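(* Let $M$ and $s$ be positive real numbers. There exists a function $\gamma$ satisfying $|\gamma(\varepsilon)|\le1$ for all $\varepsilon>0$, such that the metric entropy of the class $\mathcal{A}_s(M)$ equipped with the metric $d_{2\pi}$ can be expressed as $$H\left(\varepsilon;\mathcal{A}_s(M),d_{2\pi}\right)=\frac{2\ln(2)}{s}\left[\log^2(\varepsilon^{-1})+\log(\varepsilon^{-1})\,\log^{(2)}(\varepsilon^{-1})\left(\gamma(\varepsilon)+o_{\varepsilon\to0}(1)\right)\right].$$
   Context: $\log$ is the logarithm to base $2$, $\ln$ the natural logarithm, $\log^{(2)}=\log\circ\log$, and $\log^2(x)=(\log x)^2$. $\mathcal{A}_s(M)$ is the class of functions $f:\mathbb{R}\to\mathbb{C}$ which are $2\pi$-periodic and can be analytically continued to the strip $\mathcal{S}=\{z=x+iy\in\mathbb{C}: x\in\mathbb{R},\ |y|<s\}$ such that $\sup_{z\in\mathcal{S}}|f(z)|\le M$. The metric is $d_{2\pi}(f_1,f_2)=\sup_{x\in[0,2\pi]}|f_1(x)-f_2(x)|$. Metric entropy: for a subset $\mathcal{K}$ of a metric space $(\mathcal{X},d)$, an $\varepsilon$-covering is a set $\{x_1,\dots,x_N\}\subseteq\mathcal{X}$ such that every $x\in\mathcal{K}$ has some $i$ with $d(x,x_i)\le\varepsilon$; $N(\varepsilon;\mathcal{K},d)$ is the cardinality of a smallest $\varepsilon$-covering and $H(\varepsilon;\mathcal{K},d)=\log_2N(\varepsilon;\mathcal{K},d)$. Here the ambient space $\mathcal{X}$ is the space of continuous $2\pi$-periodic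 functions $\mathbb{R}\to\mathbb{C}$ with the metric $d_{2\pi}$. *)

(* Defs.v *)
From Stdlib Require Import Reals Lra Lia List.
From Coquelicot Require Import Coquelicot.
Open Scope R_scope.

(** [log] is to base 2; Stdlib's [ln] is the natural logarithm. *)
Definition log (x : R) : R := ln x / ln 2.

Definition sup_over {T : Type} (D : T -> Prop) (g : T -> R) : Rbar :=
  Lub_Rbar (fun r => exists x, D x /\ r = g x).

Section MetricEntropy.

(** The ambient space is the set of points of [T] satisfying [X]; centres of a
    covering need not lie in the covered set [K]. *)
Context {T : Type} (X : T -> Prop) (d : T -> T -> R).

Definition is_covering (eps : R) (K : T -> Prop) (l : list T) : Prop :=
  (forall y, In y l -> X y) /\
  (forall x, K x -> exists y, In y l /\ d x y <= eps).

(** Repetitions in [l] do not matter for the minimum. *)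
Definition is_covering_number (eps : R) (K : T -> Prop) (N : nat) : Prop :=
  (exists l, is_covering eps K l /\ length l = N) /\
  (forall l, is_covering eps K l -> (N <= length l)%nat).

(** "[H(eps; K, d)] is defined (i.e. finite coverings exist) and equals [h]". *)
Definition is_metric_entropy (eps : R) (K : T -> Prop) (h : R) : Prop :=
  exists N : nat, is_covering_number eps K N /\ h = log (INR N).

Lemma is_metric_entropy_unique (eps : R) (K : T -> Prop) (h1 h2 : R) :
  is_metric_entropy eps K h1 -> is_metric_entropy eps K h2 -> h1 = h2.
Proof.
  intros [N1 [[[l1 [c1 e1]] m1] ->]] [N2 [[[l2 [c2 e2]] m2] ->]].
  specialize (m1 _ c2). specialize (m2 _ c1).
  replace N2 with N1 by lia. reflexivity.
Qed.

End MetricEntropy.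

Definition periodic_2pi (f : R -> C) : Prop := forall x, f (x + 2 * PI) = f x.

Definition cont_periodic (f : R -> C) : Prop :=
  (forall x, continuous f x) /\ periodic_2pi f.

(** On [cont_periodic] functions the supremum is finite, so [real] loses
    nothing. *)
Definition d_2pi (f g : R -> C) : R :=
  real (sup_over (fun x => 0 <= x <= 2 * PI) (fun x => Cmod (f x - g x))).

Definition strip (s : R) (z : C) : Prop := Rabs (Im z) < s.

(** [F] is the sum of a convergent complex power series around each point of
    [D]; with [D] open this is analyticity on [D], and the values of the total
    function [F] off [D] are irrelevant. *)
Definition analytic_on (D : C -> Prop) (F : C -> C) : Prop :=
  forall z0, D z0 ->
    exists (a : nat -> C) (r : R), 0 < r /\
      forall z, Cmod (z - z0) < r ->
        @is_pseries C_AbsRing C_NormedModule a (z - z0)%C (F z).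

Definition class_A (s M : R) (f : R -> C) : Prop :=
  periodic_2pi f /\
  exists F : C -> C,
    (forall x : R, F (RtoC x) = f x) /\
    analytic_on (strip s) F /\
    Rbar_le (sup_over (strip s) (fun z => Cmod (F z))) M.

(* Main.v *)
Require Import Defs.
From Stdlib Require Import Reals Lra Lia List ZArith Psatz Classical ClassicalEpsilon.
From Coquelicot Require Import Coquelicot.
Open Scope R_scope.

(** Write [T = ln (1/eps)] and let [N] be the covering number; the claim is that
    [ln N = 2 T^2 / s], up to an error of absolute value at most
    [(2/s) T ln T + O (T)] ([entropy_two_sided]).

    A function of the class is determined by its Fourier coefficients [c_k], of size
    [M e^(- s |k|)], so that only the [d = 2 n + 1] frequencies [|k| <= n] with
    [n] about [T / s] matter at precision [eps]. Each complex coefficient contributes two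
    real dimensions, and the sum of [2 (T - s |k|)] over these frequencies is
    [2 T^2 / s]. The correction comes from the precision at which coefficients must be
    resolved, and being off by a factor [d] instead of [sqrt d] in each dimension would
    double it. Both bounds therefore use the coefficients in [l^2].

    Upper bound ([covering_upper]). The coefficients lie in an ellipsoid
    [sum |c_k|^2 e^(2 s |k|) <= const] ([trig_approximation]). Rounding them to a grid of
    mesh [eps / (4 d)] costs at most [eps / 2] in sup norm, and the lattice points of the
    ellipsoid are counted with Gaussian weights ([ellipsoid_points]).

    Lower bound ([covering_lower]). Trigonometric polynomials with coefficients on a grid
    of mesh [2 eps / sqrt d], of modulus at most [M e^(- s |k|) / d], belong to the class
    ([trig_poly_class_A]). By Parseval's identity and the same lattice point count, a ball
    of radius [eps] contains at most [const^d] of them.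

    The estimates on the Fourier coefficients need Cauchy's theorem on a rectangle. It is
    proved for sums over equidistant nodes instead of integrals. A power series satisfies
    [F (z + i tau) - F z = i (F (z + tau) - F z) + O (tau^2)], uniformly on compact
    rectangles ([analytic_regular_rectangle]). A horizontal shift by one node multiplies
    a discrete Fourier coefficient by a root of unity, so a vertical one multiplies it by
    [e^(- k tau) + O (tau^2)], and [O (1 / tau)] such steps lead to the boundary of the
    strip with error [O (tau)] ([coef_climb]). Bessel's inequality there is the ellipsoid
    bound ([coef_weighted_l2]). High frequencies are controlled by second differences
    ([coef_decay]), uniformly in the number of nodes. *)

(** * Finite sums *)

Fixpoint rsum (u : nat -> R) (N : nat) : R :=
  match N with O => 0 | S N => rsum u N + u N end.

Fixpoint csum (u : nat -> C) (N : nat) : C :=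
  match N with O => RtoC 0 | S N => (csum u N + u N)%C end.

Lemma rsum_S (u : nat -> R) (N : nat) : rsum u (S N) = rsum u N + u N.
Proof. reflexivity. Qed.

Lemma csum_S (u : nat -> C) (N : nat) : csum u (S N) = (csum u N + u N)%C.
Proof. reflexivity. Qed.

Lemma rsum_le (u v : nat -> R) (N : nat) :
  (forall i, (i < N)%nat -> u i <= v i) -> rsum u N <= rsum v N.
Proof.
  induction N as [|N IH]; simpl; intros H; [lra|].
  apply Rplus_le_compat; [apply IH; intros; apply H|apply H]; lia.
Qed.

Lemma rsum_ext (u v : nat -> R) (N : nat) :
  (forall i, (i < N)%nat -> u i = v i) -> rsum u N = rsum v N.
Proof.
  induction N as [|N IH]; simpl; intros H; [easy|].
  rewrite IH, H by (intros; try apply H; lia). easy.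
Qed.

Lemma rsum_plus (u v : nat -> R) (N : nat) :
  rsum (fun i => u i + v i) N = rsum u N + rsum v N.
Proof. induction N; simpl; [lra|]. rewrite IHN. ring. Qed.

Lemma rsum_scal (a : R) (u : nat -> R) (N : nat) :
  rsum (fun i => a * u i) N = a * rsum u N.
Proof. induction N; simpl; [lra|]. rewrite IHN. ring. Qed.

Lemma rsum_const (a : R) (N : nat) : rsum (fun _ => a) N = INR N * a.
Proof. induction N; [simpl; lra|]. rewrite S_INR. simpl rsum. rewrite IHN. ring. Qed.

Lemma rsum_ge_0 (u : nat -> R) (N : nat) :
  (forall i, (i < N)%nat -> 0 <= u i) -> 0 <= rsum u N.
Proof.
  intros H. replace 0 with (rsum (fun _ => 0) N) by (rewrite rsum_const; ring).
  now apply rsum_le.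
Qed.

Lemma rsum_first (u : nat -> R) (N : nat) :
  rsum u (S N) = u 0%nat + rsum (fun i => u (S i)) N.
Proof. induction N; [simpl; lra|]. change (rsum u (S (S N))) with (rsum u (S N) + u (S N)). rewrite IHN. simpl. ring. Qed.

Lemma rsum_split (u : nat -> R) (N K : nat) :
  rsum u (N + K) = rsum u N + rsum (fun i => u (N + i)%nat) K.
Proof.
  induction K; [rewrite Nat.add_0_r; simpl; lra|].
  rewrite Nat.add_succ_r. simpl. rewrite IHK. ring.
Qed.

Lemma rsum_monotone (u : nat -> R) (N K : nat) :
  (forall i, 0 <= u i) -> (N <= K)%nat -> rsum u N <= rsum u K.
Proof.
  intros H L. replace K with (N + (K - N))%nat by lia. rewrite rsum_split.
  assert (0 <= rsum (fun i => u (N + i)%nat) (K - N)) by (apply rsum_ge_0; auto). lra.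
Qed.

Lemma rsum_term_le (u : nat -> R) (N i : nat) :
  (forall i, 0 <= u i) -> (i < N)%nat -> u i <= rsum u N.
Proof.
  intros H L. apply Rle_trans with (rsum u (S i)).
  - simpl. assert (0 <= rsum u i) by (apply rsum_ge_0; auto). lra.
  - apply rsum_monotone; auto.
Qed.

Lemma csum_ext (u v : nat -> C) (N : nat) :
  (forall i, (i < N)%nat -> u i = v i) -> csum u N = csum v N.
Proof.
  induction N as [|N IH]; simpl; intros H; [easy|].
  rewrite IH, H by (intros; try apply H; lia). easy.
Qed.

Lemma csum_plus (u v : nat -> C) (N : nat) :
  csum (fun i => u i + v i)%C N = (csum u N + csum v N)%C.
Proof. induction N; simpl; [ring|]. rewrite IHN. ring. Qed.

Lemma csum_scal (a : C) (u : nat -> C) (N : nat) :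
  csum (fun i => a * u i)%C N = (a * csum u N)%C.
Proof. induction N; simpl; [ring|]. rewrite IHN. ring. Qed.

Lemma csum_minus (u v : nat -> C) (N : nat) :
  csum (fun i => u i - v i)%C N = (csum u N - csum v N)%C.
Proof. induction N; simpl; [ring|]. rewrite IHN. ring. Qed.

Lemma csum_split (u : nat -> C) (N K : nat) :
  csum u (N + K) = (csum u N + csum (fun i => u (N + i)%nat) K)%C.
Proof.
  induction K; [rewrite Nat.add_0_r; simpl; ring|].
  rewrite Nat.add_succ_r. simpl. rewrite IHK. ring.
Qed.

Lemma csum_swap (u : nat -> nat -> C) (N K : nat) :
  csum (fun i => csum (u i) K) N = csum (fun j => csum (fun i => u i j) N) K.
Proof.
  induction N; simpl.
  - induction K; simpl; [easy|]. rewrite <- IHK. ring.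
  - rewrite IHN, <- csum_plus. easy.
Qed.

Lemma csum_delta (u : nat -> C) (a : C) (N j : nat) :
  (j < N)%nat -> (forall i, (i < N)%nat -> i <> j -> u i = RtoC 0) -> u j = a ->
  csum u N = a.
Proof.
  intros L H <-. induction N as [|N IH]; [lia|]. simpl.
  destruct (Nat.eq_dec j N) as [->|E].
  - rewrite (csum_ext u (fun _ => RtoC 0 * RtoC 0)%C).
    + rewrite csum_scal. ring.
    + intros i Hi. rewrite H by lia. ring.
  - rewrite IH, (H N) by (try lia; intros; apply H; lia). ring.
Qed.

Lemma csum_shift (u : nat -> C) (N : nat) :
  u N = u 0%nat -> csum (fun j => u (S j)) N = csum u N.
Proof.
  intros H.
  assert (E : forall K, (csum (fun j => u (S j)) K + u 0%nat = csum u K + u K)%C).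
  { induction K; simpl; [easy|].
    replace (csum (fun j => u (S j)) K + u (S K) + u 0%nat)%C
      with (csum (fun j => u (S j)) K + u 0%nat + u (S K))%C by ring.
    rewrite IHK. ring. }
  specialize (E N). rewrite H in E.
  replace (csum (fun j => u (S j)) N)
    with (csum (fun j => u (S j)) N + u 0%nat - u 0%nat)%C by ring.
  rewrite E. ring.
Qed.

Lemma Cmod_csum_le (u : nat -> C) (N : nat) :
  Cmod (csum u N) <= rsum (fun i => Cmod (u i)) N.
Proof.
  induction N; simpl; [rewrite Cmod_0; lra|].
  eapply Rle_trans; [apply Cmod_triangle|]. lra.
Qed.

Lemma Cmod_csum_le_bound (u : nat -> C) (v : nat -> R) (N : nat) :
  (forall i, (i < N)%nat -> Cmod (u i) <= v i) -> Cmod (csum u N) <= rsum v N.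
Proof.
  intros H. eapply Rle_trans; [apply Cmod_csum_le|]. now apply rsum_le.
Qed.

Lemma RtoC_rsum (u : nat -> R) (N : nat) :
  RtoC (rsum u N) = csum (fun i => RtoC (u i)) N.
Proof. induction N; simpl; [easy|]. now rewrite RtoC_plus, IHN. Qed.

(** * Trigonometric polynomials and the discrete Fourier transform *)

Definition cis (t : R) : C := (cos t, sin t).

Lemma cis_plus (a b : R) : cis (a + b) = (cis a * cis b)%C.
Proof.
  unfold cis, Cmult; simpl. rewrite cos_plus, sin_plus. f_equal; ring.
Qed.

Lemma cis_0 : cis 0 = RtoC 1.
Proof. unfold cis. rewrite cos_0, sin_0. easy. Qed.

Lemma Cmod_cis (t : R) : Cmod (cis t) = 1.
Proof.
  unfold Cmod, cis; simpl fst; simpl snd.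
  replace (cos t ^ 2 + sin t ^ 2) with 1; [apply sqrt_1|].
  rewrite <- (sin2_cos2 t). unfold Rsqr. ring.
Qed.

Lemma Cconj_cis (t : R) : Cconj (cis t) = cis (- t).
Proof. unfold Cconj, cis; simpl. now rewrite cos_neg, sin_neg. Qed.

Lemma cis_2PI_IZR (k : Z) : cis (2 * PI * IZR k) = RtoC 1.
Proof.
  assert (P : forall n : nat, cis (2 * PI * INR n) = RtoC 1).
  { induction n; [rewrite Rmult_0_r; apply cis_0|].
    rewrite S_INR, Rmult_plus_distr_l, cis_plus, IHn, Rmult_1_r.
    unfold cis. rewrite cos_2PI, sin_2PI. unfold Cmult, RtoC; simpl. f_equal; ring. }
  destruct (Z_le_gt_dec 0 k) as [H|H].
  - replace k with (Z.of_nat (Z.to_nat k)) by lia. rewrite <- INR_IZR_INZ. apply P.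
  - specialize (P (Z.to_nat (- k))).
    rewrite INR_IZR_INZ, Z2Nat.id in P by lia.
    rewrite opp_IZR in P.
    assert (E : (cis (2 * PI * IZR k) * cis (2 * PI * - IZR k))%C = RtoC 1).
    { rewrite <- cis_plus, <- cis_0. f_equal. ring. }
    rewrite P in E. rewrite <- E. ring.
Qed.

Lemma Cmod_sq_cis_minus_1 (t : R) : Cmod (cis t - 1) ^ 2 = 4 * sin (t / 2) ^ 2.
Proof.
  rewrite Cmod2_alt.
  replace (Re (cis t - 1)) with (cos t - 1) by reflexivity.
  replace (Im (cis t - 1)) with (sin t + - 0) by reflexivity.
  replace (cos t) with (1 - 2 * sin (t / 2) * sin (t / 2))
    by (rewrite <- cos_2a_sin; f_equal; field).
  replace (sin t) with (2 * sin (t / 2) * cos (t / 2))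
    by (rewrite <- sin_2a; f_equal; field).
  pose proof (sin2_cos2 (t / 2)) as H. unfold Rsqr in H.
  set (x := sin (t / 2)) in *. set (y := cos (t / 2)) in *.
  replace (4 * x ^ 2) with (4 * x ^ 2 * (x * x + y * y)) by (rewrite H; ring).
  ring.
Qed.

Lemma cis_neq_1 (t : R) : 0 < Rabs t < 2 * PI -> cis t <> RtoC 1.
Proof.
  intros H E.
  pose proof (Cmod_sq_cis_minus_1 t) as H1. rewrite E in H1.
  replace (RtoC 1 - 1)%C with (RtoC 0) in H1 by ring.
  rewrite Cmod_0 in H1.
  assert (Z : sin (t / 2) = 0) by nra.
  unfold Rabs in H. destruct (Rcase_abs t).
  - assert (0 < sin (- (t / 2))) by (apply sin_gt_0; lra). rewrite sin_neg in H0. lra.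
  - assert (0 < sin (t / 2)) by (apply sin_gt_0; lra). lra.
Qed.

(** Enumerating the frequencies as [0, 1, -1, 2, -2, ...] makes every sum over
    [|k| <= n] an initial segment, of length [2 n + 1], of one fixed enumeration; a
    transform with many frequencies then shares its first coefficients with the
    polynomials of low degree. *)
Definition freq (i : nat) : Z :=
  if Nat.even i then (- Z.of_nat (Nat.div2 i))%Z else Z.of_nat (Nat.div2 (S i)).

Definition fr (i : nat) : R := IZR (freq i).

Definition degree (i : nat) : R := INR (Nat.div2 (S i)).

Lemma freq_odd (n : nat) : freq (2 * n + 1) = (Z.of_nat n + 1)%Z.
Proof.
  unfold freq. rewrite Nat.add_1_r.
  rewrite Nat.even_succ, <- Nat.negb_even, Nat.even_mul. simpl negb. cbv iota.
  replace (S (S (2 * n))) with (2 * (n + 1))%nat by lia.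
  rewrite Nat.div2_double. lia.
Qed.

Lemma freq_even (n : nat) : freq (2 * n) = (- Z.of_nat n)%Z.
Proof. unfold freq. rewrite Nat.even_mul. simpl orb. cbv iota. now rewrite Nat.div2_double. Qed.

Lemma degree_odd (n : nat) : degree (2 * n + 1) = INR n + 1.
Proof.
  unfold degree. replace (S (2 * n + 1)) with (2 * (n + 1))%nat by lia.
  now rewrite Nat.div2_double, plus_INR.
Qed.

Lemma degree_even (n : nat) : degree (2 * n) = INR n.
Proof. unfold degree. now rewrite Nat.div2_succ_double. Qed.

Lemma even_or_odd_index (i : nat) : exists n, i = (2 * n)%nat \/ i = (2 * n + 1)%nat.
Proof. destruct (Nat.Even_or_Odd i) as [[n H]|[n H]]; exists n; auto. Qed.

Lemma Rabs_fr (i : nat) : Rabs (fr i) = degree i.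
Proof.
  unfold fr. destruct (even_or_odd_index i) as [n [->| ->]].
  - rewrite freq_even, degree_even, opp_IZR, Rabs_Ropp, <- INR_IZR_INZ.
    apply Rabs_pos_eq, pos_INR.
  - rewrite freq_odd, degree_odd, plus_IZR, <- INR_IZR_INZ.
    apply Rabs_pos_eq. pose proof (pos_INR n). lra.
Qed.

Lemma degree_ge_0 (i : nat) : 0 <= degree i.
Proof. apply pos_INR. Qed.

Lemma degree_le (i n : nat) : (i < 2 * n + 1)%nat -> degree i <= INR n.
Proof.
  intros H. destruct (even_or_odd_index i) as [k [->| ->]].
  - rewrite degree_even. apply le_INR. lia.
  - rewrite degree_odd, <- S_INR. apply le_INR. lia.
Qed.

Lemma degree_ge_half (i : nat) : INR i / 2 <= degree i.
Proof.
  destruct (even_or_odd_index i) as [k [->| ->]].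
  - rewrite degree_even, mult_INR. simpl. lra.
  - rewrite degree_odd, plus_INR, mult_INR. simpl. lra.
Qed.

Lemma freq_bound (i n : nat) : (i < 2 * n + 1)%nat -> (Z.abs (freq i) <= Z.of_nat n)%Z.
Proof.
  intros H. destruct (even_or_odd_index i) as [k [->| ->]].
  - rewrite freq_even. lia.
  - rewrite freq_odd. lia.
Qed.

Lemma freq_inj (i j : nat) : freq i = freq j -> i = j.
Proof.
  intros H. destruct (even_or_odd_index i) as [k [->| ->]];
    destruct (even_or_odd_index j) as [l [->| ->]];
    rewrite ?freq_even, ?freq_odd in H; lia.
Qed.

Lemma rsum_degree (n : nat) : rsum degree (2 * n + 1) = INR n * (INR n + 1).
Proof.
  induction n; [simpl; unfold degree; simpl; lra|].
  replace (2 * S n + 1)%nat with (S (S (2 * n + 1))) by lia.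
  change (rsum degree (S (S (2 * n + 1))))
    with (rsum degree (2 * n + 1) + degree (2 * n + 1) + degree (S (2 * n + 1))).
  rewrite IHn. replace (S (2 * n + 1)) with (2 * (S n))%nat by lia.
  rewrite degree_odd, degree_even, S_INR. ring.
Qed.

(** The two sums of exponentials behind orthogonality, over nodes here and over
    frequencies below, both multiplied by [cis t - 1] so that they telescope. *)
Lemma geometric_cis (t : R) (N : nat) :
  ((cis t - 1) * csum (fun j => cis (INR j * t)) N = cis (INR N * t) - 1)%C.
Proof.
  induction N.
  - simpl csum. rewrite Rmult_0_l, cis_0. ring.
  - simpl csum. rewrite Cmult_plus_distr_l, IHN.
    rewrite S_INR, Rmult_plus_distr_r, Rmult_1_l, cis_plus. ring.
Qed.

Lemma dirichlet_cis (t : R) (n : nat) :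
  ((cis t - 1) * csum (fun i => cis (fr i * t)) (2 * n + 1)
   = cis ((INR n + 1) * t) - cis (- (INR n * t)))%C.
Proof.
  induction n.
  - simpl csum. unfold fr. simpl.
    rewrite !Rmult_0_l, Ropp_0, cis_0, Rplus_0_l, Rmult_1_l. ring.
  - replace (2 * S n + 1)%nat with (S (S (2 * n + 1))) by lia.
    set (f := fun i => cis (fr i * t)) in *.
    change (csum f (S (S (2 * n + 1))))
      with (csum f (2 * n + 1) + f (2 * n + 1)%nat + f (S (2 * n + 1)))%C.
    rewrite !Cmult_plus_distr_l, IHn. unfold f.
    replace (S (2 * n + 1)) with (2 * (S n))%nat by lia.
    unfold fr. rewrite freq_even, freq_odd, plus_IZR, opp_IZR, <- !INR_IZR_INZ, S_INR.
    replace ((INR n + 1 + 1) * t) with (t + (INR n + 1) * t) by ring.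
    rewrite cis_plus.
    replace (- (INR n * t)) with (t + - (INR n + 1) * t) by ring.
    rewrite cis_plus.
    replace (- ((INR n + 1) * t)) with (- (INR n + 1) * t) by ring.
    ring.
Qed.

Lemma Cmult_eq_0_cancel (a b : C) : a <> RtoC 0 -> (a * b = 0)%C -> b = RtoC 0.
Proof.
  intros Ha H. replace b with (/ a * (a * b))%C by (field; exact Ha).
  rewrite H. ring.
Qed.

(** Orthogonality over the nodes and over the frequencies both rest on this: the
    telescoped sums vanish, and the factor can be cancelled. *)
Lemma root_of_unity_neq_1 (d : Z) (Q : nat) :
  (0 < Z.abs d < Z.of_nat Q)%Z -> (cis (2 * PI / INR Q * IZR d) - 1)%C <> RtoC 0.
Proof.
  intros Hd E.
  assert (HQ : 0 < INR Q) by (apply lt_0_INR; lia).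
  set (t := 2 * PI / INR Q * IZR d) in *.
  apply (cis_neq_1 t).
  - pose proof PI_RGT_0.
    unfold t. rewrite Rabs_mult, (Rabs_pos_eq (2 * PI / INR Q))
      by (apply Rlt_le, Rdiv_lt_0_compat; lra).
    rewrite <- abs_IZR.
    assert (0 < IZR (Z.abs d)) by (apply IZR_lt; lia).
    assert (IZR (Z.abs d) < INR Q) by (rewrite INR_IZR_INZ; apply IZR_lt; lia).
    assert (0 < 2 * PI / INR Q) by (apply Rdiv_lt_0_compat; lra).
    split; [nra|].
    replace (2 * PI) with (2 * PI / INR Q * INR Q) at 2 by (field; lra). nra.
  - replace (cis t) with (cis t - 1 + 1)%C by ring. rewrite E. ring.
Qed.

Lemma csum_cis_nodes (d : Z) (Q : nat) :
  (0 < Z.abs d < Z.of_nat Q)%Z ->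
  csum (fun j => cis (IZR d * (2 * PI / INR Q * INR j))) Q = RtoC 0.
Proof.
  intros Hd.
  assert (HQ : 0 < INR Q) by (apply lt_0_INR; lia).
  set (t := 2 * PI / INR Q * IZR d).
  rewrite (csum_ext _ (fun j => cis (INR j * t)))
    by (intros; unfold t; f_equal; field; lra).
  apply Cmult_eq_0_cancel with (cis t - 1)%C; [now apply root_of_unity_neq_1|].
  rewrite geometric_cis.
  replace (INR Q * t) with (2 * PI * IZR d) by (unfold t; field; lra).
  rewrite cis_2PI_IZR. ring.
Qed.

Lemma csum_cis_freqs (d : Z) (m : nat) :
  (0 < Z.abs d < Z.of_nat (2 * m + 1))%Z ->
  csum (fun i => cis (fr i * (2 * PI / INR (2 * m + 1) * IZR d))) (2 * m + 1) = RtoC 0.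
Proof.
  intros Hd. set (Q := (2 * m + 1)%nat) in *.
  assert (HQ : 0 < INR Q) by (apply lt_0_INR; lia).
  set (t := 2 * PI / INR Q * IZR d).
  apply Cmult_eq_0_cancel with (cis t - 1)%C; [now apply root_of_unity_neq_1|].
  unfold Q at 1. rewrite dirichlet_cis.
  assert (EQ : INR Q = 2 * INR m + 1) by (unfold Q; rewrite plus_INR, mult_INR; simpl; ring).
  replace ((INR m + 1) * t) with (2 * PI * IZR d + - (INR m * t))
    by (unfold t; rewrite EQ; field; rewrite <- EQ; lra).
  rewrite cis_plus, cis_2PI_IZR. ring.
Qed.

Definition node (Q j : nat) : R := 2 * PI / INR Q * INR j.

Definition dft (Q : nat) (v : nat -> C) (k : R) : C :=
  (/ RtoC (INR Q) * csum (fun j => v j * cis (- (k * node Q j))) Q)%C.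

Lemma RtoC_neq_0 (x : R) : x <> 0 -> RtoC x <> RtoC 0.
Proof. intros H E. apply H. now injection E. Qed.

Lemma csum_const (a : C) (N : nat) : csum (fun _ => a) N = (RtoC (INR N) * a)%C.
Proof.
  induction N; [simpl; ring|]. rewrite S_INR, RtoC_plus. simpl csum. rewrite IHN. ring.
Qed.

Lemma dft_inversion (m : nat) (v : nat -> C) (j : nat) :
  let Q := (2 * m + 1)%nat in (j < Q)%nat ->
  csum (fun i => dft Q v (fr i) * cis (fr i * node Q j))%C Q = v j.
Proof.
  intros Q Hj.
  assert (HQ : INR Q <> 0) by (apply not_0_INR; lia).
  apply RtoC_neq_0 in HQ.
  unfold dft.
  rewrite (csum_ext _ (fun i => / RtoC (INR Q) *
    csum (fun l => v l * (cis (fr i * (node Q j - node Q l)))) Q)%C).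
  2:{ intros i _. rewrite <- Cmult_assoc. f_equal.
      rewrite Cmult_comm, <- csum_scal. apply csum_ext. intros l _.
      replace (fr i * (node Q j - node Q l)) with (fr i * node Q j + - (fr i * node Q l)) by ring.
      rewrite cis_plus. ring. }
  rewrite csum_scal, csum_swap.
  rewrite (csum_delta _ (RtoC (INR Q) * v j)%C Q j); [field; exact HQ|exact Hj| |].
  - intros l Hl Hlj. rewrite csum_scal.
    rewrite (csum_ext _ (fun i => cis (fr i * (2 * PI / INR Q * IZR (Z.of_nat j - Z.of_nat l))))).
    + unfold Q. rewrite csum_cis_freqs; [ring|fold Q; lia].
    + intros i _. unfold node. rewrite minus_IZR, <- !INR_IZR_INZ. f_equal. ring.
  - rewrite csum_scal, (csum_ext _ (fun _ => RtoC 1)).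
    + rewrite csum_const. ring.
    + intros i _. rewrite Rminus_diag, Rmult_0_r. apply cis_0.
Qed.

Lemma Cconj_csum (u : nat -> C) (N : nat) :
  Cconj (csum u N) = csum (fun i => Cconj (u i)) N.
Proof.
  induction N; simpl; [unfold Cconj, RtoC; simpl; now rewrite Ropp_0|].
  now rewrite Cplus_conj, IHN.
Qed.

(** Expanding one of the two factors [dft] and inverting the transform on the other
    gives Parseval's identity. *)
Lemma dft_parseval (m : nat) (v : nat -> C) :
  let Q := (2 * m + 1)%nat in
  rsum (fun i => Cmod (dft Q v (fr i)) ^ 2) Q
  = / INR Q * rsum (fun j => Cmod (v j) ^ 2) Q.
Proof.
  intros Q.
  assert (HQ : INR Q <> 0) by (apply not_0_INR; lia).
  assert (HQ' := RtoC_neq_0 _ HQ).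
  enough (E : RtoC (rsum (fun i => Cmod (dft Q v (fr i)) ^ 2) Q)
    = RtoC (/ INR Q * rsum (fun j => Cmod (v j) ^ 2) Q)) by now injection E.
  rewrite RtoC_mult, RtoC_inv, !RtoC_rsum by exact HQ.
  rewrite (csum_ext _ (fun i => dft Q v (fr i) * (/ RtoC (INR Q) *
     csum (fun j => Cconj (v j) * cis (fr i * node Q j)) Q))%C).
  2:{ intros i _. rewrite Cmod2_conj. f_equal. unfold dft at 1.
      rewrite Cmult_conj, Cconj_csum. f_equal.
      - rewrite <- RtoC_inv by exact HQ. unfold Cconj, RtoC; simpl. now rewrite Ropp_0.
      - apply csum_ext. intros j _. now rewrite Cmult_conj, Cconj_cis, Ropp_involutive. }
  rewrite (csum_ext _ (fun i => / RtoC (INR Q) *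
     csum (fun j => Cconj (v j) * (dft Q v (fr i) * cis (fr i * node Q j))) Q)%C).
  2:{ intros i _.
      replace (dft Q v (fr i) * (/ INR Q * csum (fun j => Cconj (v j) * cis (fr i * node Q j)) Q))%C
      with (/ INR Q * (dft Q v (fr i) * csum (fun j => Cconj (v j) * cis (fr i * node Q j)) Q))%C by ring.
      f_equal. rewrite <- csum_scal. apply csum_ext. intros. ring. }
  rewrite csum_scal, csum_swap. f_equal. apply csum_ext. intros j Hj.
  rewrite csum_scal. unfold Q. rewrite dft_inversion by exact Hj.
  rewrite Cmod2_conj. ring.
Qed.

Definition trig_poly (b : nat -> C) (N : nat) (x : R) : C :=
  csum (fun i => b i * cis (fr i * x))%C N.

Lemma dft_trig_poly (n : nat) (b : nat -> C) (i : nat) :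
  let Q := (2 * n + 1)%nat in (i < Q)%nat ->
  dft Q (fun j => trig_poly b Q (node Q j)) (fr i) = b i.
Proof.
  intros Q Hi.
  assert (HQ : INR Q <> 0) by (apply not_0_INR; lia).
  apply RtoC_neq_0 in HQ.
  unfold dft, trig_poly.
  rewrite (csum_ext _ (fun j => csum (fun l => b l * cis ((fr l - fr i) * node Q j)) Q)%C).
  2:{ intros j _. rewrite Cmult_comm, <- csum_scal. apply csum_ext. intros l _.
      replace ((fr l - fr i) * node Q j) with (fr l * node Q j + - (fr i * node Q j)) by ring.
      rewrite cis_plus. ring. }
  rewrite csum_swap.
  rewrite (csum_delta _ (RtoC (INR Q) * b i)%C Q i); [field; exact HQ|exact Hi| |].
  - intros l Hl Hlj. rewrite csum_scal.
    rewrite (csum_ext _ (fun j => cis (IZR (freq l - freq i) * (2 * PI / INR Q * INR j)))).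
    + rewrite csum_cis_nodes; [ring|].
      assert (freq l <> freq i) by (intros E; apply freq_inj in E; lia).
      pose proof (freq_bound i n Hi). pose proof (freq_bound l n Hl). lia.
    + intros j _. now rewrite minus_IZR.
  - rewrite csum_scal, (csum_ext _ (fun _ => RtoC 1)).
    + rewrite csum_const. ring.
    + intros j _. rewrite Rminus_diag, Rmult_0_l. apply cis_0.
Qed.

Lemma node_range (Q j : nat) : (j < Q)%nat -> 0 <= node Q j <= 2 * PI.
Proof.
  intros Hj. unfold node. pose proof PI_RGT_0.
  assert (HQ : 0 < INR Q) by (apply lt_0_INR; lia).
  assert (0 <= INR j <= INR Q) by (split; [apply pos_INR|apply le_INR; lia]).
  assert (0 < 2 * PI / INR Q) by (apply Rdiv_lt_0_compat; lra).
  split; [nra|].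
  replace (2 * PI) with (2 * PI / INR Q * INR Q) at 2 by (field; lra). nra.
Qed.

(** Coefficients are controlled in [l^2], not only one by one: in the lower bound this
    saves a factor [sqrt n] for each of them. *)
Lemma trig_poly_parseval (n : nat) (b : nat -> C) (e : R) :
  let Q := (2 * n + 1)%nat in
  (forall x, 0 <= x <= 2 * PI -> Cmod (trig_poly b Q x) <= e) ->
  rsum (fun i => Cmod (b i) ^ 2) Q <= e ^ 2.
Proof.
  intros Q H.
  assert (HQ : 0 < INR Q) by (apply lt_0_INR; lia).
  rewrite (rsum_ext _ (fun i =>
    Cmod (dft Q (fun j => trig_poly b Q (node Q j)) (fr i)) ^ 2))
    by (intros; unfold Q; now rewrite dft_trig_poly).
  unfold Q. rewrite dft_parseval. fold Q.
  apply Rle_trans with (/ INR Q * rsum (fun _ => e ^ 2) Q).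
  - apply Rmult_le_compat_l; [apply Rlt_le, Rinv_0_lt_compat, HQ|].
    apply rsum_le. intros j Hj. apply pow_incr. split; [apply Cmod_ge_0|].
    apply H. now apply node_range.
  - rewrite rsum_const. right. field. lra.
Qed.

(** * Counting lattice points *)

Lemma one_le_INR (n : nat) : (0 < n)%nat -> 1 <= INR n.
Proof. intros H. apply (le_INR 1). lia. Qed.

Lemma exp_le_exp (x y : R) : x <= y -> exp x <= exp y.
Proof. intros [H| ->]; [left; now apply exp_increasing|lra]. Qed.

Lemma geometric_sum_le (q : R) (N : nat) :
  0 <= q < 1 -> rsum (fun i => q ^ i) N <= / (1 - q).
Proof.
  intros H. apply Rmult_le_reg_l with (1 - q); [lra|]. rewrite Rinv_r by lra.
  assert (E : (1 - q) * rsum (fun i => q ^ i) N = 1 - q ^ N).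
  { induction N; simpl; [ring|]. rewrite Rmult_plus_distr_l, IHN. ring. }
  rewrite E. assert (0 <= q ^ N) by (apply pow_le; lra). lra.
Qed.

(** An upper bound for the theta sum of [exp (- (x p)^2)] over all integers [p]. *)
Definition theta_bound (x : R) : R := 2 * exp 1 * (1 + / (2 * x)).

Lemma theta_bound_pos (x : R) : 0 < x -> 0 < theta_bound x.
Proof.
  intros H. unfold theta_bound. assert (0 < / (2 * x)) by (apply Rinv_0_lt_compat; lra).
  pose proof (exp_pos 1). apply Rmult_lt_0_compat; lra.
Qed.

(** The factor 2 accounts for the two signs of an integer; zero is counted twice,
    which costs only a constant. *)
Lemma gaussian_sum_le (x : R) (N : nat) :
  0 < x -> rsum (fun i => 2 * exp (- (x * INR i) ^ 2)) N <= theta_bound x.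
Proof.
  intros Hx. set (q := exp (- (2 * x))).
  assert (Hq : 0 <= q <= / (1 + 2 * x)).
  { split; [apply Rlt_le, exp_pos|]. unfold q. rewrite exp_Ropp.
    apply Rinv_le_contravar; [lra|]. pose proof (exp_ineq1_le (2 * x)). lra. }
  assert (Hq1 : / (1 + 2 * x) < 1).
  { apply Rmult_lt_reg_r with (1 + 2 * x); [lra|]. rewrite Rinv_l; lra. }
  apply Rle_trans with (rsum (fun i => (2 * exp 1) * q ^ i) N).
  - apply rsum_le. intros i _. rewrite Rmult_assoc. apply Rmult_le_compat_l; [lra|].
    replace (q ^ i) with (exp (INR i * - (2 * x))).
    + (* completing the square: [t ^ 2 >= 2 t - 1] *)
      rewrite <- exp_plus. apply exp_le_exp.
      pose proof (pow2_ge_0 (x * INR i - 1)). nra.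
    + unfold q. clear. induction i; [simpl; rewrite Rmult_0_l; apply exp_0|].
      rewrite S_INR, Rmult_plus_distr_r, exp_plus, IHi. simpl. rewrite Rmult_1_l. ring.
  - rewrite rsum_scal. unfold theta_bound. apply Rmult_le_compat_l; [pose proof (exp_pos 1); lra|].
    eapply Rle_trans; [apply geometric_sum_le; lra|].
    replace (1 + / (2 * x)) with (/ (1 - / (1 + 2 * x))).
    + apply Rinv_le_contravar; lra.
    + field. lra.
Qed.

(** Each point [p] of the ellipsoid [sum (x_i p_i)^2 <= r] has weight
    [exp (r - sum (x_i p_i)^2) >= 1], and the total weight of all integer points is a
    product of one-dimensional theta sums. With [r = d] the first factor costs only a
    constant per dimension, while the count beats that of the circumscribed box by
    [sqrt d] per dimension; this is what bounds [gamma] by 1 rather than by 2. *)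
Lemma ellipsoid_points (d : nat) : forall (x : nat -> R) (r : R),
  (forall i, 0 < x i) ->
  exists l : list (list Z),
    INR (length l) <= exp (r + rsum (fun i => ln (theta_bound (x i))) d) /\
    forall p, length p = d ->
      rsum (fun i => (x i * IZR (nth i p 0%Z)) ^ 2) d <= r -> In p l.
Proof.
  induction d as [|d IH]; intros x r Hx.
  - destruct (Rle_dec 0 r) as [H|H].
    + exists (nil :: nil). split.
      * simpl. rewrite Rplus_0_r. pose proof (exp_ineq1_le r). lra.
      * intros [|? ?] Hp _; [now left|discriminate].
    + exists nil. split; [simpl; apply Rlt_le, exp_pos|]. intros p _ Hp. simpl in Hp. lra.
  - set (w := rsum (fun i => ln (theta_bound (x (S i)))) d).
    assert (A : forall P : nat, exists l : list (list Z),
      INR (length l) <= rsum (fun i => 2 * exp (- (x 0%nat * INR i) ^ 2)) P * exp (r + w) /\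
      forall z p, (Z.abs z < Z.of_nat P)%Z -> length p = d ->
        (x 0%nat * IZR z) ^ 2 + rsum (fun i => (x (S i) * IZR (nth i p 0%Z)) ^ 2) d <= r ->
        In (z :: p) l).
    { induction P as [|P [l [Hl1 Hl2]]].
      - exists nil. split; [simpl; lra|]. intros; lia.
      - destruct (IH (fun i => x (S i)) (r - (x 0%nat * INR P) ^ 2)) as [l' [H1 H2]];
          [auto|]. fold w in H1.
        exists (l ++ map (cons (Z.of_nat P)) l' ++ map (cons (- Z.of_nat P)%Z) l').
        split.
        + rewrite !length_app, !length_map, !plus_INR, rsum_S.
          replace (r - (x 0%nat * INR P) ^ 2 + w) with (- (x 0%nat * INR P) ^ 2 + (r + w)) in H1 by ring.
          rewrite exp_plus in H1. lra.
        + intros z p Hz Hp Hs.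
          destruct (Z_lt_le_dec (Z.abs z) (Z.of_nat P)) as [Hz'|Hz'];
            [apply in_or_app; left; now apply Hl2|].
          assert (Ez : z = Z.of_nat P \/ z = (- Z.of_nat P)%Z) by lia.
          assert (In p l').
          { apply H2; [exact Hp|].
            replace (x 0%nat * INR P) with (x 0%nat * IZR (Z.of_nat P))
              by (now rewrite INR_IZR_INZ).
            destruct Ez as [->| ->]; rewrite ?opp_IZR in Hs; nra. }
          apply in_or_app; right. apply in_or_app.
          destruct Ez as [->| ->]; [left|right]; now apply in_map. }
    pose proof (Hx 0%nat) as H0.
    destruct (INR_unbounded (r / x 0%nat ^ 2)) as [P HP].
    destruct (A P) as [l [Hl1 Hl2]]. exists l. split.
    + eapply Rle_trans; [exact Hl1|]. rewrite rsum_first. fold w.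
      replace (r + (ln (theta_bound (x 0%nat)) + w)) with (ln (theta_bound (x 0%nat)) + (r + w)) by ring.
      rewrite (exp_plus (ln _)), exp_ln by (now apply theta_bound_pos).
      apply Rmult_le_compat_r; [apply Rlt_le, exp_pos|]. now apply gaussian_sum_le.
    + intros [|z p] Hp Hs; [discriminate|]. injection Hp as Hp.
      rewrite rsum_first in Hs. simpl nth in Hs.
      apply Hl2; [|exact Hp|exact Hs].
      assert (S0 : 0 <= rsum (fun i => (x (S i) * IZR (nth i p 0%Z)) ^ 2) d)
        by (apply rsum_ge_0; intros; apply pow2_ge_0).
      apply lt_IZR. rewrite <- INR_IZR_INZ. eapply Rle_lt_trans; [|exact HP].
      assert (IZR (Z.abs z) <= IZR z ^ 2) by (simpl; rewrite Rmult_1_r, <- mult_IZR; apply IZR_le; nia).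
      apply Rle_trans with (IZR z ^ 2); [easy|].
      apply Rmult_le_reg_r with (x 0%nat ^ 2); [nra|].
      replace (r / x 0%nat ^ 2 * x 0%nat ^ 2) with r by (field; lra). nra.
Qed.

(** Nonnegative integers suffice: there are [floor X + 1 >= X] of them up to [X]. *)
Lemma box_points (d : nat) : forall X : nat -> R,
  (forall i, 0 < X i) ->
  exists l : list (list Z), NoDup l /\
    (forall p, In p l -> length p = d /\
       forall i, (i < d)%nat -> 0 <= IZR (nth i p 0%Z) <= X i) /\
    exp (rsum (fun i => ln (X i)) d) <= INR (length l).
Proof.
  induction d as [|d IH]; intros X HX.
  - exists (nil :: nil). split; [repeat constructor; simpl; tauto|]. split.
    + intros p [<-|[]]. split; [easy|]. intros; lia.
    + simpl. rewrite exp_0. lra.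
  - destruct (IH (fun i => X (S i))) as [l' [N' [H' L']]]; [auto|].
    assert (A : forall P : nat, exists l : list (list Z), NoDup l /\
      (forall p, In p l -> exists k p', (k < P)%nat /\ In p' l' /\ p = Z.of_nat k :: p') /\
      length l = (P * length l')%nat).
    { induction P as [|P [l [H1 [H2 H3]]]].
      - exists nil. split; [constructor|]. split; [intros _ []|easy].
      - exists (map (cons (Z.of_nat P)) l' ++ l). split; [|split].
        + apply NoDup_app.
          * apply NoDup_map_NoDup_ForallPairs; [|easy]. intros a b _ _ E. congruence.
          * easy.
          * intros a Ha Hb. apply in_map_iff in Ha as [a' [<- _]].
            apply H2 in Hb as [k [p' [Hk [_ E]]]]. injection E as E _. lia.
        + intros p Hp. apply in_app_or in Hp as [Hp|Hp].
          * apply in_map_iff in Hp as [p' [<- Hp]]. exists P, p'. auto.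
          * apply H2 in Hp as [k [p' [Hk Hp]]]. exists k, p'. split; [lia|auto].
        + rewrite length_app, length_map, H3. simpl. lia. }
    pose proof (HX 0%nat) as H0.
    destruct (nfloor_ex (X 0%nat)) as [P [HP1 HP2]]; [lra|].
    destruct (A (S P)) as [l [H1 [H2 H3]]]. exists l. split; [easy|]. split.
    + intros p Hp. apply H2 in Hp as [k [p' [Hk [Hp ->]]]].
      apply H' in Hp as [Hl Hp]. split; [simpl; lia|].
      intros [|i] Hi; simpl nth.
      * rewrite <- INR_IZR_INZ. split; [apply pos_INR|].
        apply Rle_trans with (INR P); [apply le_INR; lia|easy].
      * apply Hp. lia.
    + rewrite rsum_first, exp_plus, exp_ln, H3, mult_INR by auto.
      apply Rmult_le_compat; [lra|apply Rlt_le, exp_pos|rewrite S_INR; lra|exact L'].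
Qed.

(** Pigeonhole principle, for a relation [rel] instead of a map from [V] to [l]. *)
Lemma length_le_fibers {A B : Type} (rel : A -> B -> Prop) (V : list A) (K : nat) :
  NoDup V ->
  (forall y, exists W : list A, (length W <= K)%nat /\ forall v, In v V -> rel v y -> In v W) ->
  forall l : list B, (forall v, In v V -> exists y, In y l /\ rel v y) ->
  (length V <= length l * K)%nat.
Proof.
  intros HV HW l Hl.
  assert (A1 : exists W : list A, (length W <= length l * K)%nat /\
    forall v, In v V -> (exists y, In y l /\ rel v y) -> In v W).
  { clear Hl. induction l as [|y l [W [H1 H2]]].
    - exists nil. split; [easy|]. intros v _ [y [[] _]].
    - destruct (HW y) as [W' [H3 H4]]. exists (W' ++ W). split.
      + rewrite length_app. simpl. lia.
      + intros v Hv [z [[->|Hz] Hr]]; apply in_or_app; [left; auto|right; eauto]. }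
  destruct A1 as [W [H1 H2]].
  apply Nat.le_trans with (length W); [|exact H1].
  apply NoDup_incl_length; [exact HV|]. intros v Hv. auto.
Qed.

(** * Power series: second-order regularity and the identity theorem *)

Lemma pow_n_Cpow (w : C) (n : nat) : @pow_n C_Ring w n = (w ^ n)%C.
Proof. induction n; [easy|]. simpl. now rewrite IHn. Qed.

Lemma sum_n_csum (a : nat -> C) (w : C) (n : nat) :
  sum_n (fun k => @scal C_AbsRing C_NormedModule (@pow_n C_AbsRing w k) (a k)) n
  = csum (fun k => a k * w ^ k)%C (S n).
Proof.
  induction n.
  - rewrite sum_O. simpl csum. change (pow_n w 0) with (RtoC 1).
    change (RtoC 1 * a 0%nat = 0 + a 0%nat * RtoC 1)%C. ring.
  - rewrite sum_Sn, IHn, (csum_S _ (S n)).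
    change (pow_n w (S n)) with (@pow_n C_Ring w (S n)). rewrite pow_n_Cpow.
    change (csum (fun k => a k * w ^ k) (S n) + w ^ S n * a (S n)
      = csum (fun k => a k * w ^ k) (S n) + a (S n) * w ^ S n)%C. ring.
Qed.

Lemma is_pseries_csum (a : nat -> C) (w l : C) :
  @is_pseries C_AbsRing C_NormedModule a w l <->
  forall eta, 0 < eta -> exists N0, forall N, (N0 <= N)%nat ->
    Cmod (csum (fun k => a k * w ^ k)%C N - l) < eta.
Proof.
  unfold is_pseries, is_series.
  pose proof (@filterlim_locally_ball_norm C_AbsRing nat C_NormedModule eventually _
    (sum_n (fun k => @scal C_AbsRing C_NormedModule (@pow_n C_AbsRing w k) (a k))) l) as E.
  split.
  - intros H eta He. pose proof (proj1 E H) as H'. clear H. rename H' into H. destruct (H (mkposreal eta He)) as [N0 HN]. exists (S N0).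
    intros [|N] HN'; [lia|]. specialize (HN N ltac:(lia)).
    unfold ball_norm in HN. rewrite sum_n_csum in HN. exact HN.
  - intros H. refine (proj2 E _). intros eta. destruct (H eta (cond_pos eta)) as [N0 HN]. exists N0.
    intros N HN'. unfold ball_norm. rewrite sum_n_csum. apply (HN (S N)). lia.
Qed.

Lemma pseries_coef_bound (a : nat -> C) (rho : R) (l : C) :
  0 < rho -> @is_pseries C_AbsRing C_NormedModule a (RtoC rho) l ->
  exists B, 0 <= B /\ forall k, Cmod (a k) * rho ^ k <= B.
Proof.
  intros Hr H. rewrite is_pseries_csum in H.
  destruct (H 1 Rlt_0_1) as [N0 HN].
  set (u := fun k => (a k * RtoC rho ^ k)%C) in *.
  assert (Hu : forall k, Cmod (u k) = Cmod (a k) * rho ^ k).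
  { intros k. unfold u. rewrite Cmod_mult, Cmod_pow, Cmod_R, Rabs_pos_eq by lra. easy. }
  assert (H0 : 0 <= rsum (fun k => Cmod (u k)) N0) by (apply rsum_ge_0; intros; apply Cmod_ge_0).
  exists (rsum (fun k => Cmod (u k)) N0 + 2). split; [lra|].
  intros k. rewrite <- Hu. destruct (le_lt_dec N0 k) as [Hk|Hk].
  - pose proof (HN k Hk) as H1. pose proof (HN (S k) ltac:(lia)) as H2.
    rewrite csum_S in H2.
    replace (u k) with ((csum u k + u k - l) + - (csum u k - l))%C by ring.
    eapply Rle_trans; [apply Cmod_triangle|]. rewrite Cmod_opp. lra.
  - pose proof (rsum_term_le (fun k => Cmod (u k)) N0 k (fun i => Cmod_ge_0 _) Hk).
    simpl in H1. lra.
Qed.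

Lemma Cmod_triangle4 (a b c d : C) :
  Cmod (a + b + c + d) <= Cmod a + Cmod b + Cmod c + Cmod d.
Proof.
  do 2 (eapply Rle_trans; [apply Cmod_triangle|]; apply Rplus_le_compat_r).
  apply Cmod_triangle.
Qed.

Definition taylor_rest (w h : C) (n : nat) : C :=
  ((w + h) ^ n - w ^ n - RtoC (INR n) * w ^ pred n * h)%C.

(** By the recurrence [rest (n + 1) = (w + h) rest n + n w^(n-1) h^2]. The factor
    [r ^ 2] on the left stands for an exponent [n - 2] on the right. *)
Lemma taylor_rest_bound (w h : C) (r : R) (n : nat) :
  Cmod w <= r -> Cmod (w + h) <= r ->
  r ^ 2 * Cmod (taylor_rest w h n) <= INR n ^ 2 * r ^ n * Cmod h ^ 2.
Proof.
  intros Hw Hwh.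
  assert (Hr : 0 <= r) by (pose proof (Cmod_ge_0 w); lra).
  pose proof (Cmod_ge_0 h) as Hh.
  induction n.
  - unfold taylor_rest. simpl pred. simpl INR.
    replace ((w + h) ^ 0 - w ^ 0 - 0 * w ^ 0 * h)%C with (RtoC 0) by (simpl; ring).
    rewrite Cmod_0. lra.
  - assert (E : taylor_rest w h (S n)
      = ((w + h) * taylor_rest w h n + RtoC (INR n) * w ^ pred n * (h * h))%C).
    { unfold taylor_rest. destruct n as [|n]; [simpl; ring|].
      simpl pred. rewrite (S_INR (S n)), RtoC_plus.
      change ((w + h) ^ S (S n))%C with ((w + h) * ((w + h) * (w + h) ^ n))%C.
      change ((w + h) ^ S n)%C with ((w + h) * (w + h) ^ n)%C.
      change (w ^ S (S n))%C with (w * (w * w ^ n))%C.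
      change (w ^ S n)%C with (w * w ^ n)%C. ring. }
    rewrite E.
    assert (B : r ^ 2 * Cmod (RtoC (INR n) * w ^ pred n * (h * h)) <= INR n * r ^ S n * Cmod h ^ 2).
    { rewrite !Cmod_mult, Cmod_R, Cmod_pow, Rabs_pos_eq by apply pos_INR.
      destruct n as [|n]; [simpl INR; rewrite !Rmult_0_l; lra|].
      simpl pred.
      replace (r ^ 2 * (INR (S n) * Cmod w ^ n * (Cmod h * Cmod h)))
        with (INR (S n) * r ^ 2 * Cmod h ^ 2 * Cmod w ^ n) by ring.
      replace (INR (S n) * r ^ S (S n) * Cmod h ^ 2)
        with (INR (S n) * r ^ 2 * Cmod h ^ 2 * r ^ n) by (simpl; ring).
      apply Rmult_le_compat_l.
      - pose proof (pos_INR (S n)).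
        repeat apply Rmult_le_pos; try lra; try apply pow2_ge_0.
      - apply pow_incr. split; [apply Cmod_ge_0|exact Hw]. }
    apply Rle_trans with (r * (r ^ 2 * Cmod (taylor_rest w h n))
      + INR n * r ^ S n * Cmod h ^ 2).
    + eapply Rle_trans; [apply Rmult_le_compat_l; [apply pow2_ge_0|apply Cmod_triangle]|].
      rewrite Rmult_plus_distr_l, Cmod_mult. apply Rplus_le_compat; [|exact B].
      replace (r ^ 2 * (Cmod (w + h) * Cmod (taylor_rest w h n)))
        with (Cmod (w + h) * (r ^ 2 * Cmod (taylor_rest w h n))) by ring.
      apply Rmult_le_compat_r; [|exact Hwh].
      apply Rmult_le_pos; [apply pow2_ge_0|apply Cmod_ge_0].
    + apply Rle_trans with (r * (INR n ^ 2 * r ^ n * Cmod h ^ 2) + INR n * r ^ S n * Cmod h ^ 2).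
      { apply Rplus_le_compat_r, Rmult_le_compat_l; [lra|exact IHn]. }
      rewrite S_INR. simpl (r ^ S n).
      replace (r * (INR n ^ 2 * r ^ n * Cmod h ^ 2) + INR n * (r * r ^ n) * Cmod h ^ 2)
        with ((INR n ^ 2 + INR n) * (r * r ^ n * Cmod h ^ 2)) by ring.
      replace ((INR n + 1) ^ 2 * (r * r ^ n) * Cmod h ^ 2)
        with ((INR n + 1) ^ 2 * (r * r ^ n * Cmod h ^ 2)) by ring.
      apply Rmult_le_compat_r.
      * assert (0 <= r ^ n) by (now apply pow_le).
        repeat apply Rmult_le_pos; lra.
      * pose proof (pos_INR n). nra.
Qed.

Lemma square_le_pow2 (n : nat) : INR n ^ 2 <= 3 * 2 ^ n.
Proof.
  assert (H : INR n ^ 2 + 2 * INR n + 3 <= 3 * 2 ^ n).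
  { induction n; [simpl; lra|]. rewrite S_INR. simpl (2 ^ S n). pose proof (pos_INR n). nra. }
  pose proof (pos_INR n). lra.
Qed.

(** If [F] has complex derivative [p] at [z], both products are [h1 h2 p] to first
    order. Their difference thus sees the second-order remainder without naming [p];
    for [h1 = i h2] it is a discrete Cauchy-Riemann equation, and for [h1 = - h2] a
    second difference. *)
Definition skew_difference (F : C -> C) (z h1 h2 : C) : C :=
  (h2 * (F (z + h1) - F z) - h1 * (F (z + h2) - F z))%C.

(** The first-order terms cancel in each monomial, and the remainders of the monomials
    are summable well inside the disc of convergence. The estimate is made on partial
    sums and then passes to the limit. *)
Lemma pseries_skew_difference (a : nat -> C) (rho B : R) (w h1 h2 f0 f1 f2 : C) :
  0 < rho -> 0 <= B -> (forall k, Cmod (a k) * rho ^ k <= B) ->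
  Cmod w <= rho / 8 -> Cmod h1 <= rho / 8 -> Cmod h2 <= rho / 8 ->
  @is_pseries C_AbsRing C_NormedModule a w f0 ->
  @is_pseries C_AbsRing C_NormedModule a (w + h1)%C f1 ->
  @is_pseries C_AbsRing C_NormedModule a (w + h2)%C f2 ->
  Cmod (h2 * (f1 - f0) - h1 * (f2 - f0)) <=
    96 * B / rho ^ 2 * (Cmod h1 * Cmod h2 * (Cmod h1 + Cmod h2)).
Proof.
  intros Hr HB Ha Hw H1 H2 P0 P1 P2.
  rewrite is_pseries_csum in P0, P1, P2.
  set (V := Cmod h1 * Cmod h2 * (Cmod h1 + Cmod h2)).
  pose proof (Cmod_ge_0 h1) as G1. pose proof (Cmod_ge_0 h2) as G2.
  pose proof (Cmod_ge_0 w) as G0.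
  assert (HV : 0 <= V) by (unfold V; repeat apply Rmult_le_pos; lra).
  set (r := rho / 4).
  assert (Hr' : 0 < r) by (unfold r; lra).
  assert (W1 : Cmod (w + h1) <= r) by (eapply Rle_trans; [apply Cmod_triangle|unfold r; lra]).
  assert (W2 : Cmod (w + h2) <= r) by (eapply Rle_trans; [apply Cmod_triangle|unfold r; lra]).
  assert (T : forall n, Cmod (a n * (h2 * taylor_rest w h1 n - h1 * taylor_rest w h2 n)) <=
    3 * B * V / r ^ 2 * (/ 2) ^ n).
  { intros n. rewrite Cmod_mult.
    apply Rmult_le_reg_l with (r ^ 2); [nra|].
    pose proof (taylor_rest_bound w h1 r n ltac:(unfold r; lra) W1) as R1.
    pose proof (taylor_rest_bound w h2 r n ltac:(unfold r; lra) W2) as R2.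
    assert (E : r ^ 2 * Cmod (h2 * taylor_rest w h1 n - h1 * taylor_rest w h2 n)
      <= INR n ^ 2 * r ^ n * V).
    { apply Rle_trans with (r ^ 2 * (Cmod h2 * Cmod (taylor_rest w h1 n)
        + Cmod h1 * Cmod (taylor_rest w h2 n))).
      - apply Rmult_le_compat_l; [nra|]. unfold Cminus.
        eapply Rle_trans; [apply Cmod_triangle|]. rewrite Cmod_opp, !Cmod_mult. lra.
      - replace (r ^ 2 * (Cmod h2 * Cmod (taylor_rest w h1 n) + Cmod h1 * Cmod (taylor_rest w h2 n)))
          with (Cmod h2 * (r ^ 2 * Cmod (taylor_rest w h1 n))
            + Cmod h1 * (r ^ 2 * Cmod (taylor_rest w h2 n))) by ring.
        replace (INR n ^ 2 * r ^ n * V) with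
          (Cmod h2 * (INR n ^ 2 * r ^ n * Cmod h1 ^ 2) + Cmod h1 * (INR n ^ 2 * r ^ n * Cmod h2 ^ 2))
          by (unfold V; ring).
        apply Rplus_le_compat; apply Rmult_le_compat_l; assumption. }
    apply Rle_trans with (Cmod (a n) * (INR n ^ 2 * r ^ n * V)).
    { replace (r ^ 2 * (Cmod (a n) * Cmod (h2 * taylor_rest w h1 n - h1 * taylor_rest w h2 n)))
        with (Cmod (a n) * (r ^ 2 * Cmod (h2 * taylor_rest w h1 n - h1 * taylor_rest w h2 n))) by ring.
      apply Rmult_le_compat_l; [apply Cmod_ge_0|exact E]. }
    replace (r ^ 2 * (3 * B * V / r ^ 2 * (/ 2) ^ n)) with (B * V * (3 * (/ 2) ^ n)) by (field; lra).
    replace (r ^ n) with (rho ^ n * ((/ 2) ^ n * (/ 2) ^ n)).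
    2:{ unfold r. rewrite <- !Rpow_mult_distr. f_equal. field. }
    replace (Cmod (a n) * (INR n ^ 2 * (rho ^ n * ((/ 2) ^ n * (/ 2) ^ n)) * V))
      with (Cmod (a n) * rho ^ n * V * (INR n ^ 2 * ((/ 2) ^ n * (/ 2) ^ n))) by ring.
    assert (Hp : 0 < (/ 2) ^ n) by (apply pow_lt; lra).
    assert (Hpp : (/ 2) ^ n * 2 ^ n = 1).
    { rewrite <- Rpow_mult_distr. replace (/ 2 * 2) with 1 by field. apply pow1. }
    apply Rmult_le_compat.
    - repeat apply Rmult_le_pos; try lra; [apply Cmod_ge_0|apply pow_le; lra].
    - apply Rmult_le_pos; [apply pow2_ge_0|nra].
    - apply Rmult_le_compat_r; [exact HV|apply Ha].
    - pose proof (square_le_pow2 n).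
      apply Rle_trans with (3 * 2 ^ n * ((/ 2) ^ n * (/ 2) ^ n)); [|].
      + apply Rmult_le_compat_r; [nra|lra].
      + right. replace (3 * 2 ^ n * ((/ 2) ^ n * (/ 2) ^ n))
          with (3 * ((/ 2) ^ n * 2 ^ n) * (/ 2) ^ n) by ring. rewrite Hpp. ring. }
  apply le_epsilon. intros eta Heta.
  set (e := eta / (2 * (Cmod h1 + Cmod h2) + 1)).
  assert (He : 0 < e) by (apply Rdiv_lt_0_compat; lra).
  destruct (P0 e He) as [N0 Q0]. destruct (P1 e He) as [N1 Q1]. destruct (P2 e He) as [N2 Q2].
  set (N := (N0 + N1 + N2)%nat).
  specialize (Q0 N ltac:(unfold N; lia)). specialize (Q1 N ltac:(unfold N; lia)).
  specialize (Q2 N ltac:(unfold N; lia)).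
  set (g0 := csum (fun k => a k * w ^ k)%C N) in *.
  set (g1 := csum (fun k => a k * (w + h1) ^ k)%C N) in *.
  set (g2 := csum (fun k => a k * (w + h2) ^ k)%C N) in *.
  assert (EG : (h2 * (g1 - g0) - h1 * (g2 - g0))%C
    = csum (fun n => a n * (h2 * taylor_rest w h1 n - h1 * taylor_rest w h2 n))%C N).
  { unfold g0, g1, g2. rewrite <- !csum_minus, <- !csum_scal, <- csum_minus.
    apply csum_ext. intros n _. unfold taylor_rest. ring. }
  assert (BG : Cmod (h2 * (g1 - g0) - h1 * (g2 - g0)) <= 96 * B / rho ^ 2 * V).
  { rewrite EG. eapply Rle_trans; [apply Cmod_csum_le_bound; intros; apply T|].
    rewrite rsum_scal.
    apply Rle_trans with (3 * B * V / r ^ 2 * / (1 - / 2)).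
    - apply Rmult_le_compat_l; [|apply geometric_sum_le; lra].
      apply Rmult_le_pos; [|apply Rlt_le, Rinv_0_lt_compat; nra].
      repeat apply Rmult_le_pos; lra.
    - right. unfold r. field. lra. }
  replace (h2 * (f1 - f0) - h1 * (f2 - f0))%C
    with ((h2 * (g1 - g0) - h1 * (g2 - g0)) +
      (- (h2 * (g1 - f1)) + (h2 * (g0 - f0)) + (h1 * (g2 - f2)) + - (h1 * (g0 - f0))))%C by ring.
  eapply Rle_trans; [apply Cmod_triangle|]. apply Rplus_le_compat; [exact BG|].
  eapply Rle_trans; [apply Cmod_triangle4|].
  rewrite !Cmod_opp, !Cmod_mult.
  apply Rle_trans with (Cmod h2 * e + Cmod h2 * e + Cmod h1 * e + Cmod h1 * e).
  - repeat apply Rplus_le_compat; apply Rmult_le_compat_l; lra.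
  - replace eta with (e * (2 * (Cmod h1 + Cmod h2) + 1)) by (unfold e; field; lra). nra.
Qed.

(** The bound is of third order in the steps, one more than the trivial order of
    [skew_difference] for a merely Lipschitz function. *)
Definition regular_near (F : C -> C) (rho K : R) (z : C) : Prop :=
  forall h1 h2, Cmod h1 <= rho -> Cmod h2 <= rho ->
    Cmod (skew_difference F z h1 h2) <= K * (Cmod h1 * Cmod h2 * (Cmod h1 + Cmod h2)).

Lemma analytic_regular (D : C -> Prop) (F : C -> C) (z0 : C) :
  analytic_on D F -> D z0 ->
  exists rho, 0 < rho /\ exists K, 0 <= K /\ forall z, Cmod (z - z0) <= rho -> regular_near F rho K z.
Proof.
  intros HF Hz0. destruct (HF z0 Hz0) as [a [r [Hr Ha]]].
  assert (Hr2 : Cmod (RtoC (r / 2)) < r) by (rewrite Cmod_R, Rabs_pos_eq; lra).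
  destruct (pseries_coef_bound a (r / 2) (F (z0 + RtoC (r / 2))%C)) as [B [HB HaB]]; [lra| |].
  { replace (RtoC (r / 2)) with (z0 + RtoC (r / 2) - z0)%C at 1 by ring.
    apply Ha. now replace (z0 + RtoC (r / 2) - z0)%C with (RtoC (r / 2)) by ring. }
  exists (r / 16). split; [lra|].
  exists (96 * B / (r / 2) ^ 2). split.
  { apply Rmult_le_pos; [lra|]. apply Rlt_le, Rinv_0_lt_compat. nra. }
  intros z Hz h1 h2 H1 H2. unfold skew_difference.
  pose proof (Cmod_triangle (z - z0) h1) as T1.
  pose proof (Cmod_triangle (z - z0) h2) as T2.
  apply (pseries_skew_difference a (r / 2) B (z - z0)%C); try lra; try exact HaB.
  - apply Ha. lra.
  - replace (z - z0 + h1)%C with (z + h1 - z0)%C in * by ring. apply Ha. lra.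
  - replace (z - z0 + h2)%C with (z + h2 - z0)%C in * by ring. apply Ha. lra.
Qed.

Lemma Cmod_pair_le (x y : R) : Cmod (x, y) <= Rabs x + Rabs y.
Proof.
  replace (x, y) with (RtoC x + RtoC y * Ci)%C
    by (unfold Cplus, Cmult, RtoC, Ci; simpl; f_equal; ring).
  eapply Rle_trans; [apply Cmod_triangle|]. rewrite Cmod_mult, !Cmod_R, Cmod_Ci. lra.
Qed.

(** Compactness of the rectangle. A single number [d] serves as radius, with [/ d] as
    constant, so that a Lebesgue number of the cover controls both at once. *)
Lemma analytic_regular_rectangle (s s' : R) (F : C -> C) :
  s' < s -> analytic_on (strip s) F ->
  exists rho, 0 < rho /\ exists K, 0 <= K /\
    forall x y, 0 <= x <= 2 * PI -> Rabs y <= s' -> regular_near F rho K (x, y).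
Proof.
  intros Hs HF.
  assert (L : forall p : R * R, exists d : posreal, Rabs (snd p) <= s' ->
    forall z, Cmod (z - p) <= 2 * d -> regular_near F d (/ d) z).
  { intros [u v]. simpl. destruct (Rle_dec (Rabs v) s') as [Hv|Hv].
    - destruct (analytic_regular _ F (u, v) HF) as [rho [Hr [K [HK H]]]].
      { unfold strip. simpl. lra. }
      assert (Hd : 0 < Rmin (rho / 2) (/ (K + 1))).
      { apply Rmin_pos; [lra|]. apply Rinv_0_lt_compat; lra. }
      (* halving leaves room for points that are only near the centre *)
      exists (mkposreal _ Hd). intros _ z Hz h1 h2 H1 H2. simpl in *.
      pose proof (Rmin_l (rho / 2) (/ (K + 1))). pose proof (Rmin_r (rho / 2) (/ (K + 1))).
      eapply Rle_trans; [apply (H z); lra|].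
      apply Rmult_le_compat_r.
      + pose proof (Cmod_ge_0 h1). pose proof (Cmod_ge_0 h2).
        repeat apply Rmult_le_pos; lra.
      + apply Rle_trans with (K + 1); [lra|].
        apply Rle_trans with (/ / (K + 1)); [right; now rewrite Rinv_inv|].
        apply Rinv_le_contravar; [exact Hd|lra].
    - exists (mkposreal 1 Rlt_0_1). intros; lra. }
  set (delta := fun u v =>
    proj1_sig (constructive_indefinite_description _ (L (u, v)))).
  destruct (compactness_value_2d 0 (2 * PI) (- s') s' delta) as [d Hd].
  exists d. split; [apply cond_pos|]. exists (/ d).
  assert (Hdp := cond_pos d).
  split; [apply Rlt_le, Rinv_0_lt_compat, Hdp|].
  intros x y Hx Hy h1 h2 H1 H2.
  apply Rnot_lt_le. intros Hlt.
  apply (Hd x y Hx); [now apply Rabs_le_between|].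
  intros [u [v [Hu [Hv [Hxu [Hyv Hle]]]]]].
  unfold delta in *. destruct (constructive_indefinite_description _ (L (u, v))) as [e He].
  simpl in *.
  assert (R1 : regular_near F e (/ e) (x, y)).
  { apply He; [now apply Rabs_le_between|].
    eapply Rle_trans; [apply Cmod_pair_le|]. simpl.
    replace (x + - u) with (x - u) by ring. replace (y + - v) with (y - v) by ring. lra. }
  specialize (R1 h1 h2 ltac:(lra) ltac:(lra)).
  apply (Rlt_irrefl (Cmod (skew_difference F (x, y) h1 h2))).
  eapply Rle_lt_trans; [exact R1|]. eapply Rle_lt_trans; [|exact Hlt].
  apply Rmult_le_compat_r.
  - pose proof (Cmod_ge_0 h1). pose proof (Cmod_ge_0 h2). repeat apply Rmult_le_pos; lra.
  - apply Rinv_le_contravar; lra.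
Qed.

(** The lowest nonzero coefficient would dominate the series close to the centre. *)
Lemma pseries_coefs_0 (a : nat -> C) (r : R) (F : C -> C) (z0 u : C) (eta : R) :
  0 < r -> 0 < eta -> Cmod u = 1 ->
  (forall z, Cmod (z - z0) < r -> @is_pseries C_AbsRing C_NormedModule a (z - z0)%C (F z)) ->
  (forall t, 0 < t < eta -> F (z0 + RtoC t * u)%C = RtoC 0) ->
  forall k, a k = RtoC 0.
Proof.
  intros Hr He Hu Ha H0.
  assert (Hr2 : Cmod (RtoC (r / 2)) < r) by (rewrite Cmod_R, Rabs_pos_eq; lra).
  destruct (pseries_coef_bound a (r / 2) (F (z0 + RtoC (r / 2))%C)) as [B [HB HaB]]; [lra| |].
  { replace (RtoC (r / 2)) with (z0 + RtoC (r / 2) - z0)%C at 1 by ring.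
    apply Ha. now replace (z0 + RtoC (r / 2) - z0)%C with (RtoC (r / 2)) by ring. }
  set (rho := r / 2) in *.
  assert (Hrho : 0 < rho) by (unfold rho; lra).
  induction k as [k IH] using (well_founded_induction lt_wf).
  apply Cmod_eq_0. apply Rle_antisym; [|apply Cmod_ge_0].
  apply le_epsilon. intros e Hepos. rewrite Rplus_0_l.
  (* a point so close to the centre that the terms beyond the k-th are negligible *)
  set (t := Rmin (Rmin (eta / 2) (rho / 2)) (e * rho ^ S k / (2 * B + 1))).
  assert (Hk : 0 < rho ^ S k) by (apply pow_lt; lra).
  assert (Ht : 0 < t).
  { repeat apply Rmin_pos; try lra. apply Rdiv_lt_0_compat; [|lra].
    now apply Rmult_lt_0_compat. }
  assert (Ht1 : t <= eta / 2) by (eapply Rle_trans; [apply Rmin_l|apply Rmin_l]).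
  assert (Ht2 : t <= rho / 2) by (eapply Rle_trans; [apply Rmin_l|apply Rmin_r]).
  assert (Ht3 : t <= e * rho ^ S k / (2 * B + 1)) by apply Rmin_r.
  set (w := (RtoC t * u)%C).
  assert (Hw : Cmod w = t) by (unfold w; rewrite Cmod_mult, Cmod_R, Hu, Rabs_pos_eq; lra).
  assert (P := Ha (z0 + w)%C). replace (z0 + w - z0)%C with w in P by ring.
  specialize (P ltac:(rewrite Hw; unfold rho in *; lra)).
  unfold w in P at 2. rewrite H0 in P by lra. rewrite is_pseries_csum in P.
  assert (Htk : 0 < t ^ k) by (now apply pow_lt).
  apply Rmult_le_reg_r with (t ^ k); [exact Htk|].
  apply le_epsilon. intros e2 He2.
  destruct (P e2 He2) as [N0 HN]. specialize (HN (S k + N0)%nat ltac:(lia)).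
  replace (csum (fun k => a k * w ^ k)%C (S k + N0) - 0)%C with
    (csum (fun k => a k * w ^ k)%C (S k + N0)) in HN by ring.
  rewrite csum_split, csum_S in HN.
  rewrite (csum_ext _ (fun _ => RtoC 0)) in HN by (intros i Hi; rewrite IH by lia; ring).
  rewrite csum_const in HN.
  set (v := csum (fun i => a (S k + i)%nat * w ^ (S k + i))%C N0) in *.
  assert (Hv : Cmod v <= B * (t / rho) ^ S k * 2).
  { apply Rle_trans with (rsum (fun i => B * (t / rho) ^ S k * (/ 2) ^ i) N0).
    - apply Cmod_csum_le_bound. intros i _. rewrite Cmod_mult, Cmod_pow, Hw.
      replace (t ^ (S k + i)) with (rho ^ (S k + i) * (t / rho) ^ (S k + i))
        by (rewrite <- Rpow_mult_distr; f_equal; field; lra).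
      rewrite <- Rmult_assoc, (pow_add (t / rho)), (Rmult_assoc B).
      assert (0 <= t / rho) by (apply Rlt_le, Rdiv_lt_0_compat; lra).
      apply Rmult_le_compat; [| |apply HaB|].
      + apply Rmult_le_pos; [apply Cmod_ge_0|apply pow_le; lra].
      + apply Rmult_le_pos; now apply pow_le.
      + apply Rmult_le_compat_l; [now apply pow_le|]. apply pow_incr. split; [easy|].
        apply Rmult_le_reg_r with rho; [lra|].
        replace (t / rho * rho) with t by (field; lra). lra.
    - rewrite rsum_scal. apply Rmult_le_compat_l.
      + apply Rmult_le_pos; [lra|]. apply pow_le, Rlt_le, Rdiv_lt_0_compat; lra.
      + eapply Rle_trans; [apply geometric_sum_le; lra|]. lra. }
  assert (E : Cmod (a k * w ^ k) = Cmod (a k) * t ^ k)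
    by (rewrite Cmod_mult, Cmod_pow, Hw; easy).
  rewrite <- E.
  replace (a k * w ^ k)%C with ((RtoC (INR k) * RtoC 0 + a k * w ^ k + v) + - v)%C by ring.
  eapply Rle_trans; [apply Cmod_triangle|]. rewrite Cmod_opp.
  enough (B * (t / rho) ^ S k * 2 <= e * t ^ k) by lra.
  unfold Rdiv at 1. rewrite Rpow_mult_distr, pow_inv. simpl (t ^ S k).
  replace (B * (t * t ^ k * / rho ^ S k) * 2) with (2 * B * t / rho ^ S k * t ^ k)
    by (field; lra).
  apply Rmult_le_compat_r; [lra|].
  apply Rmult_le_reg_r with (rho ^ S k); [lra|].
  replace (2 * B * t / rho ^ S k * rho ^ S k) with (2 * B * t) by (field; lra).
  apply Rle_trans with ((2 * B + 1) * (e * rho ^ S k / (2 * B + 1))).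
  - nra.
  - right. field. lra.
Qed.

Lemma analytic_locally_0 (D : C -> Prop) (F : C -> C) (z0 u : C) (eta : R) :
  analytic_on D F -> D z0 -> 0 < eta -> Cmod u = 1 ->
  (forall t, 0 < t < eta -> F (z0 + RtoC t * u)%C = RtoC 0) ->
  exists r, 0 < r /\ forall z, Cmod (z - z0) < r -> F z = RtoC 0.
Proof.
  intros HF Hz He Hu H0. destruct (HF z0 Hz) as [a [r [Hr Ha]]].
  exists r. split; [exact Hr|]. intros z Hzr.
  pose proof (pseries_coefs_0 a r F z0 u eta Hr He Hu Ha H0) as A0.
  specialize (Ha z Hzr). rewrite is_pseries_csum in Ha.
  apply Cmod_eq_0. apply Rle_antisym; [|apply Cmod_ge_0].
  apply le_epsilon. intros e Hepos. rewrite Rplus_0_l.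
  destruct (Ha e Hepos) as [N HN]. specialize (HN N (le_n _)).
  rewrite (csum_ext _ (fun _ => RtoC 0)) in HN by (intros i Hi; rewrite A0; ring).
  rewrite csum_const in HN.
  replace (INR N * 0 - F z)%C with (- F z)%C in HN by ring. rewrite Cmod_opp in HN. lra.
Qed.

(** The identity theorem along a vertical line: at the supremum of the heights below
    which [D] vanishes, [D] vanishes on a segment ending there, hence on a disc. *)
Lemma analytic_strip_eq_0 (s : R) (D : C -> C) :
  analytic_on (strip s) D -> (forall x : R, D (RtoC x) = RtoC 0) ->
  forall x y, Rabs y < s -> D (x, y) = RtoC 0.
Proof.
  intros HD H0 x y Hy.
  destruct (Req_dec y 0) as [->|Hy0]; [apply H0|].
  set (sg := y / Rabs y).
  assert (Hya : 0 < Rabs y) by (now apply Rabs_pos_lt).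
  assert (Hsg : Rabs sg = 1).
  { unfold sg. unfold Rdiv. rewrite Rabs_mult, Rabs_inv, Rabs_Rabsolu. field. lra. }
  assert (Ey : y = sg * Rabs y) by (unfold sg; field; lra).
  set (E := fun t => 0 <= t < s /\ forall tau, 0 <= tau <= t -> D (x, sg * tau) = RtoC 0).
  apply NNPP. intros Hne.
  assert (E0 : E 0).
  { split; [lra|]. intros tau Htau. replace (sg * tau) with 0 by nra. apply H0. }
  assert (Hub : is_upper_bound E (Rabs y)).
  { intros t [Ht1 Ht2]. apply Rnot_lt_le. intros Hlt. apply Hne. rewrite Ey. apply Ht2. lra. }
  destruct (completeness E) as [T [HT1 HT2]]; [now exists (Rabs y)|now exists 0|].
  assert (HT0 : 0 <= T) by (now apply HT1).
  assert (HTy : T <= Rabs y) by (now apply HT2).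
  assert (Hbelow : forall tau, 0 <= tau < T -> D (x, sg * tau) = RtoC 0).
  { intros tau Htau. apply NNPP. intros Hn.
    apply (Rlt_irrefl tau). apply Rlt_le_trans with T; [lra|]. apply HT2.
    intros t [Ht1 Ht2]. apply Rnot_lt_le. intros Hlt. apply Hn, Ht2. lra. }
  assert (Hloc : exists r, 0 < r /\ forall z, Cmod (z - (x, sg * T)) < r -> D z = RtoC 0).
  { assert (Hst : strip s (x, sg * T)).
    { unfold strip. simpl. rewrite Rabs_mult, Hsg, (Rabs_pos_eq T) by lra. lra. }
    destruct (Req_dec T 0) as [HTz|HTz].
    - apply (analytic_locally_0 _ D _ (RtoC 1) 1 HD Hst Rlt_0_1 Cmod_1).
      intros t _. rewrite HTz.
      replace ((x, (sg * 0)%R) + RtoC t * 1)%C with (RtoC (x + t)); [apply H0|].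
      unfold RtoC, Cplus, Cmult; simpl. f_equal; ring.
    - apply (analytic_locally_0 _ D _ (0, - sg) T HD Hst ltac:(lra)).
      + unfold Cmod. simpl. replace (0 * (0 * 1) + - sg * (- sg * 1)) with (Rsqr sg)
          by (unfold Rsqr; ring). rewrite sqrt_Rsqr_abs. exact Hsg.
      + intros t Ht.
        replace ((x, (sg * T)%R) + RtoC t * (0, (- sg)%R))%C with (x, sg * (T - t)).
        * apply Hbelow. lra.
        * unfold RtoC, Cplus, Cmult; simpl. f_equal; ring. }
  destruct Hloc as [r [Hr Hz]].
  set (d := Rmin (r / 2) ((s - T) / 2)).
  assert (Hd : 0 < d) by (apply Rmin_pos; lra).
  assert (Hd1 : d <= r / 2) by apply Rmin_l.
  assert (Hd2 : d <= (s - T) / 2) by apply Rmin_r.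
  assert (HE : E (T + d)).
  { split; [lra|]. intros tau Htau. destruct (Rlt_dec tau T) as [Hlt|Hge]; [apply Hbelow; lra|].
    apply Hz. eapply Rle_lt_trans; [apply Cmod_pair_le|]. simpl.
    replace (x + - x) with 0 by ring. rewrite Rabs_R0.
    replace (sg * tau + - (sg * T)) with (sg * (tau - T)) by ring.
    rewrite Rabs_mult, Hsg, Rabs_pos_eq by lra. lra. }
  apply HT1 in HE. lra.
Qed.

(** The class prescribes periodicity on the real line only; the identity theorem
    carries it to the strip. *)
Lemma analytic_strip_periodic (s : R) (F : C -> C) :
  analytic_on (strip s) F -> (forall x : R, F (RtoC (x + 2 * PI)) = F (RtoC x)) ->
  forall x y, Rabs y < s -> F (x + 2 * PI, y) = F (x, y).
Proof.
  intros HF Hper x y Hy.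
  set (D := fun z => (F (z + RtoC (2 * PI)) - F z)%C).
  assert (HD : D (x, y) = RtoC 0).
  { apply (analytic_strip_eq_0 s); [|intros x'|exact Hy].
    - intros z0 Hz0.
      destruct (HF (z0 + RtoC (2 * PI))%C) as [a [r [Hr Ha]]].
      { unfold strip in *. simpl. rewrite Rplus_0_r. exact Hz0. }
      destruct (HF z0 Hz0) as [b [r' [Hr' Hb]]].
      exists (PS_minus a b), (Rmin r r'). split; [now apply Rmin_pos|].
      intros z Hz. unfold D.
      apply (@is_pseries_minus C_AbsRing C_NormedModule a b (z - z0)%C).
      + replace (z - z0)%C with (z + RtoC (2 * PI) - (z0 + RtoC (2 * PI)))%C in * by ring.
        apply Ha. eapply Rlt_le_trans; [exact Hz|apply Rmin_l].
      + apply Hb. eapply Rlt_le_trans; [exact Hz|apply Rmin_r].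
    - unfold D. rewrite <- RtoC_plus, Hper. ring. }
  unfold D in HD.
  replace ((x, y) + RtoC (2 * PI))%C with (x + 2 * PI, y) in HD
    by (unfold RtoC, Cplus; simpl; f_equal; ring).
  set (p := F (x + 2 * PI, y)) in *. set (q := F (x, y)) in *.
  replace p with (p - q + q)%C by ring. rewrite HD. ring.
Qed.

(** * Discrete derivatives of regular functions *)

Lemma sin_lower (a : R) : 0 <= a <= 4 -> a - a ^ 3 / 6 <= sin a.
Proof.
  intros [H1 H2]. destruct (pre_sin_bound a 0 H1 H2) as [H _].
  replace (a - a ^ 3 / 6) with (sin_approx a (2 * 0 + 1)); [exact H|].
  unfold sin_approx, sin_term. simpl. field.
Qed.

Lemma Rabs_sin_le (a : R) : Rabs (sin a) <= Rabs a.
Proof.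
  assert (P : forall x, 0 <= x -> Rabs (sin x) <= x).
  { intros x [Hx|<-]; [|rewrite sin_0, Rabs_R0; lra].
    destruct (Rle_dec x 1) as [H|H].
    - rewrite Rabs_pos_eq; [left; now apply sin_lt_x|].
      apply sin_ge_0; [lra|]. pose proof PI2_1. lra.
    - pose proof (SIN_bound x). apply Rabs_le. lra. }
  unfold Rabs at 2. destruct (Rcase_abs a) as [H|H].
  - rewrite <- Rabs_Ropp, <- sin_neg. apply P. lra.
  - apply P. lra.
Qed.

Lemma Rabs_sin_ge (a : R) : Rabs a <= PI / 2 -> Rabs a / 3 <= Rabs (sin a).
Proof.
  assert (P : forall x, 0 <= x <= PI / 2 -> x / 3 <= Rabs (sin x)).
  { intros x Hx. pose proof PI_4.
    eapply Rle_trans; [|apply Rle_abs]. eapply Rle_trans; [|apply sin_lower; lra].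
    nra. }
  intros H. unfold Rabs at 1. destruct (Rcase_abs a) as [H'|H'].
  - rewrite <- Rabs_Ropp, <- sin_neg. apply P. rewrite Rabs_left in H; lra.
  - apply P. rewrite Rabs_pos_eq in H; lra.
Qed.

Lemma exp_second_order (u : R) : Rabs u <= / 2 -> 0 <= exp u - 1 - u <= 2 * u ^ 2.
Proof.
  intros H. apply Rabs_le_between in H.
  pose proof (exp_ineq1_le u). split; [lra|].
  pose proof (exp_ineq1_le (- u)) as H1. pose proof (exp_pos u).
  assert (E : exp u * exp (- u) = 1) by (rewrite <- exp_plus, Rplus_opp_r; apply exp_0).
  assert (exp u * (1 - u) <= 1) by nra.
  apply Rmult_le_reg_r with (1 - u); [lra|]. nra.
Qed.

(** One step of the upwind scheme for the Cauchy-Riemann equation, on the mode of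
    frequency [k] with [th = k tau], multiplies it by [1 + i (e^(i th) - 1)], which to
    second order is the exact factor [e^(- th)]. *)
Lemma step_factor (th : R) : Rabs th <= / 2 ->
  Cmod (1 + Ci * (cis th - 1) - RtoC (exp (- th))) <= 4 * th ^ 2.
Proof.
  intros H.
  replace (1 + Ci * (cis th - 1) - RtoC (exp (- th)))%C
    with (1 - sin th - exp (- th), cos th - 1)
    by (apply injective_projections; simpl; ring).
  eapply Rle_trans; [apply Cmod_pair_le|].
  assert (H1 : Rabs (cos th - 1) <= th ^ 2 / 2).
  { replace th with (2 * (th / 2)) at 1 by field. rewrite cos_2a_sin.
    replace (1 - 2 * sin (th / 2) * sin (th / 2) - 1) with (- (2 * sin (th / 2) ^ 2)) by ring.
    rewrite Rabs_Ropp, Rabs_pos_eq by (pose proof (pow2_ge_0 (sin (th / 2))); lra).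
    rewrite <- (pow2_abs (sin (th / 2))).
    pose proof (Rabs_sin_le (th / 2)) as B. pose proof (Rabs_pos (sin (th / 2))).
    assert (Rabs (sin (th / 2)) ^ 2 <= (th / 2) ^ 2).
    { rewrite <- (pow2_abs (th / 2)). apply pow_incr. lra. }
    nra. }
  assert (H2 : Rabs (sin th - th) <= th ^ 2 / 2).
  { assert (P : forall x, 0 <= x <= / 2 -> Rabs (sin x - x) <= x ^ 2 / 2).
    { intros x Hx. pose proof (sin_lower x ltac:(lra)) as L.
      pose proof (Rabs_sin_le x) as U. pose proof (Rle_abs (sin x)).
      rewrite (Rabs_pos_eq x) in U by lra. apply Rabs_le. nra. }
    unfold Rabs in H. destruct (Rcase_abs th).
    - replace (sin th - th) with (- (sin (- th) - - th)) by (rewrite sin_neg; ring).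
      rewrite Rabs_Ropp. replace (th ^ 2) with ((- th) ^ 2) by ring. apply P. lra.
    - apply P. lra. }
  pose proof (exp_second_order (- th)) as H3. rewrite Rabs_Ropp in H3. specialize (H3 H).
  replace (1 - sin th - exp (- th)) with (- ((sin th - th) + (exp (- th) - 1 - - th))) by ring.
  rewrite Rabs_Ropp.
  assert (H4 : Rabs (exp (- th) - 1 - - th) <= 2 * th ^ 2) by (rewrite Rabs_pos_eq; nra).
  pose proof (Rabs_triang (sin th - th) (exp (- th) - 1 - - th)). nra.
Qed.

Lemma regular_cauchy_riemann (F : C -> C) (rho K x y tau : R) :
  regular_near F rho K (x, y) -> Rabs tau <= rho ->
  Cmod (F (x, y + tau)%R - F (x, y) - Ci * (F (x + tau, y)%R - F (x, y))) <= 2 * K * tau ^ 2.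
Proof.
  intros H Ht. destruct (Req_dec tau 0) as [->|H0].
  { rewrite !Rplus_0_r.
    replace (F (x, y) - F (x, y) - Ci * (F (x, y) - F (x, y)))%C with (RtoC 0) by ring.
    rewrite Cmod_0. lra. }
  assert (E1 : Cmod (Ci * RtoC tau) = Rabs tau) by (rewrite Cmod_mult, Cmod_Ci, Cmod_R; ring).
  specialize (H (Ci * RtoC tau)%C (RtoC tau)). rewrite E1, Cmod_R in H.
  specialize (H Ht Ht). unfold skew_difference in H.
  replace ((x, y) + Ci * RtoC tau)%C with (x, (y + tau)%R) in H
    by (unfold Cplus, Cmult, RtoC, Ci; simpl; f_equal; ring).
  replace ((x, y) + RtoC tau)%C with ((x + tau)%R, y) in H
    by (unfold Cplus, RtoC; simpl; f_equal; ring).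
  set (p := F (x, (y + tau)%R)) in *. set (q := F (x, y)) in *. set (r := F ((x + tau)%R, y)) in *.
  replace (RtoC tau * (p - q) - Ci * RtoC tau * (r - q))%C
    with (RtoC tau * (p - q - Ci * (r - q)))%C in H by ring.
  rewrite Cmod_mult, Cmod_R in H.
  pose proof (Rabs_pos_lt tau H0).
  apply Rmult_le_reg_l with (Rabs tau); [easy|].
  rewrite <- (pow2_abs tau). nra.
Qed.

Lemma regular_second_difference (F : C -> C) (rho K x y tau : R) :
  regular_near F rho K (x, y) -> Rabs tau <= rho ->
  Cmod (F (x + tau, y)%R + F (x - tau, y)%R - 2 * F (x, y)) <= 2 * K * tau ^ 2.
Proof.
  intros H Ht. destruct (Req_dec tau 0) as [->|H0].
  { rewrite Rplus_0_r, Rminus_0_r.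
    replace (F (x, y) + F (x, y) - 2 * F (x, y))%C with (RtoC 0) by ring.
    rewrite Cmod_0. lra. }
  specialize (H (RtoC tau) (RtoC (- tau))). rewrite !Cmod_R, Rabs_Ropp in H.
  specialize (H Ht Ht). unfold skew_difference in H.
  replace ((x, y) + RtoC (- tau))%C with ((x - tau)%R, y) in H
    by (unfold Cplus, RtoC; simpl; f_equal; ring).
  replace ((x, y) + RtoC tau)%C with ((x + tau)%R, y) in H
    by (unfold Cplus, RtoC; simpl; f_equal; ring).
  set (p := F ((x - tau)%R, y)) in *. set (q := F (x, y)) in *. set (r := F ((x + tau)%R, y)) in *.
  rewrite RtoC_opp in H.
  replace (- RtoC tau * (r - q) - RtoC tau * (p - q))%C
    with (- (RtoC tau * (r + p - 2 * q)))%C in H by ring.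
  rewrite Cmod_opp, Cmod_mult, Cmod_R in H.
  pose proof (Rabs_pos_lt tau H0).
  apply Rmult_le_reg_l with (Rabs tau); [easy|].
  rewrite <- (pow2_abs tau). nra.
Qed.

(** One step is kept at its maximal length [rho], where [F] is bounded. *)
Lemma regular_lipschitz (F : C -> C) (rho K M x y tau : R) :
  regular_near F rho K (x, y) -> 0 < rho -> 0 <= K -> Rabs tau <= rho ->
  (forall x', Cmod (F (x', y)) <= M) ->
  Cmod (F (x + tau, y)%R - F (x, y)) <= (2 * M / rho + 2 * K * rho) * Rabs tau.
Proof.
  intros H Hr HK Ht HM.
  specialize (H (RtoC tau) (RtoC rho)). rewrite !Cmod_R, (Rabs_pos_eq rho) in H by lra.
  specialize (H Ht (Rle_refl _)). unfold skew_difference in H.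
  replace ((x, y) + RtoC rho)%C with ((x + rho)%R, y) in H
    by (unfold Cplus, RtoC; simpl; f_equal; ring).
  replace ((x, y) + RtoC tau)%C with ((x + tau)%R, y) in H
    by (unfold Cplus, RtoC; simpl; f_equal; ring).
  pose proof (HM x) as Hq. pose proof (HM (x + rho)) as Hp.
  set (p := F ((x + rho)%R, y)) in *. set (q := F (x, y)) in *. set (r := F ((x + tau)%R, y)) in *.
  apply Rmult_le_reg_l with rho; [easy|].
  replace (rho * Cmod (r - q)) with (Cmod (RtoC rho * (r - q)))
    by (rewrite Cmod_mult, Cmod_R, Rabs_pos_eq; lra).
  replace (RtoC rho * (r - q))%C with
    ((RtoC rho * (r - q) - RtoC tau * (p - q)) + RtoC tau * (p + - q))%C by ring.
  eapply Rle_trans; [apply Cmod_triangle|].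
  rewrite (Cmod_mult (RtoC tau)), Cmod_R.
  pose proof (Cmod_triangle p (- q)) as T. rewrite Cmod_opp in T.
  pose proof (Rabs_pos tau) as Hta.
  apply Rle_trans with (K * (Rabs tau * rho * (2 * rho)) + Rabs tau * (2 * M)).
  - apply Rplus_le_compat.
    + eapply Rle_trans; [exact H|]. apply Rmult_le_compat_l; [lra|].
      apply Rmult_le_compat_l; [nra|lra].
    + apply Rmult_le_compat_l; lra.
  - right. field. lra.
Qed.

(** * Shifts and the discrete transform *)

Lemma dft_ext (Q : nat) (u v : nat -> C) (k : R) :
  (forall j, (j < Q)%nat -> u j = v j) -> dft Q u k = dft Q v k.
Proof. intros H. unfold dft. f_equal. apply csum_ext. intros j Hj. now rewrite H. Qed.

Lemma dft_plus (Q : nat) (u v : nat -> C) (k : R) :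
  dft Q (fun j => u j + v j)%C k = (dft Q u k + dft Q v k)%C.
Proof.
  unfold dft. rewrite <- Cmult_plus_distr_l, <- csum_plus. f_equal.
  apply csum_ext. intros. ring.
Qed.

Lemma dft_scal (Q : nat) (a : C) (v : nat -> C) (k : R) :
  dft Q (fun j => a * v j)%C k = (a * dft Q v k)%C.
Proof.
  unfold dft. rewrite (csum_ext _ (fun j => a * (v j * cis (- (k * node Q j))))%C)
    by (intros; ring).
  rewrite csum_scal. ring.
Qed.

Lemma dft_bound (Q : nat) (v : nat -> C) (k B : R) :
  (0 < Q)%nat -> (forall j, (j < Q)%nat -> Cmod (v j) <= B) -> Cmod (dft Q v k) <= B.
Proof.
  intros HQ H. assert (0 < INR Q) by (now apply lt_0_INR).
  unfold dft. rewrite Cmod_mult, <- RtoC_inv, Cmod_R, Rabs_pos_eq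
    by (try apply Rlt_le, Rinv_0_lt_compat; lra).
  apply Rmult_le_reg_l with (INR Q); [easy|]. rewrite <- Rmult_assoc, Rinv_r, Rmult_1_l by lra.
  rewrite <- rsum_const. apply Cmod_csum_le_bound. intros j Hj.
  rewrite Cmod_mult, Cmod_cis, Rmult_1_r. auto.
Qed.

Lemma dft_bessel (m n : nat) (v : nat -> C) (B : R) :
  let Q := (2 * m + 1)%nat in (n <= Q)%nat ->
  (forall j, (j < Q)%nat -> Cmod (v j) <= B) ->
  rsum (fun i => Cmod (dft Q v (fr i)) ^ 2) n <= B ^ 2.
Proof.
  intros Q Hn H.
  assert (HQ : 0 < INR Q) by (apply lt_0_INR; lia).
  eapply Rle_trans; [apply (rsum_monotone _ n Q); [intros; apply pow2_ge_0|exact Hn]|].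
  unfold Q. rewrite dft_parseval. fold Q.
  apply Rmult_le_reg_l with (INR Q); [easy|]. rewrite <- Rmult_assoc, Rinv_r, Rmult_1_l by lra.
  rewrite <- rsum_const. apply rsum_le. intros j Hj. apply pow_incr.
  split; [apply Cmod_ge_0|auto].
Qed.

Lemma dft_shift (Q : nat) (g : R -> C) (i : nat) :
  (0 < Q)%nat -> (forall x, g (x + 2 * PI) = g x) ->
  dft Q (fun j => g (node Q j + 2 * PI / INR Q)) (fr i)
  = (cis (fr i * (2 * PI / INR Q)) * dft Q (fun j => g (node Q j)) (fr i))%C.
Proof.
  intros HQ Hg. assert (0 < INR Q) by (now apply lt_0_INR).
  unfold dft. rewrite Cmult_assoc, (Cmult_comm (cis _)), <- Cmult_assoc. f_equal.
  rewrite <- (csum_shift (fun j => g (node Q j) * cis (- (fr i * node Q j)))%C).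
  - rewrite <- csum_scal. apply csum_ext. intros j _.
    replace (node Q (S j)) with (node Q j + 2 * PI / INR Q)
      by (unfold node; rewrite S_INR; ring).
    replace (- (fr i * node Q j)) with
      (fr i * (2 * PI / INR Q) + - (fr i * (node Q j + 2 * PI / INR Q))) by ring.
    rewrite cis_plus. ring.
  - replace (node Q Q) with (0 + 2 * PI) by (unfold node; field; lra).
    replace (node Q 0) with 0 by (unfold node; simpl; ring).
    rewrite Hg. f_equal. rewrite Rmult_0_r, Ropp_0, cis_0.
    replace (- (fr i * (0 + 2 * PI))) with (2 * PI * IZR (- freq i))
      by (unfold fr; rewrite opp_IZR; ring).
    apply cis_2PI_IZR.
Qed.

Lemma dft_shift_signed (Q : nat) (g : R -> C) (i : nat) (tau : R) :
  (0 < Q)%nat -> (forall x, g (x + 2 * PI) = g x) ->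
  tau = 2 * PI / INR Q \/ tau = - (2 * PI / INR Q) ->
  dft Q (fun j => g (node Q j + tau)) (fr i)
  = (cis (fr i * tau) * dft Q (fun j => g (node Q j)) (fr i))%C.
Proof.
  intros HQ Hg [->| ->]; [now apply dft_shift|].
  set (h := 2 * PI / INR Q).
  pose proof (dft_shift Q (fun x => g (x + - h)) i HQ) as E. fold h in E.
  rewrite (dft_ext _ _ (fun j => g (node Q j))) in E
    by (intros; apply (f_equal g); ring).
  rewrite E, Cmult_assoc, <- cis_plus.
  - replace (fr i * - h + fr i * h) with 0 by ring. rewrite cis_0. ring.
  - intros x. rewrite <- (Hg (x + - h)). apply (f_equal g). ring.
Qed.

(** * A discrete contour shift *)

(** The quantitative content of membership in the class, on a closed strip slightly
    narrower than that of the class, where compactness makes it uniform. *)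
Definition strip_control (F : C -> C) (s M rho K : R) : Prop :=
  (forall x y, Rabs y <= s -> F (x + 2 * PI, y) = F (x, y)) /\
  (forall x y, Rabs y <= s -> Cmod (F (x, y)) <= M) /\
  (forall x y, 0 <= x <= 2 * PI -> Rabs y <= s -> regular_near F rho K (x, y)).

Definition coef (F : C -> C) (Q : nat) (y : R) (i : nat) : C :=
  dft Q (fun j => F (node Q j, y)) (fr i).

Lemma coef_bound (F : C -> C) (s M rho K y : R) (Q i : nat) :
  strip_control F s M rho K -> (0 < Q)%nat -> Rabs y <= s -> Cmod (coef F Q y i) <= M.
Proof. intros [_ [HM _]] HQ Hy. apply dft_bound; [exact HQ|]. intros. now apply HM. Qed.

(** Replacing a vertical step by [i] times a horizontal one costs [O (tau^2)], and a
    horizontal step acts on a Fourier coefficient by a scalar. *)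
Lemma coef_step (F : C -> C) (s M rho K y tau : R) (Q i : nat) :
  strip_control F s M rho K -> (0 < Q)%nat -> Rabs y <= s ->
  tau = 2 * PI / INR Q \/ tau = - (2 * PI / INR Q) ->
  Rabs tau <= rho -> Rabs (fr i * tau) <= / 2 ->
  Cmod (coef F Q (y + tau) i - RtoC (exp (- (fr i * tau))) * coef F Q y i)
    <= (2 * K + 4 * fr i ^ 2 * M) * tau ^ 2.
Proof.
  intros HF HQ Hy Ht Htr Hk.
  pose proof (coef_bound F s M rho K y Q i HF HQ Hy) as HB.
  destruct HF as [Hper [HM Hreg]].
  set (err := fun j => (F (node Q j, (y + tau)%R) - F (node Q j, y)
    - Ci * (F ((node Q j + tau)%R, y) - F (node Q j, y)))%C).
  assert (He : Cmod (dft Q err (fr i)) <= 2 * K * tau ^ 2).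
  { apply dft_bound; [exact HQ|]. intros j Hj. unfold err.
    apply (regular_cauchy_riemann F rho); [|exact Htr].
    apply Hreg; [now apply node_range|exact Hy]. }
  assert (E : dft Q err (fr i)
    = (coef F Q (y + tau) i - (1 + Ci * (cis (fr i * tau) - 1)) * coef F Q y i)%C).
  { rewrite (dft_ext _ err (fun j => F (node Q j, (y + tau)%R)
      + ((- (1) + Ci) * F (node Q j, y) + (- Ci) * F ((node Q j + tau)%R, y)))%C)
      by (intros; unfold err; ring).
    rewrite dft_plus, dft_plus, !dft_scal.
    rewrite (dft_shift_signed Q (fun x => F (x, y)) i tau HQ); [|intros; now apply Hper|exact Ht].
    unfold coef. ring. }
  rewrite E in He.
  set (a := coef F Q (y + tau) i) in *. set (b := coef F Q y i) in *.
  set (w := (1 + Ci * (cis (fr i * tau) - 1))%C) in *.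
  replace (a - RtoC (exp (- (fr i * tau))) * b)%C
    with (a - w * b + (w - RtoC (exp (- (fr i * tau)))) * b)%C by ring.
  eapply Rle_trans; [apply Cmod_triangle|].
  pose proof (step_factor (fr i * tau) Hk) as Hw. fold w in Hw.
  rewrite Cmod_mult.
  assert (Cmod (w - RtoC (exp (- (fr i * tau)))) * Cmod b <= 4 * (fr i * tau) ^ 2 * M).
  { apply Rmult_le_compat; try apply Cmod_ge_0; assumption. }
  nra.
Qed.

(** Cauchy's theorem for a rectangle, discretely: climbing [n] steps multiplies each
    coefficient by the exponential that the contour shift predicts. Since [n |tau|] is
    bounded, the accumulated error is [O (tau)]. *)
Lemma coef_climb (F : C -> C) (s M rho K tau : R) (Q i : nat) :
  strip_control F s M rho K -> (0 < Q)%nat -> 0 <= M -> 0 <= K ->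
  tau = 2 * PI / INR Q \/ tau = - (2 * PI / INR Q) ->
  Rabs tau <= rho -> degree i * Rabs tau <= / 2 ->
  forall n, INR n * Rabs tau <= s ->
  Cmod (coef F Q (INR n * tau) i - RtoC (exp (- (fr i * (INR n * tau)))) * coef F Q 0 i)
    <= INR n * exp (degree i * (INR n * Rabs tau)) * ((2 * K + 4 * degree i ^ 2 * M) * tau ^ 2).
Proof.
  intros HF HQ HM HK Ht Htr Hk.
  assert (Hk' : Rabs (fr i * tau) <= / 2) by (now rewrite Rabs_mult, Rabs_fr).
  set (A := (2 * K + 4 * degree i ^ 2 * M) * tau ^ 2).
  assert (HA : 0 <= A).
  { unfold A. pose proof (pow2_ge_0 (degree i)). pose proof (pow2_ge_0 tau).
    apply Rmult_le_pos; [nra|lra]. }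
  pose proof (degree_ge_0 i) as Hd. pose proof (Rabs_pos tau) as Hta.
  induction n; intros Hn.
  - simpl INR. rewrite !Rmult_0_l, !Rmult_0_r, Ropp_0, exp_0.
    replace (coef F Q 0 i - 1 * coef F Q 0 i)%C with (RtoC 0) by ring. rewrite Cmod_0. lra.
  - rewrite S_INR in *. pose proof (pos_INR n) as Hpn.
    assert (Hns : INR n * Rabs tau <= s) by nra.
    specialize (IHn Hns).
    assert (Hy : Rabs (INR n * tau) <= s)
      by (rewrite Rabs_mult, (Rabs_pos_eq (INR n)) by lra; lra).
    pose proof (coef_step F s M rho K (INR n * tau) tau Q i HF HQ Hy Ht Htr Hk') as St.
    replace (fr i ^ 2) with (degree i ^ 2) in St by (rewrite <- Rabs_fr; apply pow2_abs).
    fold A in St.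
    replace ((INR n + 1) * tau) with (INR n * tau + tau) by ring.
    set (b := coef F Q (INR n * tau) i) in *. set (c := coef F Q 0 i) in *.
    set (a := coef F Q (INR n * tau + tau) i) in *.
    replace (- (fr i * (INR n * tau + tau)))
      with (- (fr i * tau) + - (fr i * (INR n * tau))) by ring.
    rewrite exp_plus, RtoC_mult.
    set (e := exp (- (fr i * tau))) in *. set (e' := exp (- (fr i * (INR n * tau)))) in *.
    replace (a - RtoC e * RtoC e' * c)%C with (a - RtoC e * b + RtoC e * (b - RtoC e' * c))%C by ring.
    eapply Rle_trans; [apply Cmod_triangle|].
    rewrite (Cmod_mult (RtoC e)), Cmod_R, (Rabs_pos_eq e) by (apply Rlt_le, exp_pos).
    assert (He : e <= exp (degree i * Rabs tau)).
    { apply exp_le_exp. rewrite <- Rabs_fr, <- Rabs_mult, <- Rabs_Ropp. apply Rle_abs. }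
    set (g := exp (degree i * (INR n * Rabs tau))) in *.
    replace (degree i * ((INR n + 1) * Rabs tau))
      with (degree i * Rabs tau + degree i * (INR n * Rabs tau)) by ring.
    rewrite exp_plus. fold g. set (g1 := exp (degree i * Rabs tau)) in *.
    assert (G1 : 1 <= g1).
    { unfold g1. rewrite <- exp_0. apply exp_le_exp. now apply Rmult_le_pos. }
    assert (G : 1 <= g).
    { unfold g. rewrite <- exp_0. apply exp_le_exp.
      apply Rmult_le_pos; [easy|]. now apply Rmult_le_pos. }
    assert (H1 : e * Cmod (b - RtoC e' * c) <= g1 * (INR n * g * A)).
    { apply Rmult_le_compat; [apply Rlt_le, exp_pos|apply Cmod_ge_0|easy|easy]. }
    assert (H2 : A <= g1 * g * A).
    { rewrite <- (Rmult_1_l A) at 1. apply Rmult_le_compat_r; [easy|]. nra. }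
    nra.
Qed.

Lemma exp_half_le_2 : exp (/ 2) <= 2.
Proof. pose proof (exp_second_order (/ 2)) as H. rewrite Rabs_pos_eq in H; lra. Qed.

(** Bessel's inequality on two lines near [Im z = s] and [Im z = - s]. The weight
    [e^(s |k|)] comes from the line on the side where [|e^(i k z)|] is large. The step
    must be small in terms of [n] and [F], but the bound depends on neither. *)
Lemma coef_weighted_l2 (F : C -> C) (s M rho K : R) (n : nat) :
  strip_control F s M rho K -> 0 < M -> 0 <= K -> 0 < rho -> 0 < s ->
  exists h0, 0 < h0 /\ forall m, (n <= m)%nat -> let Q := (2 * m + 1)%nat in
    2 * PI / INR Q <= h0 ->
    rsum (fun i => (Cmod (coef F Q 0 i) * exp (s * degree i)) ^ 2) (2 * n + 1) <= 24 * M ^ 2.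
Proof.
  intros HF HM HK Hrho Hs.
  set (d := INR (2 * n + 1)).
  assert (Hd : 1 <= d) by (apply one_le_INR; lia).
  set (eta := M / d). assert (Heta : 0 < eta) by (apply Rdiv_lt_0_compat; lra).
  set (A := 2 * K + 4 * INR n ^ 2 * M).
  assert (HA : 0 <= A) by (unfold A; pose proof (pow2_ge_0 (INR n)); nra).
  set (G := s * exp (INR n * s) * A + 1).
  assert (HG0 : 0 <= s * exp (INR n * s) * A).
  { pose proof (exp_pos (INR n * s)). repeat apply Rmult_le_pos; lra. }
  assert (HG : 0 < G) by (unfold G; lra).
  pose proof (pos_INR n) as Hn0.
  (* the last bound makes the error of [coef_climb] at most [eta] *)
  exists (Rmin rho (Rmin (/ (2 * (INR n + 1))) (eta / G))). split.
  { repeat apply Rmin_pos; [easy| |now apply Rdiv_lt_0_compat].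
    apply Rinv_0_lt_compat. lra. }
  intros m Hm Q Hh. set (h := 2 * PI / INR Q) in *.
  assert (HQ : 0 < INR Q) by (apply lt_0_INR; unfold Q; lia).
  assert (HQ' : (0 < Q)%nat) by (unfold Q; lia).
  assert (Hhp : 0 < h) by (pose proof PI_RGT_0; apply Rdiv_lt_0_compat; lra).
  assert (H1 : h <= rho) by (eapply Rle_trans; [exact Hh|apply Rmin_l]).
  assert (H2 : h <= / (2 * (INR n + 1)))
    by (eapply Rle_trans; [exact Hh|eapply Rle_trans; [apply Rmin_r|apply Rmin_l]]).
  assert (H3 : h <= eta / G)
    by (eapply Rle_trans; [exact Hh|eapply Rle_trans; [apply Rmin_r|apply Rmin_r]]).
  destruct (nfloor_ex (s / h)) as [N [HN1 HN2]]; [apply Rlt_le, Rdiv_lt_0_compat; lra|].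
  assert (HNs : INR N * h <= s).
  { apply Rle_trans with (s / h * h); [apply Rmult_le_compat_r; lra|right; field; lra]. }
  assert (HNs' : s <= INR N * h + h).
  { apply Rle_trans with (s / h * h); [right; field; lra|nra]. }
  set (up := fun i => coef F Q (INR N * h) i). set (dn := fun i => coef F Q (INR N * - h) i).
  assert (Hpt : forall i, (i < 2 * n + 1)%nat ->
    (Cmod (coef F Q 0 i) * exp (s * degree i)) ^ 2
      <= 8 * (Cmod (up i) ^ 2 + Cmod (dn i) ^ 2 + eta ^ 2)).
  { intros i Hi. pose proof (degree_le i n Hi) as Hdi. pose proof (degree_ge_0 i) as Hdi0.
    assert (Hdh : degree i * h <= / 2).
    { apply Rle_trans with ((INR n + 1) * / (2 * (INR n + 1))).
      - apply Rmult_le_compat; lra.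
      - right. field. lra. }
    (* the direction in which climbing amplifies this mode *)
    assert (Key : exists sg, (sg = 1 \/ sg = -1) /\ - (fr i * (sg)) = degree i).
    { rewrite <- Rabs_fr. unfold Rabs. destruct (Rcase_abs (fr i));
      [exists 1|exists (-1)]; split; auto; ring. }
    destruct Key as [sg [Hsg Hk]].
    assert (Habs : Rabs (sg * h) = h).
    { rewrite Rabs_mult, (Rabs_pos_eq h) by lra.
      destruct Hsg as [->| ->]; [rewrite Rabs_pos_eq|rewrite Rabs_left]; lra. }
    pose proof (coef_climb F s M rho K (sg * h) Q i HF HQ') as Cl.
    rewrite Habs in Cl.
    specialize (Cl ltac:(lra) HK ltac:(destruct Hsg as [->| ->]; [left|right]; unfold h; ring)
      H1 Hdh N HNs).
    replace (- (fr i * (INR N * (sg * h)))) with (degree i * (INR N * h)) in Cl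
      by (rewrite <- Hk; ring).
    set (e := exp (degree i * (INR N * h))) in *.
    assert (He1 : exp (s * degree i) <= 2 * e).
    { apply Rle_trans with (exp (degree i * h) * e).
      - unfold e. rewrite <- exp_plus. apply exp_le_exp. nra.
      - apply Rmult_le_compat_r; [apply Rlt_le, exp_pos|].
        eapply Rle_trans; [|apply exp_half_le_2]. now apply exp_le_exp. }
    assert (Herr : INR N * e * ((2 * K + 4 * degree i ^ 2 * M) * (sg * h) ^ 2) <= eta).
    { assert (B1 : e <= exp (INR n * s)).
      { apply exp_le_exp. apply Rmult_le_compat; try lra.
        apply Rmult_le_pos; [apply pos_INR|lra]. }
      assert (B2 : 0 <= 2 * K + 4 * degree i ^ 2 * M <= A).
      { unfold A. assert (0 <= degree i ^ 2 <= INR n ^ 2)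
          by (split; [apply pow2_ge_0|apply pow_incr; lra]). nra. }
      replace ((sg * h) ^ 2) with (h ^ 2) by (destruct Hsg as [->| ->]; ring).
      replace (INR N * e * ((2 * K + 4 * degree i ^ 2 * M) * h ^ 2))
        with ((INR N * h) * e * (2 * K + 4 * degree i ^ 2 * M) * h) by ring.
      apply Rle_trans with (s * exp (INR n * s) * A * h).
      - apply Rmult_le_compat_r; [lra|]. pose proof (pos_INR N).
        assert (P1 : 0 <= INR N * h) by (apply Rmult_le_pos; lra).
        assert (P2 : 0 < e) by apply exp_pos.
        apply Rmult_le_compat; try lra; [apply Rmult_le_pos; lra|].
        apply Rmult_le_compat; lra.
      - apply Rle_trans with (G * (eta / G)); [|right; field; lra].
        apply Rmult_le_compat; unfold G in *; lra. }
    set (c := coef F Q 0 i) in *. set (S := coef F Q (INR N * (sg * h)) i) in *.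
    assert (Hc : Cmod c * e <= Cmod S + eta).
    { replace (Cmod c * e) with (Cmod (RtoC e * c))
        by (rewrite Cmod_mult, Cmod_R, Rabs_pos_eq; [ring|apply Rlt_le, exp_pos]).
      replace (RtoC e * c)%C with (S + - (S - RtoC e * c))%C by ring.
      eapply Rle_trans; [apply Cmod_triangle|]. rewrite Cmod_opp. lra. }
    assert (HS : Cmod S ^ 2 <= Cmod (up i) ^ 2 + Cmod (dn i) ^ 2).
    { pose proof (pow2_ge_0 (Cmod (up i))). pose proof (pow2_ge_0 (Cmod (dn i))).
      unfold S. destruct Hsg as [->| ->].
      - replace (INR N * (1 * h)) with (INR N * h) by ring. fold (up i). lra.
      - replace (INR N * (-1 * h)) with (INR N * - h) by ring. fold (dn i). lra. }
    pose proof (Cmod_ge_0 c) as Hc0. pose proof (Cmod_ge_0 S) as HS0.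
    pose proof (exp_pos (s * degree i)) as He0.
    assert (HH : 0 <= Cmod c * exp (s * degree i) <= 2 * (Cmod S + eta)).
    { split; [nra|]. apply Rle_trans with (Cmod c * (2 * e)); [now apply Rmult_le_compat_l|nra]. }
    apply Rle_trans with ((2 * (Cmod S + eta)) ^ 2); [now apply pow_incr|].
    pose proof (pow2_ge_0 (Cmod S - eta)). nra. }
  eapply Rle_trans; [apply rsum_le; exact Hpt|].
  rewrite rsum_scal, rsum_plus, rsum_plus, rsum_const. fold d.
  destruct HF as [_ [HB _]].
  assert (Hub : rsum (fun i => Cmod (up i) ^ 2) (2 * n + 1) <= M ^ 2).
  { apply dft_bessel; [lia|]. intros j _. apply HB. rewrite Rabs_mult, !Rabs_pos_eq; try lra.
    apply pos_INR. }
  assert (Hdb : rsum (fun i => Cmod (dn i) ^ 2) (2 * n + 1) <= M ^ 2).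
  { apply dft_bessel; [lia|]. intros j _. apply HB.
    rewrite Rabs_mult, Rabs_Ropp, !Rabs_pos_eq; try lra. apply pos_INR. }
  assert (Hde : d * eta ^ 2 <= M ^ 2).
  { unfold eta. replace (d * (M / d) ^ 2) with (M ^ 2 * / d) by (field; lra).
    rewrite <- (Rmult_1_r (M ^ 2)) at 2. apply Rmult_le_compat_l; [apply pow2_ge_0|].
    rewrite <- Rinv_1. apply Rinv_le_contravar; lra. }
  lra.
Qed.

(** Second differences give quadratic decay for all frequencies that the nodes resolve,
    uniformly in the number of nodes. The exponential bound is available only for
    frequencies that are small compared with that number; this one covers the others. *)
Lemma coef_decay (F : C -> C) (s M rho K : R) (m i : nat) :
  let Q := (2 * m + 1)%nat in
  strip_control F s M rho K -> 0 <= s -> 2 * PI / INR Q <= rho -> (0 < i < Q)%nat ->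
  Cmod (coef F Q 0 i) <= 72 * K / INR i ^ 2.
Proof.
  intros Q HF Hs Hh Hi. set (h := 2 * PI / INR Q) in *.
  assert (HQ : 0 < INR Q) by (apply lt_0_INR; unfold Q; lia).
  assert (HQ' : (0 < Q)%nat) by (unfold Q; lia).
  pose proof PI_RGT_0 as HPI.
  assert (Hhp : 0 < h) by (apply Rdiv_lt_0_compat; lra).
  assert (H0s : Rabs 0 <= s) by (rewrite Rabs_R0; lra).
  destruct HF as [Hper [_ Hreg]].
  set (err := fun j => (F ((node Q j + h)%R, 0%R) + F ((node Q j - h)%R, 0%R)
     - 2 * F (node Q j, 0%R))%C).
  assert (He : Cmod (dft Q err (fr i)) <= 2 * K * h ^ 2).
  { apply dft_bound; [exact HQ'|]. intros j Hj. unfold err.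
    apply (regular_second_difference F rho); [|rewrite Rabs_pos_eq; lra].
    apply Hreg; [now apply node_range|exact H0s]. }
  set (c := coef F Q 0 i).
  assert (E : dft Q err (fr i) = (RtoC (- (4 * sin (fr i * h / 2) ^ 2)) * c)%C).
  { rewrite (dft_ext _ err (fun j => F ((node Q j + h)%R, 0%R)
      + (F ((node Q j + - h)%R, 0%R) + (- (2)) * F (node Q j, 0%R)))%C)
      by (intros; unfold err, Rminus; ring).
    rewrite dft_plus, dft_plus, !dft_scal.
    pose proof (fun x => Hper x 0 H0s) as Hp0.
    rewrite (dft_shift_signed Q (fun x => F (x, 0%R)) i h HQ' Hp0) by (left; easy).
    rewrite (dft_shift_signed Q (fun x => F (x, 0%R)) i (- h) HQ' Hp0) by (right; easy).
    fold (coef F Q 0 i). fold c.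
    replace (- (4 * sin (fr i * h / 2) ^ 2)) with (cos (fr i * h) + cos (fr i * - h) - 2).
    - replace (cis (fr i * h) * c + (cis (fr i * - h) * c + - (2) * c))%C
        with ((cis (fr i * h) + cis (fr i * - h) - 2) * c)%C by ring.
      f_equal. unfold cis. rewrite Ropp_mult_distr_r_reverse, sin_neg.
      apply injective_projections; simpl; ring.
    - rewrite Ropp_mult_distr_r_reverse, cos_neg.
      replace (fr i * h) with (2 * (fr i * h / 2)) at 1 2 by field.
      rewrite cos_2a_sin. ring. }
  rewrite E, Cmod_mult, Cmod_R, Rabs_Ropp, Rabs_pos_eq in He
    by (pose proof (pow2_ge_0 (sin (fr i * h / 2))); lra).
  assert (Hiq : INR i / 2 <= degree i) by apply degree_ge_half.
  assert (Hi1 : 1 <= INR i) by (apply one_le_INR; lia).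
  assert (Hdm : degree i <= INR m) by (apply degree_le; unfold Q in Hi; lia).
  assert (EQ : INR Q = 2 * INR m + 1) by (unfold Q; rewrite plus_INR, mult_INR; simpl; ring).
  assert (EPI : INR Q * h = 2 * PI) by (unfold h; field; lra).
  assert (Ha : Rabs (fr i * h / 2) = degree i * h / 2).
  { unfold Rdiv. rewrite !Rabs_mult, Rabs_fr, !Rabs_pos_eq; lra. }
  pose proof (Rabs_sin_ge (fr i * h / 2)) as Hsin. rewrite Ha in Hsin.
  specialize (Hsin ltac:(nra)).
  rewrite <- (pow2_abs (sin (fr i * h / 2))) in He.
  set (S := Rabs (sin (fr i * h / 2))) in *.
  assert (HS : (degree i * h / 2 / 3) ^ 2 <= S ^ 2) by (apply pow_incr; split; [nra|easy]).
  pose proof (Cmod_ge_0 c) as Hc0.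
  assert (Hdi2 : INR i ^ 2 / 4 <= degree i ^ 2) by nra.
  apply Rmult_le_reg_r with (INR i ^ 2); [nra|].
  replace (72 * K / INR i ^ 2 * INR i ^ 2) with (72 * K) by (field; lra).
  assert (Hh2 : 0 < h ^ 2) by nra.
  apply Rmult_le_reg_r with (h ^ 2); [easy|].
  assert (F1 : 4 * (degree i * h / 2 / 3) ^ 2 * Cmod c <= 2 * K * h ^ 2).
  { eapply Rle_trans; [|exact He]. apply Rmult_le_compat_r; [easy|]. lra. }
  assert (F2 : INR i ^ 2 / 4 * (Cmod c * h ^ 2) <= degree i ^ 2 * (Cmod c * h ^ 2)).
  { apply Rmult_le_compat_r; [nra|easy]. }
  nra.
Qed.

(** * Approximation by trigonometric polynomials *)

Lemma class_A_control (s M s' : R) (f : R -> C) :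
  0 < s' < s -> class_A s M f ->
  exists F rho K, (forall x : R, F (RtoC x) = f x) /\ 0 < rho /\ 0 <= K /\
    strip_control F s' M rho K.
Proof.
  intros Hs [Hper [F [HFf [HF HM]]]].
  destruct (analytic_regular_rectangle s s' F) as [rho [Hr [K [HK Hreg]]]]; [lra|easy|].
  exists F, rho, K. repeat split; try assumption.
  - intros x y Hy. apply (analytic_strip_periodic s F HF); [|lra].
    intros x'. now rewrite !HFf, Hper.
  - intros x y Hy.
    assert (B : Rbar_le (Cmod (F (x, y))) M).
    { eapply Rbar_le_trans; [|exact HM]. apply Lub_Rbar_correct.
      exists (x, y). split; [unfold strip; simpl; lra|easy]. }
    exact B.
Qed.

Lemma Cmod_cis_minus (u v : R) : Cmod (cis u - cis v) <= Rabs (u - v).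
Proof.
  replace (cis u - cis v)%C with (cis v * (cis (u - v) - 1))%C.
  - rewrite Cmod_mult, Cmod_cis, Rmult_1_l.
    apply Rsqr_incr_0_var; [|apply Rabs_pos].
    rewrite !Rsqr_pow2, Cmod_sq_cis_minus_1, <- (pow2_abs (sin _)).
    pose proof (Rabs_sin_le ((u - v) / 2)) as H.
    unfold Rdiv in H at 2. rewrite Rabs_mult, (Rabs_pos_eq (/ 2)) in H by lra.
    pose proof (Rabs_pos (sin ((u - v) / 2))). nra.
  - replace (cis u) with (cis v * cis (u - v))%C by (rewrite <- cis_plus; f_equal; ring). ring.
Qed.

Lemma trig_poly_lipschitz (b : nat -> C) (n : nat) (B x y : R) :
  (forall i, (i < 2 * n + 1)%nat -> Cmod (b i) <= B) ->
  Cmod (trig_poly b (2 * n + 1) x - trig_poly b (2 * n + 1) y)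
    <= INR (2 * n + 1) * (B * INR n) * Rabs (x - y).
Proof.
  intros HB. unfold trig_poly. rewrite <- csum_minus.
  rewrite Rmult_assoc, <- rsum_const. apply Cmod_csum_le_bound. intros i Hi.
  replace (b i * cis (fr i * x) - b i * cis (fr i * y))%C
    with (b i * (cis (fr i * x) - cis (fr i * y)))%C by ring.
  rewrite Cmod_mult, Rmult_assoc.
  apply Rmult_le_compat; try apply Cmod_ge_0; [auto|].
  eapply Rle_trans; [apply Cmod_cis_minus|].
  replace (fr i * x - fr i * y) with (fr i * (x - y)) by ring.
  rewrite Rabs_mult, Rabs_fr. apply Rmult_le_compat_r; [apply Rabs_pos|now apply degree_le].
Qed.

(** Compare with the telescoping sum of [2 / t - 2 / (t + 1)]. *)
Lemma inverse_square_tail (N L : nat) :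
  (0 < N)%nat -> rsum (fun j => / INR (N + j) ^ 2) L <= 2 / INR N.
Proof.
  intros HN.
  assert (H : rsum (fun j => / INR (N + j) ^ 2) L <= 2 / INR N - 2 / INR (N + L)).
  { induction L as [|L IH].
    - rewrite Nat.add_0_r. simpl. lra.
    - rewrite rsum_S. rewrite Nat.add_succ_r, S_INR.
      set (t := INR (N + L)) in *. assert (Ht : 1 <= t) by (apply one_le_INR; lia).
      enough (/ t ^ 2 <= 2 / t - 2 / (t + 1)) by lra.
      replace (2 / t - 2 / (t + 1)) with (2 / (t * (t + 1))) by (field; lra).
      apply Rmult_le_reg_r with (t ^ 2 * (t + 1)); [nra|].
      replace (/ t ^ 2 * (t ^ 2 * (t + 1))) with (t + 1) by (field; lra).
      replace (2 / (t * (t + 1)) * (t ^ 2 * (t + 1))) with (2 * t) by (field; lra). lra. }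
  assert (0 <= 2 / INR (N + L)).
  { apply Rlt_le, Rdiv_lt_0_compat; [lra|apply lt_0_INR; lia]. }
  lra.
Qed.

Lemma exp_INR (x : R) (n : nat) : exp (x * INR n) = exp x ^ n.
Proof.
  induction n; [simpl; rewrite Rmult_0_r; apply exp_0|].
  rewrite S_INR, Rmult_plus_distr_l, exp_plus, IHn, Rmult_1_r. simpl. ring.
Qed.

Lemma weighted_coef_le (M s : R) (b : nat -> C) (N i : nat) :
  0 < M ->
  rsum (fun i => (Cmod (b i) * exp (s * degree i)) ^ 2) N <= 24 * M ^ 2 -> (i < N)%nat ->
  Cmod (b i) <= 5 * M * exp (- (s * degree i)).
Proof.
  intros HM H Hi.
  pose proof (rsum_term_le (fun i => (Cmod (b i) * exp (s * degree i)) ^ 2) N i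
    (fun _ => pow2_ge_0 _) Hi) as H1. cbv beta in H1.
  pose proof (exp_pos (s * degree i)) as He. pose proof (Cmod_ge_0 (b i)) as Hb.
  assert (H2 : Cmod (b i) * exp (s * degree i) <= 5 * M).
  { apply Rsqr_incr_0_var; [|lra]. rewrite !Rsqr_pow2. nra. }
  rewrite exp_Ropp. apply Rmult_le_reg_r with (exp (s * degree i)); [easy|].
  rewrite Rmult_assoc, Rinv_l by lra. lra.
Qed.

(** The coefficients are those of a discrete transform with very many nodes, which
    reproduces [f] at the nodes; dropping the frequencies beyond [n] costs a geometric
    tail and then a quadratic one that is negligible. How many nodes are needed depends
    on [f], which is harmless, since the bounds do not. *)
Lemma trig_approximation (M s s' : R) (f : R -> C) (n : nat) (eta : R) :
  0 < M -> 0 < s' < s -> class_A s M f -> 0 < eta ->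
  exists b : nat -> C,
    rsum (fun i => (Cmod (b i) * exp (s' * degree i)) ^ 2) (2 * n + 1) <= 24 * M ^ 2 /\
    forall x, 0 <= x <= 2 * PI ->
      Cmod (f x - trig_poly b (2 * n + 1) x)
        <= 5 * M * exp (- (s' * INR n)) / (1 - exp (- (s' / 2))) + eta.
Proof.
  intros HM Hs Hf Heta.
  destruct (class_A_control s M s' f Hs Hf) as [F [rho [K [HFf [Hrho [HK HF]]]]]].
  (* beyond frequency [n1] the quadratic decay leaves less than [eta / 3] *)
  destruct (INR_unbounded (3 * 144 * K / eta)) as [N1 HN1].
  set (n1 := (n + N1)%nat).
  destruct (coef_weighted_l2 F s' M rho K n1 HF HM HK Hrho) as [h0 [Hh0 Hl2]]; [lra|].
  set (LF := 2 * M / rho + 2 * K * rho).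
  set (LG := INR (2 * n + 1) * (5 * M * INR n)).
  assert (HLF : 0 <= LF).
  { unfold LF. assert (0 < 2 * M / rho) by (apply Rdiv_lt_0_compat; lra). nra. }
  assert (HLG : 0 <= LG).
  { unfold LG. pose proof (pos_INR (2 * n + 1)). pose proof (pos_INR n).
    repeat apply Rmult_le_pos; lra. }
  (* between nodes, both functions move by at most [eta / 3] together *)
  set (h1 := Rmin (Rmin h0 rho) (eta / (3 * (LF + LG + 1)))).
  assert (Hh1 : 0 < h1) by (repeat apply Rmin_pos; try apply Rdiv_lt_0_compat; lra).
  pose proof PI_RGT_0 as HPI.
  destruct (INR_unbounded (2 * PI / h1)) as [m1 Hm1].
  set (m := (n1 + m1)%nat). set (Q := (2 * m + 1)%nat).
  assert (HQm : INR m1 <= INR Q) by (apply le_INR; unfold Q, m; lia).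
  assert (HQ : 0 < INR Q) by (apply lt_0_INR; unfold Q; lia).
  set (h := 2 * PI / INR Q).
  assert (Hhp : 0 < h) by (apply Rdiv_lt_0_compat; lra).
  assert (Hhh : h <= h1).
  { apply Rmult_le_reg_r with (INR Q); [easy|]. unfold h.
    replace (2 * PI / INR Q * INR Q) with (2 * PI / h1 * h1) by (field; lra).
    rewrite (Rmult_comm h1). apply Rmult_le_compat_r; lra. }
  assert (Hhr : h <= rho).
  { eapply Rle_trans; [exact Hhh|eapply Rle_trans; [apply Rmin_l|apply Rmin_r]]. }
  assert (Hhh0 : h <= h0).
  { eapply Rle_trans; [exact Hhh|eapply Rle_trans; [apply Rmin_l|apply Rmin_l]]. }
  assert (Hhe : (LF + LG) * h <= eta / 3).
  { apply Rle_trans with ((LF + LG + 1) * (eta / (3 * (LF + LG + 1)))).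
    - apply Rmult_le_compat; try lra. eapply Rle_trans; [exact Hhh|apply Rmin_r].
    - right. field. lra. }
  specialize (Hl2 m ltac:(unfold m; lia) Hhh0). fold Q in Hl2.
  set (c := coef F Q 0) in *.
  exists c. split.
  { eapply Rle_trans; [|exact Hl2]. apply rsum_monotone; [intros; apply pow2_ge_0|unfold n1; lia]. }
  assert (Hc : forall i, (i < 2 * n1 + 1)%nat -> Cmod (c i) <= 5 * M * exp (- (s' * degree i)))
    by (intros i; now apply weighted_coef_le).
  set (q := exp (- (s' / 2))).
  assert (Hq0 : 0 < q) by apply exp_pos.
  assert (Hq1 : q < 1) by (unfold q; rewrite <- exp_0; apply exp_increasing; lra).
  assert (Hnode : forall j, (j < Q)%nat ->
    Cmod (f (node Q j) - trig_poly c (2 * n + 1) (node Q j))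
      <= 5 * M * exp (- (s' * INR n)) / (1 - q) + eta / 3).
  { intros j Hj.
    pose proof (dft_inversion m (fun j => F (node Q j, 0)) j Hj) as Inv. fold Q in Inv.
    cbv beta in Inv. change (node Q j, 0) with (RtoC (node Q j)) in Inv. rewrite HFf in Inv.
    rewrite <- Inv. clear Inv.
    set (g := fun i => (c i * cis (fr i * node Q j))%C).
    change (csum _ Q) with (csum g Q).
    assert (EQ : Q = ((2 * n + 1) + 2 * N1 + 2 * m1)%nat) by (unfold Q, m, n1; lia).
    rewrite (f_equal (csum g) EQ).
    rewrite csum_split, csum_split. unfold g. fold (trig_poly c (2 * n + 1) (node Q j)).
    set (p := trig_poly c (2 * n + 1) (node Q j)).
    match goal with |- Cmod (p + ?u + ?v - p) <= _ =>
      replace (p + u + v - p)%C with (u + v)%C by ring end.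
    eapply Rle_trans; [apply Cmod_triangle|]. apply Rplus_le_compat.
    - apply Rle_trans with (rsum (fun i => 5 * M * exp (- (s' * INR n)) * q ^ i) (2 * N1)).
      + apply Cmod_csum_le_bound. intros i Hi. rewrite Cmod_mult, Cmod_cis, Rmult_1_r.
        eapply Rle_trans; [apply Hc; unfold n1; lia|]. rewrite !Rmult_assoc.
        do 2 (apply Rmult_le_compat_l; [lra|]).
        unfold q. rewrite <- exp_INR, <- exp_plus. apply exp_le_exp.
        pose proof (degree_ge_half (2 * n + 1 + i)) as Hdg.
        rewrite !plus_INR, mult_INR in Hdg. simpl INR in Hdg. nra.
      + rewrite rsum_scal. apply Rmult_le_compat_l.
        * pose proof (exp_pos (- (s' * INR n))). repeat apply Rmult_le_pos; lra.
        * apply geometric_sum_le. lra.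
    - apply Rle_trans with (rsum (fun i => 72 * K * / INR (2 * n + 1 + 2 * N1 + i) ^ 2) (2 * m1)).
      + apply Cmod_csum_le_bound. intros i Hi. rewrite Cmod_mult, Cmod_cis, Rmult_1_r.
        apply (coef_decay F s' M rho K m); [easy|lra|exact Hhr|unfold m, n1; lia].
      + rewrite rsum_scal.
        assert (HB : 3 * 144 * K / eta <= INR (2 * n + 1 + 2 * N1)).
        { apply Rle_trans with (INR N1); [lra|apply le_INR; lia]. }
        pose proof (inverse_square_tail (2 * n + 1 + 2 * N1) (2 * m1) ltac:(lia)) as Ht.
        assert (H0 : 0 < INR (2 * n + 1 + 2 * N1)) by (apply lt_0_INR; lia).
        set (P := INR (2 * n + 1 + 2 * N1)) in *.
        apply Rle_trans with (72 * K * (2 / P)); [apply Rmult_le_compat_l; lra|].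
        apply Rmult_le_reg_r with (P * (3 / eta)).
        { apply Rmult_lt_0_compat; [easy|apply Rdiv_lt_0_compat; lra]. }
        replace (72 * K * (2 / P) * (P * (3 / eta))) with (3 * 144 * K / eta) by (field; lra).
        replace (eta / 3 * (P * (3 / eta))) with P by (field; lra). exact HB. }
  intros x Hx.
  assert (Hj : exists j, (j < Q)%nat /\ 0 <= x - node Q j <= h).
  { destruct (nfloor_ex (x / h)) as [j [Hj1 Hj2]].
    { apply Rmult_le_pos; [lra|]. apply Rlt_le, Rinv_0_lt_compat, Hhp. }
    assert (A1 : INR j * h <= x).
    { apply Rle_trans with (x / h * h); [apply Rmult_le_compat_r; lra|right; field; lra]. }
    assert (A2 : x <= (INR j + 1) * h).
    { apply Rle_trans with (x / h * h); [right; field; lra|apply Rmult_le_compat_r; lra]. }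
    assert (A3 : INR Q * h = 2 * PI) by (unfold h; field; lra).
    destruct (le_lt_dec Q j) as [HQj|HQj].
    - exists (pred Q). split; [unfold Q; lia|]. unfold node. fold h.
      assert (A4 : INR (pred Q) = INR Q - 1)
        by (replace Q with (S (pred Q)) at 2 by (unfold Q; lia); rewrite S_INR; ring).
      rewrite A4. apply le_INR in HQj. nra.
    - exists j. split; [exact HQj|]. unfold node. fold h. lra. }
  destruct Hj as [j [Hj Hxj]].
  specialize (Hnode j Hj).
  assert (Lf : Cmod (f x - f (node Q j)) <= LF * h).
  { destruct HF as [_ [HB Hreg]].
    pose proof (regular_lipschitz F rho K M (node Q j) 0 (x - node Q j)) as Lip.
    replace (node Q j + (x - node Q j)) with x in Lip by ring.
    change (x, 0) with (RtoC x) in Lip. change (node Q j, 0) with (RtoC (node Q j)) in Lip.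
    rewrite !HFf in Lip. eapply Rle_trans.
    - apply Lip; try assumption.
      + apply Hreg; [now apply node_range|rewrite Rabs_R0; lra].
      + rewrite Rabs_pos_eq; lra.
      + intros x'. apply HB. rewrite Rabs_R0. lra.
    - fold LF. apply Rmult_le_compat_l; [easy|]. rewrite Rabs_pos_eq; lra. }
  assert (Lg : Cmod (trig_poly c (2 * n + 1) (node Q j) - trig_poly c (2 * n + 1) x) <= LG * h).
  { eapply Rle_trans; [apply (trig_poly_lipschitz c n (5 * M))|].
    - intros i Hi. eapply Rle_trans; [apply Hc; unfold n1; lia|].
      rewrite <- (Rmult_1_r (5 * M)) at 2. apply Rmult_le_compat_l; [lra|].
      rewrite <- exp_0. apply exp_le_exp. pose proof (degree_ge_0 i). nra.
    - fold LG. apply Rmult_le_compat_l; [easy|]. rewrite Rabs_minus_sym, Rabs_pos_eq; lra. }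
  replace (f x - trig_poly c (2 * n + 1) x)%C with
    (f x - f (node Q j) + (f (node Q j) - trig_poly c (2 * n + 1) (node Q j))
      + (trig_poly c (2 * n + 1) (node Q j) - trig_poly c (2 * n + 1) x))%C by ring.
  eapply Rle_trans; [apply Cmod_triangle|].
  eapply Rle_trans; [apply Rplus_le_compat_r, Cmod_triangle|]. lra.
Qed.

(** * Trigonometric polynomials belong to the class *)

Definition cexp (z : C) : C := (RtoC (exp (Re z)) * cis (Im z))%C.

Lemma cexp_plus (a b : C) : cexp (a + b) = (cexp a * cexp b)%C.
Proof.
  unfold cexp. change (Re (a + b)) with (Re a + Re b). change (Im (a + b)) with (Im a + Im b).
  rewrite exp_plus, RtoC_mult, cis_plus. ring.
Qed.

Lemma Cmod_cexp (z : C) : Cmod (cexp z) = exp (Re z).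
Proof.
  unfold cexp. rewrite Cmod_mult, Cmod_cis, Cmod_R, Rabs_pos_eq, Rmult_1_r; [easy|].
  apply Rlt_le, exp_pos.
Qed.

Definition taylor_term (r : nat -> R) (t : R) (n : nat) : R := t ^ n / INR (fact n) * r n.

Lemma is_derive_monomial (c t : R) (N : nat) :
  is_derive (fun t => c * (t ^ S N / INR (fact (S N)))) t (c * (t ^ N / INR (fact N))).
Proof.
  auto_derive; [easy|].
  change (fact N + N * fact N)%nat with (S N * fact N)%nat. rewrite mult_INR.
  change (match N with O => 1 | S _ => INR N + 1 end) with (INR (S N)).
  field.
  split; [apply INR_fact_neq_0|apply not_0_INR; lia].
Qed.

Lemma is_derive_taylor_sum (r : nat -> R) (N : nat) (t : R) :
  is_derive (fun t => rsum (taylor_term r t) (S N)) t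
    (rsum (taylor_term (fun n => r (S n)) t) N).
Proof.
  induction N as [|N IH].
  - apply (is_derive_ext (fun _ => r 0%nat)).
    + intros u. unfold taylor_term. simpl. field.
    + apply @is_derive_const.
  - rewrite rsum_S. apply (is_derive_ext (fun t => rsum (taylor_term r t) (S N)
      + taylor_term r t (S N))); [intros; easy|].
    apply @is_derive_plus; [exact IH|]. unfold taylor_term. rewrite Rmult_comm.
    apply (is_derive_ext (fun t => r (S N) * (t ^ S N / INR (fact (S N))))).
    + intros u. apply Rmult_comm.
    + apply is_derive_monomial.
Qed.

(** Comparison with a multiple of the antiderivative, by the mean value theorem. *)
Lemma bound_from_derivative (u u' : R -> R) (c : R) (N : nat) :
  u 0 = 0 -> (forall t, is_derive u t (u' t)) ->
  (forall t, 0 <= t <= 1 -> Rabs (u' t) <= c * (t ^ N / INR (fact N))) ->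
  forall t, 0 <= t <= 1 -> Rabs (u t) <= c * (t ^ S N / INR (fact (S N))).
Proof.
  assert (P : forall u u', u 0 = 0 -> (forall t, is_derive u t (u' t)) ->
    (forall t, 0 <= t <= 1 -> u' t <= c * (t ^ N / INR (fact N))) ->
    forall t, 0 <= t <= 1 -> u t <= c * (t ^ S N / INR (fact (S N)))).
  { clear u u'. intros u u' H0 Hd Hb t Ht.
    set (g := fun t => u t - c * (t ^ S N / INR (fact (S N)))).
    set (g' := fun t => u' t - c * (t ^ N / INR (fact N))).
    assert (Hg : forall x, is_derive g x (g' x)).
    { intros x. apply @is_derive_minus; [apply Hd|]. apply is_derive_monomial. }
    destruct (MVT_gen g 0 t g') as [y [Hy E]].
    - intros x _. apply Hg.
    - intros x _. apply derivable_continuous_pt. exists (g' x). apply is_derive_Reals, Hg.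
    - rewrite Rmin_left, Rmax_right in Hy by lra.
      assert (G0 : g 0 = 0) by (unfold g; rewrite H0; simpl; unfold Rdiv; ring).
      assert (G1 : g' y <= 0) by (unfold g'; specialize (Hb y ltac:(lra)); lra).
      rewrite G0 in E. assert (g t <= 0) by nra. unfold g in H. lra. }
  intros H0 Hd Hb t Ht. apply Rabs_le. split.
  - enough (- u t <= c * (t ^ S N / INR (fact (S N)))) by lra.
    apply (P (fun t => - u t) (fun t => - u' t)); [rewrite H0; ring| | |exact Ht].
    + intros x. apply @is_derive_opp, Hd.
    + intros x Hx. specialize (Hb x Hx). apply Rabs_le_between in Hb. lra.
  - apply (P u u' H0 Hd); [|exact Ht]. intros x Hx. specialize (Hb x Hx).
    apply Rabs_le_between in Hb. lra.
Qed.

(** Both components of the Taylor remainder of [t |-> e^(t v)] are estimated at once, by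
    integrating the differential equation that links order [N + 1] to order [N]. *)
Lemma cexp_taylor (v : C) (N : nat) :
  let V := Rabs (Re v) + Rabs (Im v) in
  let B := exp (Rabs (Re v)) in
  forall t, 0 <= t <= 1 ->
  Rabs (exp (Re v * t) * cos (Im v * t) - rsum (taylor_term (fun n => Re (v ^ n)%C) t) N)
    <= B * V ^ N * (t ^ N / INR (fact N)) /\
  Rabs (exp (Re v * t) * sin (Im v * t) - rsum (taylor_term (fun n => Im (v ^ n)%C) t) N)
    <= B * V ^ N * (t ^ N / INR (fact N)).
Proof.
  intros V B. set (al := Re v) in *. set (be := Im v) in *.
  assert (HB : 0 < B) by apply exp_pos.
  assert (HV : 0 <= V) by (unfold V; pose proof (Rabs_pos al); pose proof (Rabs_pos be); lra).
  induction N as [|N IH]; intros t Ht.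
  - simpl rsum. rewrite !Rminus_0_r. simpl.
    replace (B * 1 * (1 / 1)) with (B * 1) by field.
    assert (He : 0 <= exp (al * t) <= B).
    { split; [apply Rlt_le, exp_pos|]. apply exp_le_exp.
      pose proof (Rle_abs al). pose proof (Rabs_pos al). nra. }
    rewrite !Rabs_mult, !(Rabs_pos_eq (exp (al * t))) by lra.
    pose proof (COS_bound (be * t)). pose proof (SIN_bound (be * t)).
    split; apply Rmult_le_compat; try apply Rabs_pos; try lra; apply Rabs_le; lra.
  - set (RN := fun t => exp (al * t) * cos (be * t) - rsum (taylor_term (fun n => Re (v ^ n)%C) t) N) in *.
    set (IN := fun t => exp (al * t) * sin (be * t) - rsum (taylor_term (fun n => Im (v ^ n)%C) t) N) in *.
    assert (Bd : forall a b t, 0 <= t <= 1 -> Rabs a + Rabs b <= V ->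
      Rabs (a * RN t + b * IN t) <= B * V ^ S N * (t ^ N / INR (fact N))).
    { intros a b u Hu Hab. destruct (IH u Hu) as [H1 H2].
      fold (RN u) in H1. fold (IN u) in H2.
      set (X := B * V ^ N * (u ^ N / INR (fact N))) in *.
      replace (B * V ^ S N * (u ^ N / INR (fact N))) with (V * X) by (unfold X; simpl; ring).
      eapply Rle_trans; [apply Rabs_triang|]. rewrite !Rabs_mult.
      pose proof (Rabs_pos a). pose proof (Rabs_pos b).
      pose proof (Rabs_pos (RN u)). pose proof (Rabs_pos (IN u)). nra. }
    assert (Dr : forall t, rsum (taylor_term (fun n => Re (v ^ S n)%C) t) N
      = al * rsum (taylor_term (fun n => Re (v ^ n)%C) t) N
        + - be * rsum (taylor_term (fun n => Im (v ^ n)%C) t) N).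
    { intros u. rewrite <- !rsum_scal, <- rsum_plus. apply rsum_ext. intros n _.
      unfold taylor_term. change (Re (v ^ S n)%C) with (al * Re (v ^ n)%C - be * Im (v ^ n)%C). ring. }
    assert (Di : forall t, rsum (taylor_term (fun n => Im (v ^ S n)%C) t) N
      = be * rsum (taylor_term (fun n => Re (v ^ n)%C) t) N
        + al * rsum (taylor_term (fun n => Im (v ^ n)%C) t) N).
    { intros u. rewrite <- !rsum_scal, <- rsum_plus. apply rsum_ext. intros n _.
      unfold taylor_term. change (Im (v ^ S n)%C) with (al * Im (v ^ n)%C + be * Re (v ^ n)%C). ring. }
    assert (Z : forall r, rsum (taylor_term r 0) (S N) = r 0%nat).
    { intros r. rewrite rsum_first.
      rewrite (rsum_ext _ (fun _ => 0)) by (intros; unfold taylor_term; simpl; unfold Rdiv; ring).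
      rewrite rsum_const. unfold taylor_term. simpl. field. }
    split.
    + apply (bound_from_derivative
        (fun t => exp (al * t) * cos (be * t) - rsum (taylor_term (fun n => Re (v ^ n)%C) t) (S N))
        (fun t => al * RN t + - be * IN t)); [| | |exact Ht].
      * rewrite Z, !Rmult_0_r, exp_0, cos_0. simpl. ring.
      * intros u. replace (al * RN u + - be * IN u)
          with ((al * exp (al * u) * cos (be * u) - be * exp (al * u) * sin (be * u))
            - rsum (taylor_term (fun n => Re (v ^ S n)%C) u) N)
          by (rewrite Dr; unfold RN, IN; ring).
        apply @is_derive_minus; [auto_derive; [easy|ring]|].
        apply (is_derive_taylor_sum (fun n => Re (v ^ n)%C)).
      * intros u Hu. apply Bd; [exact Hu|]. rewrite Rabs_Ropp. unfold V. lra.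
    + apply (bound_from_derivative
        (fun t => exp (al * t) * sin (be * t) - rsum (taylor_term (fun n => Im (v ^ n)%C) t) (S N))
        (fun t => be * RN t + al * IN t)); [| | |exact Ht].
      * rewrite Z, !Rmult_0_r, sin_0. simpl. ring.
      * intros u. replace (be * RN u + al * IN u)
          with ((al * exp (al * u) * sin (be * u) + be * exp (al * u) * cos (be * u))
            - rsum (taylor_term (fun n => Im (v ^ S n)%C) u) N)
          by (rewrite Di; unfold RN, IN; ring).
        apply @is_derive_minus; [auto_derive; [easy|ring]|].
        apply (is_derive_taylor_sum (fun n => Im (v ^ n)%C)).
      * intros u Hu. apply Bd; [exact Hu|]. unfold V. lra.
Qed.

Lemma cexp_series_bound (v : C) (N : nat) :
  let V := Rabs (Re v) + Rabs (Im v) in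
  Cmod (csum (fun n => RtoC (/ INR (fact n)) * v ^ n)%C N - cexp v)
    <= 2 * exp (Rabs (Re v)) * (V ^ N / INR (fact N)).
Proof.
  intros V. destruct (cexp_taylor v N 1 ltac:(lra)) as [H1 H2]. fold V in H1, H2.
  assert (E : csum (fun n => RtoC (/ INR (fact n)) * v ^ n)%C N
    = (rsum (taylor_term (fun n => Re (v ^ n)%C) 1) N,
       rsum (taylor_term (fun n => Im (v ^ n)%C) 1) N)).
  { clear. induction N; [easy|]. rewrite csum_S, IHN, !rsum_S.
    unfold taylor_term. rewrite pow1.
    apply injective_projections; simpl; unfold Re, Im; field; apply INR_fact_neq_0. }
  rewrite E.
  rewrite !Rmult_1_r in H1, H2. rewrite pow1 in H1, H2.
  set (X := rsum (taylor_term (fun n => Re (v ^ n)%C) 1) N) in *.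
  set (Y := rsum (taylor_term (fun n => Im (v ^ n)%C) 1) N) in *.
  replace ((X, Y) - cexp v)%C with (X - exp (Re v) * cos (Im v), Y - exp (Re v) * sin (Im v))
    by (unfold cexp, cis; apply injective_projections; simpl; ring).
  eapply Rle_trans; [apply Cmod_pair_le|].
  rewrite Rabs_minus_sym in H1. rewrite Rabs_minus_sym in H2.
  unfold Rdiv in *. lra.
Qed.

Lemma cexp_pseries (c v : C) (a w : C) : v = (c * w)%C ->
  @is_pseries C_AbsRing C_NormedModule
    (fun n => a * (RtoC (/ INR (fact n)) * c ^ n))%C w (a * cexp v)%C.
Proof.
  intros Hv. apply is_pseries_csum. intros eta Heta.
  set (V := Rabs (Re v) + Rabs (Im v)).
  set (G := Cmod a * (2 * exp (Rabs (Re v)))).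
  assert (HG : 0 <= G).
  { unfold G. pose proof (Cmod_ge_0 a). pose proof (exp_pos (Rabs (Re v))).
    apply Rmult_le_pos; lra. }
  destruct (cv_speed_pow_fact V (eta / (G + 1))) as [N0 HN];
    [apply Rdiv_lt_0_compat; lra|].
  exists N0. intros N HN'. specialize (HN N HN').
  unfold Rdist in HN. rewrite Rminus_0_r in HN. apply Rabs_def2 in HN.
  rewrite (csum_ext _ (fun n => a * (RtoC (/ INR (fact n)) * v ^ n))%C).
  - rewrite csum_scal.
    replace (a * csum (fun n => RtoC (/ INR (fact n)) * v ^ n) N - a * cexp v)%C
      with (a * (csum (fun n => RtoC (/ INR (fact n)) * v ^ n) N - cexp v))%C by ring.
    rewrite Cmod_mult. pose proof (cexp_series_bound v N) as H. fold V in H.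
    apply Rle_lt_trans with (G * (V ^ N / INR (fact N))).
    + unfold G. rewrite Rmult_assoc. apply Rmult_le_compat_l; [apply Cmod_ge_0|exact H].
    + apply Rle_lt_trans with (G * (eta / (G + 1))); [apply Rmult_le_compat_l; lra|].
      apply Rmult_lt_reg_r with (G + 1); [lra|].
      replace (G * (eta / (G + 1)) * (G + 1)) with (G * eta) by (field; lra). nra.
  - intros n _. rewrite Hv. rewrite Cpow_mult_l. ring.
Qed.

Definition trig_ext (b : nat -> C) (N : nat) (z : C) : C :=
  csum (fun i => b i * cexp (Ci * RtoC (fr i) * z))%C N.

Lemma trig_ext_real (b : nat -> C) (N : nat) (x : R) :
  trig_ext b N (RtoC x) = trig_poly b N x.
Proof.
  unfold trig_ext, trig_poly. apply csum_ext. intros i _. f_equal. unfold cexp.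
  replace (Re (Ci * RtoC (fr i) * RtoC x)) with 0 by (simpl; ring).
  replace (Im (Ci * RtoC (fr i) * RtoC x)) with (fr i * x) by (simpl; ring).
  rewrite exp_0. ring.
Qed.

(** The expansion about [z0] is [e^(c z0)] times that of [e^(c w)] at [0], by the
    functional equation of the exponential. *)
Lemma trig_ext_analytic (D : C -> Prop) (b : nat -> C) (N : nat) :
  analytic_on D (trig_ext b N).
Proof.
  intros z0 _.
  enough (H : exists a : nat -> C, forall z,
    @is_pseries C_AbsRing C_NormedModule a (z - z0)%C (trig_ext b N z)).
  { destruct H as [a Ha]. exists a, 1. split; [apply Rlt_0_1|]. intros z _. apply Ha. }
  induction N as [|N [a Ha]].
  - exists (fun _ => RtoC 0). intros z. apply is_pseries_csum. intros eta Heta. exists 0%nat.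
    intros N _. rewrite (csum_ext _ (fun _ => RtoC 0)) by (intros; ring).
    rewrite csum_const. unfold trig_ext. simpl csum.
    replace (INR N * 0 - 0)%C with (RtoC 0) by ring. now rewrite Cmod_0.
  - set (c := (Ci * RtoC (fr N))%C).
    exists (PS_plus a (fun n => b N * cexp (c * z0) * (RtoC (/ INR (fact n)) * c ^ n))%C).
    intros z.
    pose proof (cexp_pseries c (c * (z - z0))%C (b N * cexp (c * z0))%C (z - z0)%C eq_refl) as P.
    replace (b N * cexp (c * z0) * cexp (c * (z - z0)))%C with (b N * cexp (c * z))%C in P.
    + exact (@is_pseries_plus C_AbsRing C_NormedModule _ _ _ _ _ (Ha z) P).
    + rewrite <- Cmult_assoc, <- cexp_plus. do 2 f_equal. ring.
Qed.

Lemma trig_ext_bound (s : R) (b : nat -> C) (N : nat) (z : C) :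
  strip s z -> Cmod (trig_ext b N z) <= rsum (fun i => Cmod (b i) * exp (s * degree i)) N.
Proof.
  intros Hz. unfold trig_ext. apply Cmod_csum_le_bound. intros i _.
  rewrite Cmod_mult, Cmod_cexp. apply Rmult_le_compat_l; [apply Cmod_ge_0|].
  apply exp_le_exp.
  replace (Re (Ci * RtoC (fr i) * z)) with (- (fr i * Im z))
    by (unfold Im; simpl; ring).
  eapply Rle_trans; [apply Rle_abs|]. rewrite Rabs_Ropp, Rabs_mult, Rabs_fr.
  rewrite Rmult_comm. apply Rmult_le_compat_r; [apply degree_ge_0|].
  unfold strip in Hz. lra.
Qed.

Lemma cis_fr_periodic (i : nat) (x : R) : cis (fr i * (x + 2 * PI)) = cis (fr i * x).
Proof.
  rewrite Rmult_plus_distr_l, cis_plus.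
  replace (fr i * (2 * PI)) with (2 * PI * IZR (freq i)) by (unfold fr; ring).
  rewrite cis_2PI_IZR. ring.
Qed.

Lemma trig_poly_periodic (b : nat -> C) (N : nat) : periodic_2pi (trig_poly b N).
Proof.
  intros x. unfold trig_poly. apply csum_ext. intros i _. now rewrite cis_fr_periodic.
Qed.

Lemma trig_poly_class_A (s M : R) (b : nat -> C) (N : nat) :
  rsum (fun i => Cmod (b i) * exp (s * degree i)) N <= M -> class_A s M (trig_poly b N).
Proof.
  intros H. split; [apply trig_poly_periodic|].
  exists (trig_ext b N). split; [intros; apply trig_ext_real|].
  split; [apply trig_ext_analytic|].
  apply Lub_Rbar_correct. intros r [z [Hz ->]]. simpl.
  eapply Rle_trans; [apply (trig_ext_bound s), Hz|exact H].
Qed.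

(** * The uniform metric *)

Lemma lipschitz_continuous (f : R -> C) (L x : R) :
  0 <= L -> (forall y, Cmod (f y - f x) <= L * Rabs (y - x)) -> continuous f x.
Proof.
  intros HL H. apply filterlim_locally. intros eps.
  assert (He := cond_pos eps).
  assert (Hd : 0 < eps / (L + 1)) by (apply Rdiv_lt_0_compat; lra).
  exists (mkposreal _ Hd). intros y Hy.
  assert (Hy' : Rabs (y - x) < eps / (L + 1)) by exact Hy.
  assert (B : Cmod (f y - f x) < eps).
  { eapply Rle_lt_trans; [apply H|]. pose proof (Rabs_pos (y - x)).
    replace (pos eps) with ((L + 1) * (eps / (L + 1))) by (field; lra). nra. }
  pose proof (Rmax_Cmod (f y - f x)%C) as Hm.
  split.
  - change (Rabs (fst (f y) - fst (f x)) < eps).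
    eapply Rle_lt_trans; [|exact B]. eapply Rle_trans; [|exact Hm]. apply Rmax_l.
  - change (Rabs (snd (f y) - snd (f x)) < eps).
    eapply Rle_lt_trans; [|exact B]. eapply Rle_trans; [|exact Hm]. apply Rmax_r.
Qed.

Lemma trig_poly_cont_periodic (b : nat -> C) (n : nat) :
  cont_periodic (trig_poly b (2 * n + 1)).
Proof.
  split; [|apply trig_poly_periodic]. intros x.
  assert (HB : 0 <= rsum (fun i => Cmod (b i)) (2 * n + 1))
    by (apply rsum_ge_0; intros; apply Cmod_ge_0).
  apply (lipschitz_continuous _
    (INR (2 * n + 1) * (rsum (fun i => Cmod (b i)) (2 * n + 1) * INR n))).
  - pose proof (pos_INR n). pose proof (pos_INR (2 * n + 1)).
    repeat apply Rmult_le_pos; lra.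
  - intros y. apply trig_poly_lipschitz. intros i Hi.
    apply (rsum_term_le (fun i => Cmod (b i))); [intros; apply Cmod_ge_0|exact Hi].
Qed.

Lemma d_2pi_le (f g : R -> C) (e : R) :
  (forall x, 0 <= x <= 2 * PI -> Cmod (f x - g x) <= e) -> d_2pi f g <= e.
Proof.
  intros H. unfold d_2pi, sup_over.
  match goal with |- context [Lub_Rbar ?E] => set (S := E) end.
  destruct (Lub_Rbar_correct S) as [_ Hl].
  assert (Hle : Rbar_le (Lub_Rbar S) e).
  { apply Hl. intros r [x [Hx ->]]. simpl. auto. }
  pose proof PI_RGT_0.
  destruct (Lub_Rbar S); simpl in *; [easy|easy|].
  eapply Rle_trans; [apply Cmod_ge_0|]. apply (H 0). lra.
Qed.

(** Continuity on a compact interval makes the supremum finite. *)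
Lemma d_2pi_ge (f g : R -> C) (x : R) :
  cont_periodic f -> cont_periodic g -> 0 <= x <= 2 * PI -> Cmod (f x - g x) <= d_2pi f g.
Proof.
  intros [Hf _] [Hg _] Hx.
  assert (Hc : forall y, continuity_pt (fun y => Cmod (f y - g y)) y).
  { intros y. apply continuity_pt_filterlim.
    assert (Hd : continuous (fun y => minus (G := C_NormedModule) (f y) (g y)) y).
    { apply (@continuous_minus R_UniformSpace C_AbsRing C_NormedModule); [apply Hf|apply Hg]. }
    apply (continuous_comp (fun y => minus (G := C_NormedModule) (f y) (g y))
      (fun z : C => Cmod z) y Hd).
    exact (@filterlim_norm C_AbsRing C_NormedModule _). }
  pose proof PI_RGT_0 as HPI.
  destruct (continuity_ab_maj (fun y => Cmod (f y - g y)) 0 (2 * PI)) as [m [Hm _]];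
    [lra|intros; apply Hc|].
  unfold d_2pi, sup_over.
  match goal with |- context [Lub_Rbar ?E] => set (S := E) end.
  destruct (Lub_Rbar_correct S) as [Hub Hl].
  assert (Hle : Rbar_le (Lub_Rbar S) (Cmod (f m - g m))).
  { apply Hl. intros r [y [Hy ->]]. simpl. now apply Hm. }
  assert (Hge : Rbar_le (Cmod (f x - g x)) (Lub_Rbar S)).
  { apply Hub. exists x. easy. }
  destruct (Lub_Rbar S); simpl in *; [easy|easy|easy].
Qed.

(** * Coverings: the upper bound *)

(** Rounding must not increase absolute values, so that rounded coefficients stay in
    the ellipsoid. *)
Lemma round_toward_0 (t : R) :
  exists z : Z, Rabs (IZR z) <= Rabs t /\ Rabs (t - IZR z) <= 1.
Proof.
  assert (P : forall x, 0 <= x -> exists z : Z, Rabs (IZR z) <= x /\ Rabs (x - IZR z) <= 1).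
  { intros x Hx. destruct (nfloor_ex x Hx) as [k Hk]. exists (Z.of_nat k).
    rewrite <- INR_IZR_INZ. pose proof (pos_INR k). rewrite !Rabs_pos_eq; lra. }
  unfold Rabs at 2. destruct (Rcase_abs t) as [H|H].
  - destruct (P (- t)) as [z [H1 H2]]; [lra|]. exists (- z)%Z. rewrite opp_IZR, Rabs_Ropp.
    split; [easy|]. rewrite <- Rabs_Ropp. now replace (- (t - - IZR z)) with (- t - IZR z) by ring.
  - apply P. lra.
Qed.

Lemma round_family (d : nat) : forall u : nat -> R,
  exists p : list Z, length p = d /\ forall i, (i < d)%nat ->
    Rabs (IZR (nth i p 0%Z)) <= Rabs (u i) /\ Rabs (u i - IZR (nth i p 0%Z)) <= 1.
Proof.
  induction d as [|d IH]; intros u.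
  - exists nil. split; [easy|]. intros; lia.
  - destruct (IH (fun i => u (S i))) as [p [Hl Hp]].
    destruct (round_toward_0 (u 0%nat)) as [z Hz].
    exists (z :: p). split; [simpl; lia|]. intros [|i] Hi; [exact Hz|]. apply Hp. lia.
Qed.

Definition lattice_coef (delta : R) (v : list Z * list Z) (i : nat) : C :=
  (delta * IZR (nth i (fst v) 0%Z), delta * IZR (nth i (snd v) 0%Z)).

(** The coefficients of the approximating polynomial are rounded to a grid of mesh
    [delta]; their real parts and their imaginary parts each run through the lattice
    points of one ellipsoid, whence the factor 2 in the exponent. *)
Lemma covering_of_degree (M s s' delta eta : R) (n : nat) :
  0 < M -> 0 < s' < s -> 0 < delta -> 0 < eta ->
  let d := (2 * n + 1)%nat in
  exists l, is_covering cont_periodic d_2pi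
      (5 * M * exp (- (s' * INR n)) / (1 - exp (- (s' / 2))) + eta + INR d * (2 * delta))
      (class_A s M) l /\
    INR (length l) <= exp (2 * (INR d + rsum (fun i =>
      ln (theta_bound (sqrt (INR d) * delta * exp (s' * degree i) / (5 * M)))) d)).
Proof.
  intros HM Hs Hdelta Heta d.
  assert (Hd : 1 <= INR d) by (apply one_le_INR; unfold d; lia).
  assert (Hsq : 0 < sqrt (INR d)) by (apply sqrt_lt_R0; lra).
  set (x := fun i => sqrt (INR d) * delta * exp (s' * degree i) / (5 * M)).
  assert (Hx : forall i, 0 < x i).
  { intros i. unfold x. pose proof (exp_pos (s' * degree i)).
    apply Rdiv_lt_0_compat; [|lra]. repeat apply Rmult_lt_0_compat; lra. }
  destruct (ellipsoid_points d x (INR d) Hx) as [l0 [Hl0 Hin]].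
  exists (map (fun v => trig_poly (lattice_coef delta v) d) (list_prod l0 l0)).
  split; [split|].
  - intros g Hg. apply in_map_iff in Hg as [v [<- _]]. apply trig_poly_cont_periodic.
  - intros f Hf.
    destruct (trig_approximation M s s' f n eta HM Hs Hf Heta) as [b [Hb Hfb]].
    fold d in Hb, Hfb.
    destruct (round_family d (fun i => Re (b i) / delta)) as [p [Lp Hp]].
    destruct (round_family d (fun i => Im (b i) / delta)) as [q [Lq Hq]].
    assert (Hell : forall (c : nat -> R) (r : list Z),
      (forall i, Rabs (c i) <= Cmod (b i)) ->
      (forall i, (i < d)%nat -> Rabs (IZR (nth i r 0%Z)) <= Rabs (c i / delta)) ->
      rsum (fun i => (x i * IZR (nth i r 0%Z)) ^ 2) d <= INR d).
    { intros c r Hc Hr.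
      (* [5 M] is a convenient bound for [sqrt 24 M] *)
      apply Rle_trans with (rsum (fun i => INR d / (25 * M ^ 2)
        * (Cmod (b i) * exp (s' * degree i)) ^ 2) d).
      - apply rsum_le. intros i Hi. specialize (Hr i Hi). specialize (Hc i).
        unfold Rdiv in Hr at 1. rewrite Rabs_mult, (Rabs_pos_eq (/ delta)) in Hr
          by (apply Rlt_le, Rinv_0_lt_compat, Hdelta).
        assert (H1 : (delta * IZR (nth i r 0%Z)) ^ 2 <= Cmod (b i) ^ 2).
        { rewrite <- (pow2_abs (delta * _)). apply pow_incr. split; [apply Rabs_pos|].
          rewrite Rabs_mult, (Rabs_pos_eq delta) by lra.
          apply Rle_trans with (delta * (Rabs (c i) * / delta)); [apply Rmult_le_compat_l; lra|].
          apply Rle_trans with (Rabs (c i)); [right; field; lra|easy]. }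
        replace ((x i * IZR (nth i r 0%Z)) ^ 2) with
          (INR d / (25 * M ^ 2) * ((delta * IZR (nth i r 0%Z)) ^ 2 * exp (s' * degree i) ^ 2)).
        + apply Rmult_le_compat_l.
          * apply Rlt_le, Rdiv_lt_0_compat; [lra|nra].
          * rewrite (Rpow_mult_distr (Cmod _)).
            apply Rmult_le_compat_r; [apply pow2_ge_0|exact H1].
        + unfold x. rewrite <- (sqrt_sqrt (INR d)) at 1 by lra. field. lra.
      - rewrite rsum_scal. apply Rle_trans with (INR d / (25 * M ^ 2) * (24 * M ^ 2)).
        + apply Rmult_le_compat_l; [apply Rlt_le, Rdiv_lt_0_compat; [lra|nra]|exact Hb].
        + replace (INR d / (25 * M ^ 2) * (24 * M ^ 2)) with (INR d * (24 / 25)) by (field; lra).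
          lra. }
    exists (trig_poly (lattice_coef delta (p, q)) d). split.
    + apply (in_map (fun v => trig_poly (lattice_coef delta v) d)), in_prod.
      * apply Hin; [exact Lp|]. apply (Hell (fun i => Re (b i))); [intros; apply re_le_Cmod|].
        intros i Hi. now apply Hp.
      * apply Hin; [exact Lq|]. apply (Hell (fun i => Im (b i))).
        -- intros i. eapply Rle_trans; [apply Rmax_r|apply Rmax_Cmod].
        -- intros i Hi. now apply Hq.
    + apply d_2pi_le. intros t Ht.
      replace (f t - trig_poly (lattice_coef delta (p, q)) d t)%C with
        (f t - trig_poly b d t + (trig_poly b d t - trig_poly (lattice_coef delta (p, q)) d t))%C
        by ring.
      eapply Rle_trans; [apply Cmod_triangle|]. apply Rplus_le_compat; [now apply Hfb|].
      unfold trig_poly. rewrite <- csum_minus, <- rsum_const.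
      apply Cmod_csum_le_bound. intros i Hi.
      replace (b i * cis (fr i * t) - lattice_coef delta (p, q) i * cis (fr i * t))%C
        with ((b i - lattice_coef delta (p, q) i) * cis (fr i * t))%C by ring.
      rewrite Cmod_mult, Cmod_cis, Rmult_1_r.
      destruct (Hp i Hi) as [_ Hp2]. destruct (Hq i Hi) as [_ Hq2].
      unfold lattice_coef; simpl fst; simpl snd.
      set (z1 := IZR (nth i p 0%Z)) in *. set (z2 := IZR (nth i q 0%Z)) in *.
      replace (b i - ((delta * z1)%R, (delta * z2)%R))%C
        with (delta * (Re (b i) / delta - z1), delta * (Im (b i) / delta - z2)).
      * eapply Rle_trans; [apply Cmod_pair_le|].
        rewrite !Rabs_mult, (Rabs_pos_eq delta) by lra. nra.
      * apply injective_projections; simpl; unfold Re, Im; field; lra.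
  - rewrite length_map, length_prod, mult_INR.
    set (X := INR d + rsum (fun i => ln (theta_bound (x i))) d) in *.
    change (INR (length l0) * INR (length l0) <= exp (2 * X)).
    replace (2 * X) with (X + X) by ring. rewrite exp_plus.
    apply Rmult_le_compat; try apply pos_INR; exact Hl0.
Qed.

Lemma ln_le_self (x : R) : 0 < x -> ln x <= x.
Proof.
  intros H. rewrite <- (exp_ln x) at 2 by easy. pose proof (exp_ineq1_le (ln x)). lra.
Qed.

Lemma ln_ge_0 (x : R) : 1 <= x -> 0 <= ln x.
Proof. intros H. rewrite <- ln_1. apply ln_le; lra. Qed.

(** [d] is the number of frequencies, close to [2 T / s], and [d ln d] is the whole
    second-order term of both bounds. *)
Lemma dimension_log_dimension (s u : R) :
  0 < s -> 0 <= u -> exists c, 0 <= c /\ forall T d, 1 <= T -> 1 <= d <= 2 * T / s + u ->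
    d * ln d <= 2 / s * (T * ln T) + c * T /\ d <= c * T.
Proof.
  intros Hs Hu.
  assert (H2s : 0 < 2 / s) by (apply Rdiv_lt_0_compat; lra).
  set (g := 2 / s + u).
  assert (Hg : 0 < g) by (unfold g; lra).
  pose proof (Rabs_pos (ln g)) as HA.
  assert (HgA : 0 <= g * Rabs (ln g)) by (apply Rmult_le_pos; lra).
  exists (u + g * Rabs (ln g) + g). split; [lra|].
  intros T d HT Hd.
  assert (E : 2 * T / s = 2 / s * T) by (field; lra).
  rewrite E in Hd.
  assert (HdT : d <= g * T) by (unfold g; nra).
  pose proof (ln_ge_0 T HT) as HlT. pose proof (ln_le_self T ltac:(lra)) as HlT'.
  assert (Hld : ln d <= Rabs (ln g) + ln T).
  { apply Rle_trans with (ln (g * T)); [apply ln_le; lra|].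
    rewrite ln_mult by lra. pose proof (Rle_abs (ln g)). lra. }
  assert (Hld0 : 0 <= ln d) by (apply ln_ge_0; lra).
  split.
  - apply Rle_trans with ((2 / s * T + u) * ln T + g * T * Rabs (ln g)).
    + apply Rle_trans with (d * (Rabs (ln g) + ln T)); [apply Rmult_le_compat_l; lra|].
      rewrite Rmult_plus_distr_l, Rplus_comm. apply Rplus_le_compat; apply Rmult_le_compat_r; lra.
    + assert (u * ln T <= u * T) by (apply Rmult_le_compat_l; lra). nra.
  - nra.
Qed.

Lemma rsum_scal_plus (a c : R) (u : nat -> R) (N : nat) :
  rsum (fun i => a - c * u i) N = INR N * a - c * rsum u N.
Proof. induction N; [simpl; ring|]. rewrite !rsum_S, S_INR, IHN. ring. Qed.

(** The degree is about the least at which truncation costs a fixed fraction of [eps], and the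
    mesh is [eps / (4 d)] because the sup norm is bounded by the sum of [d] rounding
    errors. Each real coordinate then contributes [ln (sqrt d / eps)] minus its weight, where
    the count in a box would contribute [ln (d / eps)]. *)
Lemma covering_upper (M s : R) : 0 < M -> 0 < s ->
  exists c T0, forall eps, 0 < eps -> T0 <= ln (/ eps) ->
    let T := ln (/ eps) in
    exists l, is_covering cont_periodic d_2pi eps (class_A s M) l /\
      INR (length l) <= exp (2 / s * T ^ 2 + 2 / s * (T * ln T) + c * T).
Proof.
  intros HM Hs.
  set (kap := 1 - exp (- (s / 4))).
  assert (Hkap : 0 < kap).
  { unfold kap. assert (exp (- (s / 4)) < 1); [|lra].
    rewrite <- exp_0. apply exp_increasing. lra. }
  set (E := exp (s / 2)). assert (HE : 0 < E) by apply exp_pos.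
  (* [e^(- s n) <= c1 eps] makes the truncation error at most [eps / 4] *)
  set (c1 := kap / (20 * M * E)).
  assert (Hc1 : 0 < c1) by (apply Rdiv_lt_0_compat; [easy|nra]).
  set (b := Rabs (ln c1)). assert (Hb : 0 <= b) by apply Rabs_pos.
  set (k0 := 10 * M * E + exp (b + s)).
  assert (Hk0 : 0 < k0) by (unfold k0; pose proof (exp_pos (b + s)); nra).
  set (k1 := ln (2 * exp 1 * k0)).
  set (u := 2 * (b / s + 1) + 1).
  assert (Hbs : 0 <= b / s) by (apply Rmult_le_pos; [easy|apply Rlt_le, Rinv_0_lt_compat, Hs]).
  destruct (dimension_log_dimension s u Hs) as [c [Hc Hdim]]; [unfold u; lra|].
  pose proof (Rabs_pos k1) as Hk1.
  exists (c + 2 * (1 + Rabs k1) * c), 1. intros eps Heps HT T. fold T in HT.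
  assert (ET : exp T = / eps) by (apply exp_ln, Rinv_0_lt_compat, Heps).
  assert (HTb : 0 <= (T + b) / s).
  { apply Rmult_le_pos; [lra|]. apply Rlt_le, Rinv_0_lt_compat, Hs. }
  destruct (nfloor_ex _ HTb) as [n0 [Hn1 Hn2]].
  set (n := S n0). assert (En : INR n = INR n0 + 1) by apply S_INR.
  set (v := INR n - T / s).
  assert (Hv : b / s <= v <= b / s + 1).
  { unfold v. replace ((T + b) / s) with (T / s + b / s) in * by (field; lra). lra. }
  assert (En' : INR n = T / s + v) by (unfold v; ring).
  assert (HsT : s * (T / s) = T) by (field; lra).
  assert (Hsb : s * (b / s) = b) by (field; lra).
  set (d := (2 * n + 1)%nat).
  assert (Ed : INR d = 2 * INR n + 1) by (unfold d; rewrite plus_INR, mult_INR; simpl; ring).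
  assert (Hn : 1 <= INR n) by (rewrite En; pose proof (pos_INR n0); lra).
  (* so close to [s] that [s n - s' n] is only the constant [s / 2] *)
  set (s' := s - s / (2 * INR n)).
  assert (Hfr : 0 < s / (2 * INR n) <= s / 2).
  { split; [apply Rdiv_lt_0_compat; lra|]. unfold Rdiv. apply Rmult_le_compat_l; [lra|].
    apply Rinv_le_contravar; lra. }
  assert (Hs' : s / 2 <= s' < s) by (unfold s'; lra).
  assert (Hsn : s' * INR n = s * INR n - s / 2) by (unfold s'; field; lra).
  set (delta := eps / (4 * INR d)).
  assert (Hd1 : 1 <= INR d) by lra.
  assert (Hdelta : 0 < delta) by (apply Rdiv_lt_0_compat; lra).
  destruct (covering_of_degree M s s' delta (eps / 4) n HM ltac:(lra) Hdelta ltac:(lra))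
    as [l [[Hl1 Hl2] Hlen]]. fold d in Hl2, Hlen.
  exists l. split; [split; [exact Hl1|]|].
  - intros f Hf. destruct (Hl2 f Hf) as [y [Hy Hfy]]. exists y. split; [exact Hy|].
    eapply Rle_trans; [exact Hfy|].
    assert (A1 : exp (- (s' * INR n)) <= E * (eps * c1)).
    { rewrite Hsn. replace (- (s * INR n - s / 2)) with (s / 2 + - (s * INR n)) by ring.
      rewrite exp_plus. fold E. apply Rmult_le_compat_l; [lra|].
      apply Rle_trans with (exp (- T + ln c1)).
      - apply exp_le_exp. rewrite En'. pose proof (Rle_abs (- ln c1)) as Hb'.
        rewrite Rabs_Ropp in Hb'. fold b in Hb'. nra.
      - rewrite exp_plus, exp_ln, exp_Ropp, ET, Rinv_inv by easy. lra. }
    assert (A2 : kap <= 1 - exp (- (s' / 2))).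
    { unfold kap. enough (exp (- (s' / 2)) <= exp (- (s / 4))) by lra.
      apply exp_le_exp. lra. }
    assert (A3 : 5 * M * exp (- (s' * INR n)) / (1 - exp (- (s' / 2))) <= eps / 4).
    { apply Rmult_le_reg_r with (1 - exp (- (s' / 2))); [lra|].
      unfold Rdiv at 1. rewrite Rmult_assoc, Rinv_l, Rmult_1_r by lra.
      apply Rle_trans with (eps / 4 * kap); [|apply Rmult_le_compat_l; lra].
      apply Rle_trans with (5 * M * (E * (eps * c1))); [apply Rmult_le_compat_l; lra|].
      right. unfold c1. field. lra. }
    replace (INR d * (2 * delta)) with (eps / 2) by (unfold delta; field; lra). lra.
  - eapply Rle_trans; [exact Hlen|]. apply exp_le_exp.
    assert (Hsq : 0 < sqrt (INR d)) by (apply sqrt_lt_R0; lra).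
    assert (Hsq1 : 1 <= sqrt (INR d)) by (rewrite <- sqrt_1; apply sqrt_le_1; lra).
    assert (Th : rsum (fun i =>
        ln (theta_bound (sqrt (INR d) * delta * exp (s' * degree i) / (5 * M)))) d
      <= rsum (fun i => (k1 + ln (INR d) / 2 + T) - s * degree i) d).
    { apply rsum_le. intros i Hi.
      set (a := degree i). pose proof (exp_pos (s' * a)) as Hea.
      assert (Ha : 0 <= a <= INR n) by (split; [apply degree_ge_0|now apply degree_le]).
      assert (Hxi : 0 < sqrt (INR d) * delta * exp (s' * a) / (5 * M)).
      { apply Rdiv_lt_0_compat; [|lra].
        apply Rmult_lt_0_compat; [now apply Rmult_lt_0_compat|exact Hea]. }
      assert (Hth : theta_bound (sqrt (INR d) * delta * exp (s' * a) / (5 * M))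
        <= 2 * exp 1 * k0 * (sqrt (INR d) * (exp T * exp (- (s * a))))).
      { unfold theta_bound. rewrite (Rmult_assoc (2 * exp 1)).
        apply Rmult_le_compat_l; [pose proof (exp_pos 1); lra|].
        unfold k0. rewrite Rmult_plus_distr_r, Rplus_comm. apply Rplus_le_compat.
        - replace (/ (2 * (sqrt (INR d) * delta * exp (s' * a) / (5 * M))))
            with (10 * M * (sqrt (INR d) * (exp T * exp (- (s' * a))))).
          + replace (10 * M * E * (sqrt (INR d) * (exp T * exp (- (s * a)))))
              with (10 * M * (sqrt (INR d) * (exp T * (E * exp (- (s * a)))))) by ring.
            apply Rmult_le_compat_l; [lra|]. apply Rmult_le_compat_l; [lra|].
            apply Rmult_le_compat_l; [apply Rlt_le, exp_pos|].
            unfold E. rewrite <- exp_plus. apply exp_le_exp.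
            unfold s'. replace (s / (2 * INR n)) with (s * / (2 * INR n)) by easy.
            assert (a * / (2 * INR n) <= / 2).
            { apply Rmult_le_reg_r with (2 * INR n); [lra|].
              rewrite Rmult_assoc, Rinv_l by lra. lra. }
            nra.
          + rewrite exp_Ropp, ET. unfold delta.
            rewrite <- (sqrt_sqrt (INR d)) at 3 by lra. field. lra.
        - rewrite <- (Rmult_1_r 1) at 1.
          replace (exp (b + s) * (sqrt (INR d) * (exp T * exp (- (s * a)))))
            with (sqrt (INR d) * (exp (b + s) * exp T * exp (- (s * a)))) by ring.
          rewrite <- !exp_plus. apply Rmult_le_compat; try lra.
          rewrite <- exp_0. apply exp_le_exp. nra. }
      apply Rle_trans with (ln (2 * exp 1 * k0 * (sqrt (INR d) * (exp T * exp (- (s * a)))))).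
      { apply ln_le; [now apply theta_bound_pos|exact Hth]. }
      pose proof (exp_pos T). pose proof (exp_pos (- (s * a))). pose proof (exp_pos 1).
      assert (P0 : 0 < 2 * exp 1 * k0) by (apply Rmult_lt_0_compat; lra).
      assert (P1 : 0 < exp T * exp (- (s * a))) by (now apply Rmult_lt_0_compat).
      rewrite (ln_mult _ (_ * _)); [|exact P0|now apply Rmult_lt_0_compat].
      rewrite (ln_mult (sqrt _)), (ln_mult (exp T)), !ln_exp by assumption. fold k1.
      assert (Els : ln (sqrt (INR d)) = ln (INR d) / 2).
      { rewrite <- (sqrt_sqrt (INR d)) at 2 by lra. rewrite ln_mult by lra. field. }
      rewrite Els. lra. }
    rewrite rsum_scal_plus, (rsum_degree n : rsum degree d = _) in Th.
    destruct (Hdim T (INR d) HT) as [D1 D2].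
    { split; [easy|]. rewrite Ed, En'. unfold u.
      replace (2 * T / s) with (2 * (T / s)) by (field; lra). lra. }
    (* the main term: completing the square around [n = T / s] *)
    assert (Main : 2 * (INR d * T) - 2 * s * (INR n * (INR n + 1)) <= 2 / s * T ^ 2).
    { rewrite Ed, En'.
      replace (2 / s * T ^ 2) with (2 * T * (T / s)) by (field; lra).
      set (w := T / s) in *. rewrite <- HsT.
      assert (0 <= s * v ^ 2 + s * v) by (assert (0 <= v) by lra; nra).
      nra. }
    assert (Kb : INR d * k1 <= Rabs k1 * (c * T)).
    { pose proof (Rle_abs k1). apply Rle_trans with (INR d * Rabs k1); [apply Rmult_le_compat_l; lra|].
      rewrite Rmult_comm. apply Rmult_le_compat_l; lra. }
    nra.
Qed.

(** * Separated sets: the lower bound *)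

Lemma nth_map_seq (f : nat -> Z) (d i : nat) :
  (i < d)%nat -> nth i (map f (seq 0 d)) 0%Z = f i.
Proof.
  intros H. rewrite (nth_indep _ _ (f 0%nat)) by (now rewrite length_map, length_seq).
  rewrite map_nth, seq_nth by easy. easy.
Qed.

Definition translate (d : nat) (a b : list Z) : list Z :=
  map (fun i => (nth i a 0 + nth i b 0)%Z) (seq 0 d).

Lemma translate_difference (d : nat) (a b : list Z) : length b = d ->
  b = translate d a (map (fun i => (nth i b 0 - nth i a 0)%Z) (seq 0 d)).
Proof.
  intros Hb. apply (nth_ext _ _ 0%Z 0%Z).
  - unfold translate. now rewrite length_map, length_seq.
  - intros i Hi. unfold translate. rewrite !nth_map_seq by lia. ring.
Qed.

Lemma NoDup_list_prod {A B : Type} (l : list A) (l' : list B) :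
  NoDup l -> NoDup l' -> NoDup (list_prod l l').
Proof.
  intros Hl Hl'. induction Hl as [|a l Ha Hl IH]; simpl; [constructor|].
  apply NoDup_app; [|exact IH|].
  - apply NoDup_map_NoDup_ForallPairs; [|exact Hl']. intros x y _ _ E. congruence.
  - intros [x y] H1 H2. apply in_map_iff in H1 as [z [E _]]. injection E as <- <-.
    apply in_prod_iff in H2 as [H2 _]. contradiction.
Qed.

(** Two of these polynomials in the same ball are within [2 eps], so by Parseval's
    identity the squared distance of their integer coefficients is at most [d]. This is
    one more lattice point problem for an ellipsoid, now a round ball. *)
Lemma ball_meets_few_lattice_polys (n : nat) (eps delta : R) (V : list (list Z * list Z)) :
  let d := (2 * n + 1)%nat in
  0 < delta -> INR d * delta ^ 2 = (2 * eps) ^ 2 ->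
  (forall v, In v V -> length (fst v) = d /\ length (snd v) = d) ->
  exists K : nat, INR K <= exp (2 * (INR d + INR d * ln (theta_bound 1))) /\
  forall y, exists W, (length W <= K)%nat /\ forall v, In v V ->
    cont_periodic y /\ d_2pi (trig_poly (lattice_coef delta v) d) y <= eps -> In v W.
Proof.
  intros d Hdelta Hde HV.
  destruct (ellipsoid_points d (fun _ => 1) (INR d)) as [l0 [Hl0 Hin]]; [intros; lra|].
  rewrite rsum_const in Hl0.
  exists (length l0 * length l0)%nat. split.
  { rewrite mult_INR. set (X := INR d + INR d * ln (theta_bound 1)) in *.
    replace (2 * X) with (X + X) by ring. rewrite exp_plus.
    apply Rmult_le_compat; try apply pos_INR; exact Hl0. }
  intros y. set (near := fun v : list Z * list Z =>
    cont_periodic y /\ d_2pi (trig_poly (lattice_coef delta v) d) y <= eps).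
  destruct (classic (exists v0, In v0 V /\ near v0)) as [[v0 [Hv0 Hn0]]|Hno].
  2:{ exists nil. split; [simpl; lia|]. intros v Hv Hn. exfalso. apply Hno. now exists v. }
  exists (map (fun w => (translate d (fst v0) (fst w), translate d (snd v0) (snd w)))
    (list_prod l0 l0)).
  split; [now rewrite length_map, length_prod|].
  intros v Hv Hn. destruct Hn0 as [Hy H0]. destruct Hn as [_ Hv1].
  pose (pc := trig_poly_cont_periodic).
  set (b := fun i => (lattice_coef delta v i - lattice_coef delta v0 i)%C).
  assert (Hb : rsum (fun i => Cmod (b i) ^ 2) d <= (2 * eps) ^ 2).
  { apply trig_poly_parseval. intros x Hx. fold d.
    replace (trig_poly b d x) with
      ((trig_poly (lattice_coef delta v) d x - y x)
        + - (trig_poly (lattice_coef delta v0) d x - y x))%C.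
    - eapply Rle_trans; [apply Cmod_triangle|]. rewrite Cmod_opp.
      pose proof (d_2pi_ge _ y x (pc (lattice_coef delta v) n) Hy Hx) as A1.
      pose proof (d_2pi_ge _ y x (pc (lattice_coef delta v0) n) Hy Hx) as A2.
      fold d in A1, A2. lra.
    - unfold b, trig_poly.
      rewrite (csum_ext (fun i => (lattice_coef delta v i - lattice_coef delta v0 i) * cis (fr i * x))%C
        (fun i => lattice_coef delta v i * cis (fr i * x) - lattice_coef delta v0 i * cis (fr i * x))%C)
        by (intros; ring).
      rewrite csum_minus. ring. }
  assert (Eb : forall i, Cmod (b i) ^ 2 =
    delta ^ 2 * (IZR (nth i (fst v) 0 - nth i (fst v0) 0)%Z ^ 2
      + IZR (nth i (snd v) 0 - nth i (snd v0) 0)%Z ^ 2)).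
  { intros i. rewrite Cmod2_alt, !minus_IZR. unfold b, lattice_coef. simpl. ring. }
  assert (Hsum : rsum (fun i => IZR (nth i (fst v) 0 - nth i (fst v0) 0)%Z ^ 2) d
     + rsum (fun i => IZR (nth i (snd v) 0 - nth i (snd v0) 0)%Z ^ 2) d <= INR d).
  { rewrite <- rsum_plus. apply Rmult_le_reg_l with (delta ^ 2); [nra|].
    rewrite <- rsum_scal, (Rmult_comm _ (INR d)), Hde.
    rewrite <- (rsum_ext _ _ d (fun i _ => Eb i)). exact Hb. }
  assert (P1 : 0 <= rsum (fun i => IZR (nth i (fst v) 0 - nth i (fst v0) 0)%Z ^ 2) d)
    by (apply rsum_ge_0; intros; apply pow2_ge_0).
  assert (P2 : 0 <= rsum (fun i => IZR (nth i (snd v) 0 - nth i (snd v0) 0)%Z ^ 2) d)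
    by (apply rsum_ge_0; intros; apply pow2_ge_0).
  destruct (HV v Hv) as [L1 L2].
  apply in_map_iff.
  exists (map (fun i => (nth i (fst v) 0 - nth i (fst v0) 0)%Z) (seq 0 d),
          map (fun i => (nth i (snd v) 0 - nth i (snd v0) 0)%Z) (seq 0 d)).
  split.
  - simpl fst; simpl snd. rewrite <- !translate_difference by easy. now destruct v.
  - apply in_prod; apply Hin; try (now rewrite length_map, length_seq).
    + erewrite rsum_ext; [|intros i Hi; rewrite Rmult_1_l, nth_map_seq by exact Hi; reflexivity].
      lra.
    + erewrite rsum_ext; [|intros i Hi; rewrite Rmult_1_l, nth_map_seq by exact Hi; reflexivity].
      lra.
Qed.

(** The candidates have coefficients of modulus at most [M e^(- s |k|) / d], which keeps
    the sum of the [d] terms below [M] on the strip. Up to a constant factor, the mesh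
    [2 eps / sqrt d] is the finest for which a ball of radius [eps] contains at most
    [const^d] candidates. *)
Lemma packing_of_degree (M s eps : R) (n : nat) (l : list (R -> C)) :
  let d := (2 * n + 1)%nat in
  0 < M -> 0 < eps -> is_covering cont_periodic d_2pi eps (class_A s M) l ->
  exp (2 * (rsum (fun i => ln (M * exp (- (s * degree i)) / (4 * sqrt (INR d) * eps))) d
        - (INR d + INR d * ln (theta_bound 1)))) <= INR (length l).
Proof.
  intros d HM Heps [Hl1 Hl2].
  assert (Hd : 1 <= INR d) by (apply one_le_INR; unfold d; lia).
  assert (Hsq : 0 < sqrt (INR d)) by (apply sqrt_lt_R0; lra).
  assert (Hsqd : sqrt (INR d) * sqrt (INR d) = INR d) by (apply sqrt_sqrt; lra).
  set (delta := 2 * eps / sqrt (INR d)).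
  assert (Hdelta : 0 < delta) by (apply Rdiv_lt_0_compat; lra).
  assert (Hde : INR d * delta ^ 2 = (2 * eps) ^ 2).
  { unfold delta. replace ((2 * eps / sqrt (INR d)) ^ 2) with ((2 * eps) ^ 2 / (sqrt (INR d) * sqrt (INR d)))
      by (field; lra).
    rewrite Hsqd. field. lra. }
  set (X := fun i => M * exp (- (s * degree i)) / (4 * sqrt (INR d) * eps)).
  assert (HX : forall i, 0 < X i).
  { intros i. apply Rdiv_lt_0_compat; repeat apply Rmult_lt_0_compat; try lra. apply exp_pos. }
  destruct (box_points d X HX) as [box [Nbox [Hbox Lbox]]].
  set (V := list_prod box box).
  assert (HV : forall v, In v V -> length (fst v) = d /\ length (snd v) = d).
  { intros [p q] Hv. apply in_prod_iff in Hv as [H1 H2]. now split; apply Hbox. }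
  destruct (ball_meets_few_lattice_polys n eps delta V Hdelta Hde HV) as [K [HK HW]].
  fold d in HK, HW.
  assert (Hcov : forall v, In v V -> exists y, In y l /\
    (cont_periodic y /\ d_2pi (trig_poly (lattice_coef delta v) d) y <= eps)).
  { intros v Hv. destruct (Hl2 (trig_poly (lattice_coef delta v) d)) as [y [Hy Hd2]].
    - apply trig_poly_class_A.
      apply Rle_trans with (rsum (fun _ => M / INR d) d);
        [|rewrite rsum_const; right; field; lra].
      apply rsum_le. intros i Hi. destruct v as [p q]. apply in_prod_iff in Hv as [H1 H2].
      apply Hbox in H1 as [_ H1]. apply Hbox in H2 as [_ H2].
      specialize (H1 i Hi). specialize (H2 i Hi).
      apply Rle_trans with (2 * delta * X i * exp (s * degree i)).
      + apply Rmult_le_compat_r; [apply Rlt_le, exp_pos|].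
        eapply Rle_trans; [apply Cmod_pair_le|]. simpl fst; simpl snd.
        rewrite !Rabs_mult, !(Rabs_pos_eq delta), !Rabs_pos_eq by lra. nra.
      + right. unfold X. rewrite exp_Ropp. unfold delta.
        replace (M / INR d) with (M / (sqrt (INR d) * sqrt (INR d))) by (now rewrite Hsqd).
        field. pose proof (exp_pos (s * degree i)). lra.
    - exists y. auto. }
  assert (NV : NoDup V) by (now apply NoDup_list_prod).
  pose proof (length_le_fibers _ V K NV HW l Hcov) as Hlen.
  apply le_INR in Hlen. rewrite mult_INR in Hlen.
  unfold V in Hlen. rewrite length_prod, mult_INR in Hlen.
  set (A := rsum (fun i => ln (X i)) d) in *.
  set (B := INR d + INR d * ln (theta_bound 1)) in *.
  change (exp (2 * (A - B)) <= INR (length l)).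
  apply Rmult_le_reg_r with (exp (2 * B)); [apply exp_pos|].
  rewrite <- exp_plus. replace (2 * (A - B) + 2 * B) with (A + A) by ring. rewrite exp_plus.
  apply Rle_trans with (INR (length box) * INR (length box)).
  { apply Rmult_le_compat; try (apply Rlt_le, exp_pos); exact Lbox. }
  eapply Rle_trans; [exact Hlen|]. apply Rmult_le_compat_l; [apply pos_INR|exact HK].
Qed.

(** The bound of [packing_of_degree] is nearly largest for the degree at which the
    admissible coefficients become smaller than [eps]. *)
Lemma covering_lower (M s : R) : 0 < M -> 0 < s ->
  exists c T0, forall eps, 0 < eps -> T0 <= ln (/ eps) ->
    let T := ln (/ eps) in
    forall l, is_covering cont_periodic d_2pi eps (class_A s M) l ->
      exp (2 / s * T ^ 2 - 2 / s * (T * ln T) - c * T) <= INR (length l).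
Proof.
  intros HM Hs.
  set (k := 1 + ln (theta_bound 1) - ln (M / 4)).
  destruct (dimension_log_dimension s 1 Hs ltac:(lra)) as [c [Hc Hdim]].
  pose proof (Rabs_pos k) as Hk.
  exists (c + 2 * Rabs k * c), 1. intros eps Heps HT T l Hl. fold T in HT.
  assert (ET : exp T = / eps) by (apply exp_ln, Rinv_0_lt_compat, Heps).
  assert (HTs : 0 <= T / s).
  { apply Rmult_le_pos; [lra|]. apply Rlt_le, Rinv_0_lt_compat, Hs. }
  destruct (nfloor_ex _ HTs) as [n [Hn1 Hn2]].
  pose proof (packing_of_degree M s eps n l HM Heps Hl) as Hp. cbv zeta in Hp.
  set (d := (2 * n + 1)%nat) in *.
  assert (Ed : INR d = 2 * INR n + 1) by (unfold d; rewrite plus_INR, mult_INR; simpl; ring).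
  assert (Hd1 : 1 <= INR d) by (pose proof (pos_INR n); lra).
  eapply Rle_trans; [|exact Hp]. apply exp_le_exp.
  assert (Hsq : 0 < sqrt (INR d)) by (apply sqrt_lt_R0; lra).
  rewrite (rsum_ext _ (fun i => (ln (M / 4) - ln (INR d) / 2 + T) - s * degree i)).
  2:{ intros i _. set (a := degree i).
      replace (M * exp (- (s * a)) / (4 * sqrt (INR d) * eps))
        with (M / 4 * (/ sqrt (INR d) * (exp T * exp (- (s * a)))))
        by (rewrite ET; field; lra).
      assert (P1 : 0 < exp T * exp (- (s * a))) by (apply Rmult_lt_0_compat; apply exp_pos).
      assert (P2 : 0 < / sqrt (INR d)) by (now apply Rinv_0_lt_compat).
      rewrite (ln_mult (M / 4)); [|lra|now apply Rmult_lt_0_compat].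
      rewrite (ln_mult (/ _)) by assumption.
      rewrite (ln_mult (exp T)) by apply exp_pos.
      rewrite !ln_exp, ln_Rinv by easy.
      assert (Els : ln (sqrt (INR d)) = ln (INR d) / 2).
      { rewrite <- (sqrt_sqrt (INR d)) at 2 by lra. rewrite ln_mult by lra. field. }
      rewrite Els. lra. }
  rewrite rsum_scal_plus, (rsum_degree n : rsum degree d = _).
  set (v := T / s - INR n). assert (En : INR n = T / s - v) by (unfold v; ring).
  assert (Hv : 0 <= v <= 1) by (unfold v; lra).
  assert (HsT : s * (T / s) = T) by (field; lra).
  destruct (Hdim T (INR d) HT) as [D1 D2].
  { split; [easy|]. rewrite Ed. replace (2 * T / s) with (2 * (T / s)) by (field; lra). lra. }
  assert (Main : 2 / s * T ^ 2 <= 2 * (INR d * T) - 2 * s * (INR n * (INR n + 1))).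
  { rewrite Ed, En.
    replace (2 / s * T ^ 2) with (2 * T * (T / s)) by (field; lra).
    set (w := T / s) in *. rewrite <- HsT.
    assert (0 <= s * (v - v ^ 2)) by (apply Rmult_le_pos; nra).
    nra. }
  assert (Kb : INR d * k <= Rabs k * (c * T)).
  { pose proof (Rle_abs k). apply Rle_trans with (INR d * Rabs k); [apply Rmult_le_compat_l; lra|].
    rewrite Rmult_comm. apply Rmult_le_compat_l; lra. }
  unfold k in Kb at 1. nra.
Qed.

(** * The entropy expansion *)

Lemma covering_number_exists {T : Type} (X : T -> Prop) (d : T -> T -> R) (eps : R) (K : T -> Prop) :
  (exists l, is_covering X d eps K l) -> exists N, is_covering_number X d eps K N.
Proof.
  intros [l Hl]. remember (length l) as n eqn:En. revert l Hl En.
  induction n as [n IH] using (well_founded_induction lt_wf). intros l Hl En.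
  destruct (classic (exists l', is_covering X d eps K l' /\ (length l' < n)%nat)) as [[l' [H1 H2]]|H].
  - exact (IH _ H2 l' H1 eq_refl).
  - exists n. split; [now exists l|]. intros l' Hl'.
    destruct (le_lt_dec n (length l')) as [H1|H1]; [easy|]. exfalso. eauto.
Qed.

(** Natural logarithms of the two bounds, the quadratic terms agreeing exactly. *)
Lemma entropy_two_sided (M s : R) : 0 < M -> 0 < s ->
  exists c T0, 0 <= c /\ forall eps, 0 < eps -> T0 <= ln (/ eps) ->
    let T := ln (/ eps) in
    exists h, is_metric_entropy cont_periodic d_2pi eps (class_A s M) h /\
      Rabs (h * ln 2 - 2 / s * T ^ 2) <= 2 / s * (T * ln T) + c * T.
Proof.
  intros HM Hs.
  destruct (covering_upper M s HM Hs) as [c1 [T1 U]].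
  destruct (covering_lower M s HM Hs) as [c2 [T2 L]].
  pose proof (Rabs_pos c1). pose proof (Rabs_pos c2).
  exists (Rabs c1 + Rabs c2), (Rabs T1 + Rabs T2 + 1). split; [lra|].
  intros eps Heps HT T. fold T in HT.
  pose proof (Rle_abs T1). pose proof (Rle_abs T2).
  pose proof (Rabs_pos T1). pose proof (Rabs_pos T2).
  specialize (U eps Heps ltac:(fold T; lra)). specialize (L eps Heps ltac:(fold T; lra)).
  cbv zeta in U, L. fold T in U, L.
  destruct U as [l [Hl1 Hl2]].
  destruct (covering_number_exists cont_periodic d_2pi eps (class_A s M)) as [N HN]; [now exists l|].
  exists (log (INR N)). split; [exists N; now split|].
  destruct HN as [[l' [Hl' <-]] Hmin].
  specialize (L l' Hl').
  assert (HU : INR (length l') <= exp (2 / s * T ^ 2 + 2 / s * (T * ln T) + c1 * T)).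
  { eapply Rle_trans; [apply le_INR, Hmin, Hl1|exact Hl2]. }
  assert (Hpos : 0 < INR (length l')) by (eapply Rlt_le_trans; [apply exp_pos|exact L]).
  apply ln_le in L; [|apply exp_pos]. rewrite ln_exp in L.
  apply ln_le in HU; [|exact Hpos]. rewrite ln_exp in HU.
  pose proof ln_lt_2. replace (log (INR (length l')) * ln 2) with (ln (INR (length l')))
    by (unfold log; field; lra).
  pose proof (Rle_abs c1). pose proof (Rle_abs c2).
  assert (c1 * T <= Rabs c1 * T) by (apply Rmult_le_compat_r; lra).
  assert (c2 * T <= Rabs c2 * T) by (apply Rmult_le_compat_r; lra).
  assert (0 <= Rabs c1 * T) by (apply Rmult_le_pos; lra).
  assert (0 <= Rabs c2 * T) by (apply Rmult_le_pos; lra).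
  apply Rabs_le. lra.
Qed.

Definition clamp (x : R) : R := Rmax (-1) (Rmin 1 x).

Lemma Rabs_clamp (x : R) : Rabs (clamp x) <= 1.
Proof.
  unfold clamp. apply Rabs_le. split; [apply Rmax_l|].
  apply Rmax_lub; [lra|apply Rmin_l].
Qed.

Lemma Rabs_minus_clamp (x a : R) : 0 <= a -> Rabs x <= 1 + a -> Rabs (x - clamp x) <= a.
Proof.
  intros Ha Hx. apply Rabs_le_between in Hx. unfold clamp, Rmax, Rmin.
  destruct (Rle_dec 1 x); destruct (Rle_dec (-1) _); apply Rabs_le; lra.
Qed.

Theorem theorem10 (M s : R) (hM : 0 < M) (hs : 0 < s) :
  exists gamma : R -> R,
    (forall eps : R, 0 < eps -> Rabs (gamma eps) <= 1) /\
    exists o1 : R -> R,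
      filterlim o1 (at_right 0) (locally 0) /\
      exists eps0 : R, 0 < eps0 /\
        forall eps : R, 0 < eps < eps0 ->
          is_metric_entropy cont_periodic d_2pi eps (class_A s M)
            (2 * ln 2 / s *
               (log (/ eps) ^ 2 +
                log (/ eps) * log (log (/ eps)) * (gamma eps + o1 eps))).
Proof.
  destruct (entropy_two_sided M s hM hs) as [c [T0 [Hc Hent]]].
  (* the entropy as a function of [eps], with an arbitrary value where it is not defined *)
  set (H := fun eps => epsilon (inhabits 0)
    (is_metric_entropy cont_periodic d_2pi eps (class_A s M))).
  set (rho := fun eps => (H eps * s / (2 * ln 2) - log (/ eps) ^ 2)
    / (log (/ eps) * log (log (/ eps)))).
  (* [gamma] is the normalised error forced into [-1, 1], and [o1] is what sticks out *)
  exists (fun eps => clamp (rho eps)). split; [intros; apply Rabs_clamp|].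
  exists (fun eps => rho eps - clamp (rho eps)).
  set (T1 := Rabs T0 + 3).
  pose proof ln_lt_2 as Hln2.
  assert (Hln2' : ln 2 < 1) by (rewrite <- (ln_exp 1); apply ln_increasing; [lra|
    pose proof (exp_ineq1 1); lra]).
  assert (Hsmall : forall eps T2, 0 < eps < exp (- T2) -> T2 < ln (/ eps)).
  { intros eps T2 He. rewrite ln_Rinv by lra.
    assert (ln eps < - T2) by (rewrite <- (ln_exp (- T2)); apply ln_increasing; lra).
    lra. }
  assert (Key : forall eps, 0 < eps -> T1 < ln (/ eps) ->
    let T := ln (/ eps) in
    0 < ln T /\ log (/ eps) * log (log (/ eps)) <> 0 /\
    is_metric_entropy cont_periodic d_2pi eps (class_A s M) (H eps) /\
    Rabs (rho eps - clamp (rho eps)) <= c * s / 2 / ln T).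
  { intros eps Heps HT T. fold T in HT. pose proof (Rle_abs T0). pose proof (Rabs_pos T0).
    destruct (Hent eps Heps ltac:(fold T; unfold T1 in HT; lra)) as [h [Hh1 Hh2]].
    cbv zeta in Hh2. fold T in Hh2.
    assert (HH : H eps = h).
    { apply (is_metric_entropy_unique cont_periodic d_2pi eps (class_A s M)); [|exact Hh1].
      apply epsilon_spec. now exists h. }
    assert (HT3 : 3 < T) by (unfold T1 in HT; lra).
    assert (HlT : 0 < ln T) by (rewrite <- ln_1; apply ln_increasing; lra).
    split; [exact HlT|].
    (* [log (log (1/eps))] exceeds [ln T / ln 2], since [ln (ln 2) < 0] *)
    assert (Hll : ln (ln 2) < 0) by (rewrite <- ln_1; apply ln_increasing; lra).
    assert (E1 : log (/ eps) = T / ln 2) by reflexivity.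
    assert (E2 : log (T / ln 2) = (ln T - ln (ln 2)) / ln 2).
    { unfold log. f_equal. unfold Rdiv. rewrite ln_mult, ln_Rinv; try lra.
      apply Rinv_0_lt_compat; lra. }
    assert (Hden : 0 < T * (ln T - ln (ln 2))) by (apply Rmult_lt_0_compat; lra).
    assert (E3 : log (/ eps) * log (log (/ eps)) = T * (ln T - ln (ln 2)) / (ln 2 * ln 2)).
    { rewrite E1, E2. field. lra. }
    split.
    { rewrite E3. apply Rgt_not_eq, Rdiv_lt_0_compat; [exact Hden|nra]. }
    split; [now rewrite HH|].
    assert (Hcs : 0 <= c * s / 2 / ln T).
    { apply Rmult_le_pos; [|apply Rlt_le, Rinv_0_lt_compat, HlT].
      assert (0 <= c * s) by (apply Rmult_le_pos; lra). lra. }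
    apply Rabs_minus_clamp; [exact Hcs|].
    assert (E4 : rho eps = (h * ln 2 - 2 / s * T ^ 2) * (s / 2) / (T * (ln T - ln (ln 2)))).
    { unfold rho. rewrite E3, HH, E1. field. repeat split; lra. }
    rewrite E4. unfold Rdiv at 1.
    rewrite Rabs_mult, (Rabs_pos_eq (/ _)) by (apply Rlt_le, Rinv_0_lt_compat, Hden).
    rewrite Rabs_mult, (Rabs_pos_eq (s / 2)) by lra.
    apply Rmult_le_reg_r with (T * (ln T - ln (ln 2))); [exact Hden|].
    rewrite Rmult_assoc, Rinv_l, Rmult_1_r by lra.
    apply Rle_trans with ((2 / s * (T * ln T) + c * T) * (s / 2)).
    { apply Rmult_le_compat_r; [lra|exact Hh2]. }
    replace ((2 / s * (T * ln T) + c * T) * (s / 2)) with (T * ((1 + c * s / 2 / ln T) * ln T))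
      by (field; lra).
    replace ((1 + c * s / 2 / ln T) * (T * (ln T - ln (ln 2))))
      with (T * ((1 + c * s / 2 / ln T) * (ln T - ln (ln 2)))) by ring.
    apply Rmult_le_compat_l; [lra|]. apply Rmult_le_compat_l; lra. }
  split.
  - apply filterlim_locally. intros e. pose proof (cond_pos e) as He.
    assert (Hcs : 0 <= c * s / 2).
    { assert (0 <= c * s) by (apply Rmult_le_pos; lra). lra. }
    set (T2 := Rmax T1 (exp (c * s / 2 / e + 1))).
    exists (mkposreal _ (exp_pos (- T2))). intros eps Hball Hpos.
    assert (Hb : Rabs (eps - 0) < exp (- T2)) by exact Hball.
    rewrite Rminus_0_r, Rabs_pos_eq in Hb by lra.
    pose proof (Hsmall eps T2 (conj Hpos Hb)) as HT.
    pose proof (Rmax_l T1 (exp (c * s / 2 / e + 1))) as M1.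
    pose proof (Rmax_r T1 (exp (c * s / 2 / e + 1))) as M2. fold T2 in M1, M2.
    destruct (Key eps Hpos ltac:(lra)) as [HlT [_ [_ Ho]]]. cbv zeta in *.
    set (T := ln (/ eps)) in *.
    assert (HlT' : c * s / 2 / e + 1 <= ln T).
    { rewrite <- (ln_exp (c * s / 2 / e + 1)). apply ln_le; [apply exp_pos|lra]. }
    change (Rabs (rho eps - clamp (rho eps) - 0) < e). rewrite Rminus_0_r.
    eapply Rle_lt_trans; [exact Ho|].
    apply Rmult_lt_reg_r with (ln T); [exact HlT|].
    unfold Rdiv at 1. rewrite Rmult_assoc, Rinv_l, Rmult_1_r by lra.
    apply Rlt_le_trans with (e * (c * s / 2 / e + 1)).
    + replace (e * (c * s / 2 / e + 1)) with (c * s / 2 + e) by (field; lra). lra.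
    + apply Rmult_le_compat_l; lra.
  - exists (exp (- T1)). split; [apply exp_pos|]. intros eps Heps.
    destruct (Key eps ltac:(lra) (Hsmall _ _ Heps)) as [_ [Hne [Hent' _]]].
    replace (2 * ln 2 / s * _) with (H eps); [exact Hent'|].
    replace (clamp (rho eps) + (rho eps - clamp (rho eps))) with (rho eps) by ring.
    unfold rho.
    set (D := log (/ eps) * log (log (/ eps))) in *.
    field. repeat split; lra.
Qed.
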